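(* Let $\beta\in\Omega^2_H(M)$ be a horizontal magnetic field on a three-dimensional contact sub-Riemannian manifold $M$ which defines the lifted sub-Riemannian structure $(\overline M,\overline{\mathcal{D}},\overline g)$ on $\overline M=M\times\mathbb{R}$ (the lifted distribution $\overline{\mathcal{D}}$ being bracket generating). Then: (a) normal extremal trajectories of $\overline M$ project onto magnetic geodesics on $M$; (b) abnormal extremal trajectories of $\overline M$ project onto horizontal curves $\gamma$ on $M$ satisfying $\iota_{\dot\gamma}\beta=\beta(\dot\gamma,\cdot)=0$. Moreover, in the region where $\beta$ is non-vanishing, the lifted distribution $\overline{\mathcal{D}}$ has step $3$ on $\overline M$, and for every $\overline p\in\overline M$ (in that region) there exists a unique abnormal extremal trajectory $\overline\gamma$ passing through $\overline p$.
   Context: A three-dimensional contact sub-Riemannian manifold is a smooth connected 3-manifold $M$ with a smooth one-form $\omega$ such that $\omega\wedge d\omega\neq0$ everywhere, the rank-two distribution $\mathcal{D}=\ker\omega$, and a smooth metric $g$ on $\mathcal{D}$ normalized so that the area form of $g$ on $\mathcal{D}$ equals $-d\omega|_{\mathcal{D}}$. The Reeb vector field $X_0$ is determined by $\omega(X_0)=1$, $\iota_{X_0}d\omega=0$. $\{X_1,X_2\}$ denotes a (local) orthonormal frame of $\mathcal{D}$ with $-d\omega(X_1,X_2)=1$, and $\{\nu_1,\nu_2,\omega\}$ is the coframe dual to $\{X_1,X_2,X_0\}$. Horizontal forms: $\Omega^1_H(M)=\mathrm{span}\{\nu_1,\nu_2\}$ and $\Omega^2_H(M)=\mathrm{span}\{\nu_1\wedge\omega,\nu_2\wedge\omega\}$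 (spans over $C^\infty$). The Rumin differential on $A\in\Omega^1_H(M)$ is $d_HA=d\big(A+dA(X_1,X_2)\,\omega\big)\in\Omega^2_H(M)$. A horizontal magnetic field is a closed form $\beta\in\Omega^2_H(M)$; a horizontal magnetic potential for it is $A\in\Omega^1_H(M)$ with $\beta=d_HA$ (assumed to exist globally; otherwise everything is understood locally). Lifted structure: on $\overline M=M\times\mathbb{R}$, with coordinate $w$ on $\mathbb{R}$, let $Y_i=X_i+A(X_i)\partial_w$ ($i=1,2$), $\overline{\mathcal{D}}=\mathrm{span}\{Y_1,Y_2\}$, and let $\overline g$ be the metric on $\overline{\mathcal{D}}$ for which $Y_1,Y_2$ are orthonormal. The region where $\beta$ is non-vanishing is, in $\overline M$, the set of points $(p,w)$ with $\beta|_p\neq0$. For a distribution $\mathcal{E}$, put $\mathcal{E}^1=\mathcal{E}$, $\mathcal{E}^{k+1}=\mathrm{span}\{\mathcal{E}^k,[\mathcal{E},\mathcal{E}^k]\}$; it is bracket generating of step $k$ at a point $p$ if $\mathcal{E}^k_p$ is the whole tangent space and $\mathcal{E}^j_p$ is not for $j<k$; it is bracket generating if it is so, with some finite step, at every point. A curve is horizontal if it is absolutely continuous with velocity in the distribution a.e., with $L^\infty$ controls. Hamiltonian vector fields $\vec H$ on a cotangent bundle are defined by $\sigma(\cdot,\vec H)=dH$ with $\sigma=ds$ the canonical symplectic form ($s$ the tautological one-form). Normal extremal trajectories of $\overline M$ are projections to $\overline M$ of integral curves of the Hamiltonian vector field of $\overline H(\zeta)=\frac12\sum_{i=1}^2\langle\zeta,Y_i\rangle^2$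 on $T^*\overline M$. Abnormal extremal trajectories are the horizontal curves that are critical points of the end-point map; equivalently, horizontal curves $\overline\gamma$ with $\dot{\overline\gamma}=u_1Y_1+u_2Y_2$ admitting a Lipschitz, never vanishing lift $\zeta(t)\in T^*_{\overline\gamma(t)}\overline M$ with $\langle\zeta(t),Y_1\rangle=\langle\zeta(t),Y_2\rangle=0$ and $\dot\zeta=u_1\vec\zeta_1+u_2\vec\zeta_2$ a.e., where $\zeta_i(\zeta)=\langle\zeta,Y_i\rangle$. Magnetic geodesics on $M$ (with charge $q\in\mathbb{R}$) are projections to $M$ of integral curves of the Hamiltonian vector field of $H_A(\lambda)=\frac12\sum_{i=1}^2(\langle\lambda,X_i\rangle+qA(X_i))^2$ on $T^*M$; in (a) the charge may be any real number depending on the extremal. *)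

(* Defs.v *)
From HB Require Import structures.
From mathcomp Require Export all_boot all_order all_algebra.
From mathcomp Require Export all_classical all_reals all_analysis.
Set Implicit Arguments.
Unset Strict Implicit.
Unset Printing Implicit Defensive.
Import Order.TTheory GRing.Theory Num.Theory.
Import numFieldNormedType.Exports.
Local Open Scope classical_set_scope.
Local Open Scope ring_scope.

(* All iterated directional derivatives are Frechet differentiable on the open
   set U, which is the usual C^oo. *)
Fixpoint diff_upto (R : realType) (V W : normedModType R) (k : nat)
    (U : set V) (f : V -> W) : Prop :=
  match k with
  | 0 => forall x, U x -> {for x, continuous f}
  | k'.+1 => (forall x, U x -> differentiable f x) /\
             forall v, diff_upto k' U ('D_v f)
  end.

Definition smooth (R : realType) (V W : normedModType R) (U : set V)
  (f : V -> W) : Prop := forall k, diff_upto k U f.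

(* cinv is only meaningful on cmap @` cdom. *)
Record chart (R : realType) (n : nat) (T : Type) := Chart {
  cdom : set T;
  cmap : T -> 'rV[R]_n;
  cinv : 'rV[R]_n -> T }.

(* A smooth structure is presented by an atlas together with a choice of a
   preferred chart ch p around each point p; since the charts (ch p)_p already
   form an atlas of the same structure, only these are kept.  The tangent space
   at p is 'rV_n and the cotangent space is 'cV_n, both read in the chart ch p.
   Hence a vector field is a function T -> 'rV_n, a one-form a function
   T -> 'cV_n, a two-form a function B : T -> 'M_n with
   B(u, v) = u *m B *m v^T; all of them transform by Jacobians when read in
   another chart. *)
Notation charted R n T := (T -> chart R n T).

Definition smooth_manifold (R : realType) (n : nat) (M : topologicalType)
    (ch : charted R n M) : Prop :=
  [/\ hausdorff_space M, @second_countable M,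
   (forall p, [/\ cdom (ch p) p, open (cdom (ch p)),
      open (cmap (ch p) @` cdom (ch p)),
      {in cdom (ch p), cancel (cmap (ch p)) (cinv (ch p))} &
      {within cdom (ch p), continuous (cmap (ch p))} /\
      {within cmap (ch p) @` cdom (ch p), continuous (cinv (ch p))}]) &
   (forall p q, smooth (cmap (ch p) @` (cdom (ch p) `&` cdom (ch q)))
                       (cmap (ch q) \o cinv (ch p)))].

Section Charted.
Context {R : realType} {n : nat} {T : Type}.
Variable ch : charted R n T.
Implicit Types (p q : T) (U : set T) (u v w : 'rV[R]_n).

Definition pairing (a : 'cV[R]_n) v : R := (v *m a) 0 0.
Definition form2 (B : 'M[R]_n) u v : R := (u *m B *m v^T) 0 0.

Definition wedge11 (a b : 'cV[R]_n) : 'M[R]_n := a *m b^T - b *m a^T.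
Definition wedge12 (a : 'cV[R]_n) (B : 'M[R]_n) u v w : R :=
  pairing a u * form2 B v w + pairing a v * form2 B w u
  + pairing a w * form2 B u v.

(* Jacobian at q of the change of coordinates from ch p to ch p'; vectors are
   rows, so (components in ch p') = (components in ch p) *m trans_jac p p' q. *)
Definition trans_jac p p' q : 'M[R]_n :=
  'J (cmap (ch p') \o cinv (ch p)) (cmap (ch p) q).

(* Coordinate expressions in the chart ch p, as functions on 'rV_n. *)
Definition fun_in p (f : T -> R) (x : 'rV[R]_n) : R := f (cinv (ch p) x).
Definition vec_in p (X : T -> 'rV[R]_n) (x : 'rV[R]_n) : 'rV[R]_n :=
  let q := cinv (ch p) x in X q *m trans_jac q p q.
Definition cov_in p (a : T -> 'cV[R]_n) (x : 'rV[R]_n) : 'cV[R]_n :=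
  let q := cinv (ch p) x in trans_jac p q q *m a q.
Definition form2_in p (B : T -> 'M[R]_n) (x : 'rV[R]_n) : 'M[R]_n :=
  let q := cinv (ch p) x in trans_jac p q q *m B q *m (trans_jac p q q)^T.

Definition image_in p U : set 'rV[R]_n := cmap (ch p) @` (cdom (ch p) `&` U).

Definition smooth_fun U (f : T -> R) :=
  forall p, smooth (image_in p U) (fun_in p f).
Definition smooth_vec U (X : T -> 'rV[R]_n) :=
  forall p, smooth (image_in p U) (vec_in p X).
Definition smooth_cov U (a : T -> 'cV[R]_n) :=
  forall p, smooth (image_in p U) (cov_in p a).
Definition smooth_form2 U (B : T -> 'M[R]_n) :=
  (forall p, U p -> (B p)^T = - B p) /\
  forall p, smooth (image_in p U) (form2_in p B).

Definition dfun (f : T -> R) p v : R := 'D_v (fun_in p f) (cmap (ch p) p).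

(* da(u, v) = u(a(v)) - v(a(u)) - a([u, v]), without a factor 1/2 *)
Definition dform1 (a : T -> 'cV[R]_n) p : 'M[R]_n :=
  \matrix_(i, j)
    (('D_(delta_mx 0 i) (cov_in p a) (cmap (ch p) p)) j 0
     - ('D_(delta_mx 0 j) (cov_in p a) (cmap (ch p) p)) i 0).

Definition closed_form2 (B : T -> 'M[R]_n) := forall p u v w,
  let dB z := 'D_z (form2_in p B) (cmap (ch p) p) in
  form2 (dB u) v w + form2 (dB v) w u + form2 (dB w) u v = 0.

Definition lie_bracket (X Y : T -> 'rV[R]_n) p : 'rV[R]_n :=
  'D_(X p) (vec_in p Y) (cmap (ch p) p) - 'D_(Y p) (vec_in p X) (cmap (ch p) p).

Definition has_velocity (c : R -> T) (t : R) v :=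
  (\forall s \near t, cdom (ch (c t)) (c s)) /\
  is_derive t 1 (cmap (ch (c t)) \o c) v.

End Charted.

Section Cotangent.
Context {R : realType} {n : nat} {T : Type}.
Variable ch : charted R n T.

(* The chart (x, xi) of the cotangent bundle induced by ch p. *)
Definition cotangent : charted R (n + n) (T * 'cV[R]_n) := fun z0 =>
  let p := z0.1 in
  Chart [set z | cdom (ch p) z.1]
    (fun z => row_mx (cmap (ch p) z.1) (trans_jac ch p z.1 z.1 *m z.2)^T)
    (fun y => let q := cinv (ch p) (lsubmx y) in
              (q, trans_jac ch q p q *m (rsubmx y)^T)).

Definition tautological (z : T * 'cV[R]_n) : 'cV[R]_(n + n) := col_mx z.2 0.

(* h is the value at z of the Hamiltonian vector field of H:
   sigma(., h) = dH with sigma = ds. *)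
Definition hamiltonian_vector (H : T * 'cV[R]_n -> R) (z : T * 'cV[R]_n)
    (h : 'rV[R]_(n + n)) :=
  forall v, form2 (dform1 cotangent tautological z) v h = dfun cotangent H z v.

(* Gamma is an integral curve of the Hamiltonian vector field of H, as long as
   its base point stays in the domain U of H. *)
Definition hamiltonian_curve (U : set T) (H : T * 'cV[R]_n -> R) (I : set R)
    (Gamma : R -> T * 'cV[R]_n) :=
  forall t, I t -> U (Gamma t).1 ->
    exists2 h, hamiltonian_vector H (Gamma t) h
             & has_velocity cotangent Gamma t h.

End Cotangent.

Section Curves.
Context {R : realType} {n : nat} {T : Type}.
Variable ch : charted R n T.

Definition abs_continuous (a b : R) (f : R -> 'rV[R]_n) :=
  forall e, 0 < e -> exists2 d, 0 < d &
    forall (N : nat) (s t : 'I_N -> R),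
      (forall i, a <= s i /\ s i <= t i /\ t i <= b) ->
      (forall i j, i != j -> t i <= s j \/ t j <= s i) ->
      \sum_i (t i - s i) < d -> \sum_i `|f (t i) - f (s i)| < e.

Definition abs_continuous_curve (a b : R) (c : R -> T) :=
  forall t, a <= t <= b -> exists2 e, 0 < e &
    (forall s, Num.max a (t - e) <= s <= Num.min b (t + e) ->
       cdom (ch (c t)) (c s)) /\
    abs_continuous (Num.max a (t - e)) (Num.min b (t + e))
      (cmap (ch (c t)) \o c).

Definition lipschitz_curve (a b : R) (c : R -> T) :=
  forall t, a <= t <= b -> exists2 e, 0 < e & exists L : R,
    (forall s, a <= s <= b -> `|s - t| < e -> cdom (ch (c t)) (c s)) /\
    (forall s s', a <= s <= b -> a <= s' <= b ->
       `|s - t| < e -> `|s' - t| < e ->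
       `|cmap (ch (c t)) (c s) - cmap (ch (c t)) (c s')| <= L * `|s - s'|).

End Curves.

Section Distributions.
Context {R : realType} {n : nat} {T : topologicalType}.
Variable ch : charted R n T.

(* flag E U k X: the vector field X is, over U, a section of E^k. *)
Inductive flag (E : T -> set 'rV[R]_n) (U : set T) :
    nat -> (T -> 'rV[R]_n) -> Prop :=
| flag_base X : smooth_vec ch U X -> (forall p, U p -> E p (X p)) ->
    flag E U 1 X
| flag_incl k X : flag E U k X -> flag E U k.+1 X
| flag_bracket k X Y : flag E U 1 X -> flag E U k Y ->
    flag E U k.+1 (lie_bracket ch X Y)
| flag_add k X Y : flag E U k X -> flag E U k Y ->
    flag E U k (fun p => X p + Y p)
| flag_scale k f X : smooth_fun ch U f -> flag E U k X ->
    flag E U k (fun p => f p *: X p).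

Definition flag_at (E : T -> set 'rV[R]_n) (k : nat) (p : T) : set 'rV[R]_n :=
  [set v | exists U X, [/\ open U, U p, flag E U k X & X p = v]].

Definition has_step (E : T -> set 'rV[R]_n) (p : T) (k : nat) :=
  [/\ (0 < k)%N, flag_at E k p = setT &
      forall j, (0 < j < k)%N -> flag_at E j p <> setT].

Definition bracket_generating (E : T -> set 'rV[R]_n) :=
  forall p, exists k, has_step E p k.

(* A rank-two sub-Riemannian structure is handled through its local
   orthonormal frames: F U X1 X2 says that (X1, X2) is one of them, over the
   open set U. *)
Definition frames := set T -> (T -> 'rV[R]_n) -> (T -> 'rV[R]_n) -> Prop.

Variable F : frames.

Definition frame_span (p : T) : set 'rV[R]_n :=
  [set v | exists U X1 X2, [/\ F U X1 X2, U p &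
     exists u1 u2, v = u1 *: X1 p + u2 *: X2 p]].

(* The controls (u1, u2) are components in an orthonormal frame, so that
   u1^2 + u2^2 does not depend on the frame. *)
Definition horizontal_curve (a b : R) (c : R -> T) :=
  abs_continuous_curve ch a b c /\
  exists C : R, forall U X1 X2, F U X1 X2 ->
    {ae @lebesgue_measure R, forall t, a <= t <= b -> U (c t) ->
       exists u1 u2, u1 ^+ 2 + u2 ^+ 2 <= C /\
         has_velocity ch c t (u1 *: X1 (c t) + u2 *: X2 (c t))}.

Definition unit_speed (I : set R) (c : R -> T) :=
  forall U X1 X2, F U X1 X2 -> forall t, I t -> U (c t) ->
    exists u1 u2, u1 ^+ 2 + u2 ^+ 2 = 1 /\
      has_velocity ch c t (u1 *: X1 (c t) + u2 *: X2 (c t)).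

Definition momentum (X : T -> 'rV[R]_n) (z : T * 'cV[R]_n) : R :=
  pairing z.2 (X z.1).

Definition normal_trajectory (I : set R) (c : R -> T) :=
  exists zeta : R -> 'cV[R]_n, forall U X1 X2, F U X1 X2 ->
    hamiltonian_curve ch U
      (fun z => 2^-1 * (momentum X1 z ^+ 2 + momentum X2 z ^+ 2))
      I (fun t => (c t, zeta t)).

Definition magnetic_geodesic (A : T -> 'cV[R]_n) (q : R) (I : set R)
    (c : R -> T) :=
  exists lambda : R -> 'cV[R]_n, forall U X1 X2, F U X1 X2 ->
    hamiltonian_curve ch U
      (fun z => 2^-1 *
         ((momentum X1 z + q * pairing (A z.1) (X1 z.1)) ^+ 2
          + (momentum X2 z + q * pairing (A z.1) (X2 z.1)) ^+ 2))
      I (fun t => (c t, lambda t)).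

Definition abnormal_trajectory (a b : R) (c : R -> T) :=
  horizontal_curve a b c /\
  exists zeta : R -> 'cV[R]_n,
  [/\ lipschitz_curve (cotangent ch) a b (fun t => (c t, zeta t)),
      (forall t, a <= t <= b -> zeta t != 0) &
      forall U X1 X2, F U X1 X2 ->
        (forall t, a <= t <= b -> U (c t) ->
           pairing (zeta t) (X1 (c t)) = 0 /\
           pairing (zeta t) (X2 (c t)) = 0) /\
        {ae @lebesgue_measure R, forall t, a <= t <= b -> U (c t) ->
           exists u1 u2 h1 h2,
           [/\ has_velocity ch c t (u1 *: X1 (c t) + u2 *: X2 (c t)),
               hamiltonian_vector ch (momentum X1) (c t, zeta t) h1,
               hamiltonian_vector ch (momentum X2) (c t, zeta t) h2 &
               has_velocity (cotangent ch) (fun s => (c s, zeta s)) t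
                 (u1 *: h1 + u2 *: h2)]}].

End Distributions.

Section Contact.
Context {R : realType} {M : topologicalType}.
Variable ch : charted R 3 M.
Variables (omega : M -> 'cV[R]_3) (g : M -> 'M[R]_3) (X0 : M -> 'rV[R]_3).

Definition contact_distribution (p : M) : set 'rV[R]_3 :=
  [set v | pairing (omega p) v = 0].

Let D := contact_distribution.
Let G p := form2 (g p).

(* Only the restriction of g p to D p is meaningful; the last clause is the
   normalization of the area form, up to the sign that orients D by
   - d omega. *)
Definition contact_sub_riemannian : Prop :=
  [/\ smooth_cov ch setT omega,
      (forall p, exists u v w,
         wedge12 (omega p) (dform1 ch omega p) u v w != 0),
      (forall p u v, D p u -> D p v -> G p u v = G p v u) /\
      (forall p u, D p u -> u != 0 -> 0 < G p u u),
      (forall U X Y, open U -> smooth_vec ch U X -> smooth_vec ch U Y ->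
         (forall p, U p -> D p (X p) /\ D p (Y p)) ->
         smooth_fun ch U (fun p => G p (X p) (Y p))) &
      (forall p u v, D p u -> D p v -> G p u u = 1 -> G p v v = 1 ->
         G p u v = 0 -> `|form2 (dform1 ch omega p) u v| = 1)].

Definition reeb : Prop := forall p,
  pairing (omega p) (X0 p) = 1 /\
  forall v, form2 (dform1 ch omega p) (X0 p) v = 0.

Definition contact_frame : frames := fun U X1 X2 =>
  [/\ open U, smooth_vec ch U X1, smooth_vec ch U X2 &
   forall p, U p ->
     [/\ D p (X1 p) /\ D p (X2 p), G p (X1 p) (X1 p) = 1,
         G p (X2 p) (X2 p) = 1, G p (X1 p) (X2 p) = 0 &
         - form2 (dform1 ch omega p) (X1 p) (X2 p) = 1]].

(* (nu1, nu2, omega) is dual to (X1, X2, X0). *)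
Definition dual_coframe (U : set M) (X1 X2 : M -> 'rV[R]_3)
    (nu1 nu2 : M -> 'cV[R]_3) : Prop := forall p, U p ->
  [/\ pairing (nu1 p) (X1 p) = 1, pairing (nu1 p) (X2 p) = 0 &
      pairing (nu1 p) (X0 p) = 0] /\
  [/\ pairing (nu2 p) (X1 p) = 0, pairing (nu2 p) (X2 p) = 1 &
      pairing (nu2 p) (X0 p) = 0].

Definition horizontal_form1 (A : M -> 'cV[R]_3) : Prop :=
  smooth_cov ch setT A /\
  forall U X1 X2 nu1 nu2, contact_frame U X1 X2 ->
    dual_coframe U X1 X2 nu1 nu2 ->
    exists a1 a2, [/\ smooth_fun ch U a1, smooth_fun ch U a2 &
      forall p, U p -> A p = a1 p *: nu1 p + a2 p *: nu2 p].

Definition horizontal_form2 (B : M -> 'M[R]_3) : Prop :=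
  smooth_form2 ch setT B /\
  forall U X1 X2 nu1 nu2, contact_frame U X1 X2 ->
    dual_coframe U X1 X2 nu1 nu2 ->
    exists b1 b2, [/\ smooth_fun ch U b1, smooth_fun ch U b2 &
      forall p, U p -> B p = b1 p *: wedge11 (nu1 p) (omega p)
                             + b2 p *: wedge11 (nu2 p) (omega p)].

Definition magnetic_field (B : M -> 'M[R]_3) : Prop :=
  horizontal_form2 B /\ closed_form2 ch B.

(* B = d_H A, with dA(X1, X2) evaluated in any local frame. *)
Definition magnetic_potential (B : M -> 'M[R]_3) (A : M -> 'cV[R]_3) : Prop :=
  horizontal_form1 A /\
  forall U X1 X2, contact_frame U X1 X2 -> forall p, U p ->
    B p = dform1 ch (fun q =>
      A q + form2 (dform1 ch A q) (X1 q) (X2 q) *: omega q) p.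

End Contact.

Section Lift.
Context {R : realType} {n : nat} {M : topologicalType}.
Variable ch : charted R n M.

(* M x R with the product charts. *)
Definition times_line : charted R (n + 1) (M * R)%type := fun z0 =>
  Chart [set z | cdom (ch z0.1) z.1]
    (fun z => row_mx (cmap (ch z0.1) z.1) z.2%:M)
    (fun y => (cinv (ch z0.1) (lsubmx y), rsubmx y 0 0)).

Definition lift_vec (A : M -> 'cV[R]_n) (X : M -> 'rV[R]_n) (z : M * R) :
    'rV[R]_(n + 1) :=
  row_mx (X z.1) (pairing (A z.1) (X z.1))%:M.

(* The frames (Y1, Y2); they determine both the lifted distribution, as their
   span, and the lifted metric, for which they are orthonormal. *)
Definition lift_frames (A : M -> 'cV[R]_n) (F : @frames R n M) :
    @frames R (n + 1) (M * R)%type := fun V Y1 Y2 =>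
  exists U X1 X2, [/\ F U X1 X2, V = U `*` setT,
    Y1 = lift_vec A X1 & Y2 = lift_vec A X2].

End Lift.

(* Main.v *)
(* The 1-form eta = dw - alpha on M x R, where alpha = A + dA(X1, X2) omega is the Rumin
   potential (d alpha = beta), together with the pullback of omega, cuts out the lifted
   distribution, and d eta = -beta.
   Step 3: Cartan's formula gives eta([Y1, Y2]) = 0, omega([Y1, Y2]) = 1 and
   eta([Yi, [Y1, Y2]]) = beta(Xi, X0).
   Normal extremals: the lifted Hamiltonian does not depend on w, so the momentum q conjugate
   to w is constant, and for fixed q it is the magnetic Hamiltonian of charge q.
   Abnormal extremals: the covector is k eta + f omega, and Hamilton's equation says that k is
   constant, that f u1 = f u2 = 0 and that f' = k beta(v, X0) for the velocity v; hence v = 0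
   where f <> 0, and beta(v, .) = 0 at every non-isolated zero of f.  The isolated zeros are
   countable.
   Where beta does not vanish, its kernel in the distribution is a line field spanned by the
   unit field Z = (b2 Y1 - b1 Y2) / sqrt (b1^2 + b2^2) with bi = beta(Xi, X0).  A maximal
   integral curve of Z is abnormal, with covector eta; an abnormal curve is Lipschitz and a.e.
   tangent to Z, so that, with a coordinate transverse to Z as time, Gronwall's inequality
   makes it a reparametrization of the integral curve. *)
Require Import Defs.
From HB Require Import structures.
From mathcomp Require Import all_boot all_order all_algebra.
From mathcomp Require Import all_classical all_reals all_analysis.
From mathcomp Require Import ring lra.
Set Implicit Arguments.
Unset Strict Implicit.
Unset Printing Implicit Defensive.
Import Order.TTheory GRing.Theory Num.Theory.
Import numFieldNormedType.Exports.
Local Open Scope classical_set_scope.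
Local Open Scope ring_scope.

(** * Derivatives and smooth maps *)

(** A vector at [q] is read in the chart [ch q] attached to [q], so fields and forms have a
    coordinate expression in one fixed chart only after Jacobians of transitions are inserted.
    Brackets and exterior derivatives become accessible that way, at the price of the symmetry of
    second derivatives of the transitions. Frames are local, and their existence at a point is drawn
    from bracket generation: a flag element over a point forces a frame there. One frame value per
    point is then chosen without any continuity. Expressions invariant under rotations of the frame,
    such as dA(X1, X2) and the field Z, keep their regularity all the same, because they agree with
    their expression in any local frame. The obstacle in the uniqueness claim is that an abnormal
    curve has a velocity only almost everywhere, and its factor along Z may vanish or change sign,
    so in its own time it solves no differential equation. For the same reason the reparametrization
    is merely continuous; it is assembled from local pieces by path lifting along a maximal integral
    curve. *)

Section Derivatives.
Context {R : realType}.

Lemma near_eq_differentiable (V W : normedModType R) (f g : V -> W) x :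
  {near x, f =1 g} -> differentiable f x -> differentiable g x.
Proof.
move=> fg df.
have gx : g x = f x by rewrite (nbhs_singleton fg).
have E : g \o shift x = cst (g x) + 'd f x +o_ 0 id.
  apply/eqaddoP => _/posnumP[e].
  have /eqaddoP/(_ _ (gt0 e)) := diff_locally df.
  have fg0 : \forall h \near (0 : V), f (h + x) = g (h + x).
    have : \near x, f x = g x := fg.
    by rewrite (near_shift 0 x) subr0.
  apply: filter_app; near=> h.
  by rewrite !fctE /= gx (near fg0 h).
have Eg : 'd g x = 'd f x :> (V -> W).
  by apply: diff_unique => //; exact: diff_continuous.
apply/diff_locallyP; split; rewrite Eg //; exact: diff_continuous.
Unshelve. all: by end_near. Qed.

(** [g] need only be derivable along [v]: restricted to the line through [t] in that direction it is
    a function of one real variable, where derivability is differentiability, and the chain rule for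
    differentials applies. *)
Lemma is_derive_comp (U V W : normedModType R) (g : U -> V) (f : V -> W) t v dg :
  differentiable f (g t) -> is_derive t v g dg ->
  is_derive t v (f \o g) ('D_dg f (g t)).
Proof.
move=> df [/derivable1P dgt gE].
pose k := fun h : R => g (h *: v + t).
have k0 : k 0 = g t by rewrite /k scale0r add0r.
have dk : differentiable k 0 by exact/derivable1_diffP.
have dfk : differentiable (f \o k) 0.
  by apply: differentiable_comp => //; rewrite k0.
have line (W' : normedModType R) (F : U -> W') :
    'D_v F t = 'D_1 (fun h : R => F (h *: v + t)) 0.
  rewrite /derive; congr (lim _).
  suff -> : (fun h : R => h^-1 *: ((F \o shift t) (h *: v) - F t)) =
     (fun h : R => h^-1 *: (((fun h0 : R => F (h0 *: v + t)) \o shift 0) (h *: 1)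
       - F (0 *: v + t))) by [].
  by rewrite funeqE => h /=; rewrite addr0 scale0r add0r [_%:A]mulr1.
apply: DeriveDef; first by apply/derivable1P/derivable1_diffP.
rewrite line (deriveE _ dfk) diff_comp //=; last by rewrite k0.
by rewrite k0 deriveE // -gE line -(deriveE _ dk).
Qed.

Lemma is_derive_mxP (V : normedModType R) m n (M : V -> 'M[R]_(m, n)) x v dM :
  is_derive x v M dM <->
  forall i j, is_derive x v (fun y => M y i j) (dM i j).
Proof.
split=> [[dMx <-] i j|H].
  apply: DeriveDef; first by move/derivable_mxP : dMx; exact.
  by rewrite derive_mx // mxE.
have dMx : derivable M x v by apply/derivable_mxP => i j; have [] := H i j.
apply: DeriveDef => //.
rewrite derive_mx //; apply/matrixP => i j; rewrite mxE.
by have [] := H i j.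
Qed.

Lemma is_derive_mulmx (V : normedModType R) m n p
    (A : V -> 'M[R]_(m, n)) (B : V -> 'M[R]_(n, p)) x v dA dB :
  is_derive x v A dA -> is_derive x v B dB ->
  is_derive x v (fun y => A y *m B y) (dA *m B x + A x *m dB).
Proof.
move=> /is_derive_mxP HA /is_derive_mxP HB; apply/is_derive_mxP => i j.
have -> : (fun y => (A y *m B y) i j) =
   \sum_(k < n) ((fun y => A y i k) * (fun y => B y k j)).
  by rewrite funeqE => y; rewrite mxE fct_sumE.
apply: is_derive_eq (is_derive_sum (fun k => is_deriveM (HA i k) (HB k j))) _.
rewrite !mxE -big_split /=; apply: eq_bigr => k _.
by rewrite addrC -[_ *: dA _ _]/(_ * _) mulrC.
Qed.

Lemma is_derive_scalemx (V : normedModType R) m n (f : V -> R)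
    (B : V -> 'M[R]_(m, n)) x v df dB :
  is_derive x v f df -> is_derive x v B dB ->
  is_derive x v (fun y => f y *: B y) (df *: B x + f x *: dB).
Proof.
move=> Hf /is_derive_mxP HB; apply/is_derive_mxP => i j.
have -> : (fun y => (f y *: B y) i j) = f * (fun y => B y i j).
  by rewrite funeqE => y; rewrite mxE.
apply: is_derive_eq (is_deriveM Hf (HB i j)) _.
by rewrite !mxE addrC -[_ *: df]/(_ * _) mulrC.
Qed.

Lemma is_derive_trmx (V : normedModType R) m n (M : V -> 'M[R]_(m, n)) x v dM :
  is_derive x v M dM -> is_derive x v (fun y => (M y)^T) dM^T.
Proof.
move=> /is_derive_mxP H; apply/is_derive_mxP => i j; rewrite mxE.
by under eq_fun do rewrite mxE; exact: H.
Qed.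

Lemma is_derive_row_mx (V : normedModType R) m n1 n2 (A : V -> 'M[R]_(m, n1))
    (B : V -> 'M[R]_(m, n2)) x v dA dB :
  is_derive x v A dA -> is_derive x v B dB ->
  is_derive x v (fun y => row_mx (A y) (B y)) (row_mx dA dB).
Proof.
move=> /is_derive_mxP HA /is_derive_mxP HB; apply/is_derive_mxP => i j.
rewrite mxE; under eq_fun do rewrite mxE.
by case: (fintype.split j) => k; [exact: HA|exact: HB].
Qed.

Lemma is_derive_col_mx (V : normedModType R) m1 m2 n (A : V -> 'M[R]_(m1, n))
    (B : V -> 'M[R]_(m2, n)) x v dA dB :
  is_derive x v A dA -> is_derive x v B dB ->
  is_derive x v (fun y => col_mx (A y) (B y)) (col_mx dA dB).
Proof.
move=> /is_derive_mxP HA /is_derive_mxP HB; apply/is_derive_mxP => i j.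
rewrite mxE; under eq_fun do rewrite mxE.
by case: (fintype.split i) => k; [exact: HA|exact: HB].
Qed.

Lemma is_derive_lsubmx (V : normedModType R) m n1 n2
    (A : V -> 'M[R]_(m, n1 + n2)) x v dA :
  is_derive x v A dA -> is_derive x v (fun y => lsubmx (A y)) (lsubmx dA).
Proof.
move=> /is_derive_mxP HA; apply/is_derive_mxP => i j.
by rewrite mxE; under eq_fun do rewrite mxE; exact: HA.
Qed.

Lemma is_derive_rsubmx (V : normedModType R) m n1 n2
    (A : V -> 'M[R]_(m, n1 + n2)) x v dA :
  is_derive x v A dA -> is_derive x v (fun y => rsubmx (A y)) (rsubmx dA).
Proof.
move=> /is_derive_mxP HA; apply/is_derive_mxP => i j.
by rewrite mxE; under eq_fun do rewrite mxE; exact: HA.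
Qed.

Lemma differentiable_mxP (V : normedModType R) m n (M : V -> 'M[R]_(m, n)) x :
  differentiable M x <-> forall i j, differentiable (fun y => M y i j) x.
Proof.
split=> [dM i j|H].
  apply: (@differentiable_comp _ _ _ _ M (fun N : 'M[R]_(m, n) => N i j)) => //.
  exact: differentiable_coord.
have -> : M = \sum_(i < m) \sum_(j < n) (fun y => M y i j *: delta_mx i j).
  rewrite funeqE => y; rewrite {1}(matrix_sum_delta (M y)).
  by rewrite fct_sumE; apply: eq_bigr => i _; rewrite fct_sumE.
apply: differentiable_sum => i; apply: differentiable_sum => j.
exact: differentiableZl.
Qed.

Lemma is_derive_diff (V W : normedModType R) (f : V -> W) x v :
  differentiable f x -> is_derive x v f ('D_v f x).
Proof. by move=> df; exact/derivableP/diff_derivable. Qed.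

Lemma jacobianE m n (f : 'rV[R]_m -> 'rV[R]_n) x i j :
  differentiable f x -> ('J f x) i j = ('D_(delta_mx 0 i) f x) 0 j.
Proof. by move=> df; rewrite deriveEjacobian -?rowE ?mxE. Qed.

Lemma continuous_mxP (T : topologicalType) m n (M : T -> 'M[R]_(m, n)) x :
  {for x, continuous M} <-> forall i j, {for x, continuous (fun y => M y i j)}.
Proof.
split=> [cM i j|H].
  apply: (@continuous_comp _ _ _ M (fun N : 'M[R]_(m, n) => N i j)) => //.
  exact: coord_continuous.
apply/cvgrPdist_le => /= e e0.
have K : \forall y \near x, forall i j, `|M x i j - M y i j| <= e.
  apply: filter_forall => i; apply: filter_forall => j.
  by have /cvgrPdist_le/(_ _ e0) := H i j.
near=> y.
rewrite /Num.Def.normr /= mx_normrE (bigmax_le _ (ltW e0)) //= => -[i j] _ /=.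
by rewrite !mxE; exact: (near K y).
Unshelve. all: by end_near. Qed.

End Derivatives.

Section SmoothMaps.
Context {R : realType}.
Implicit Types V W : normedModType R.

Lemma is_derive_line V (x u : V) (t : R) :
  is_derive t 1 (fun s : R => s *: u + x) u.
Proof.
have D : is_derive t 1 (fun s : R => s *: u) u.
  have := @is_diff_scalel R V t u => -[d1 d2]; apply: DeriveDef.
    exact: diff_derivable.
  by rewrite deriveE // d2 scale1r.
by have := is_deriveD D (is_derive_cst x t 1); rewrite addr0.
Qed.

Lemma mvt_line V (f : V -> R) (x u : V) (h : R) : 0 < h ->
  (forall s, 0 <= s <= h -> differentiable f (s *: u + x)) ->
  exists2 c, 0 < c < h & f (h *: u + x) - f x = h * 'D_u f (c *: u + x).
Proof.
move=> h0 df; pose phi := fun s : R => f (s *: u + x).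
have D s : 0 <= s <= h -> is_derive s 1 phi ('D_u f (s *: u + x)).
  by move=> /df ds; exact: (@is_derive_comp R R V R (fun r : R => r *: u + x) f s 1 u ds (is_derive_line x u s)).
have [||c + E] := @MVT R phi (fun s => 'D_u f (s *: u + x)) 0 h h0.
- by move=> c; rewrite in_itv /= => /andP[c0 ch]; apply: D; rewrite !ltW.
- apply: derivable_within_continuous => s; rewrite in_itv /= => sh.
  by have [] := D s sh.
rewrite in_itv /= => ch; exists c => //.
by move: E; rewrite /phi scale0r add0r subr0 mulrC.
Qed.

Lemma diff_upto_le V W k (U : set V) (f : V -> W) :
  diff_upto k.+1 U f -> diff_upto k U f.
Proof.
elim: k f => [f [df _] x /df|k IH f [df Df]]; first exact: differentiable_continuous.
by split=> // v; exact: IH (Df v).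
Qed.

Lemma diff_upto_ext V W k (U : set V) (f g : V -> W) : open U ->
  (forall x, U x -> f x = g x) -> diff_upto k U f -> diff_upto k U g.
Proof.
move=> oU; elim: k f g => [f g fg cf x Ux|k IH f g fg [df Df]].
  have fgx : {near x, f =1 g} by apply: filterS (open_nbhs_nbhs (conj oU Ux)).
  have : f @ x --> f x := cf x Ux.
  rewrite (fg _ Ux) => cgx; suff : g @ x --> g x by [].
  by apply: cvg_trans cgx; exact: near_eq_cvg fgx.
have near_fg x : U x -> \forall y \near x, f y = g y.
  by move=> Ux; apply: filterS (open_nbhs_nbhs (conj oU Ux)).
split=> [x Ux|v]; first exact: near_eq_differentiable (near_fg x Ux) (df x Ux).
apply: IH (Df v) => x Ux; exact: near_eq_derive (near_fg x Ux).
Qed.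

Lemma diff_upto_sub V W k (U U' : set V) (f : V -> W) :
  U' `<=` U -> diff_upto k U f -> diff_upto k U' f.
Proof.
move=> UU; elim: k f => [f cf x /UU|k IH f [df Df]]; first exact: cf.
by split=> [x /UU /df|v]; last exact: IH (Df v).
Qed.

Lemma smooth_sub V W (U U' : set V) (f : V -> W) :
  U' `<=` U -> smooth U f -> smooth U' f.
Proof. by move=> UU sf k; exact: diff_upto_sub (sf k). Qed.

Lemma smooth_ext V W (U : set V) (f g : V -> W) : open U ->
  (forall x, U x -> f x = g x) -> smooth U f -> smooth U g.
Proof. by move=> oU fg sf k; exact: diff_upto_ext (sf k). Qed.

Lemma smooth_derive V W (U : set V) (f : V -> W) v :
  smooth U f -> smooth U ('D_v f).
Proof. by move=> sf k; have [_] := sf k.+1; exact. Qed.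

Lemma smooth_differentiable V W (U : set V) (f : V -> W) x :
  smooth U f -> U x -> differentiable f x.
Proof. by move=> /(_ 1%N) [df _]; exact: df. Qed.

Lemma diff_upto_cst V W k (U : set V) (c : W) : diff_upto k U (fun=> c).
Proof.
elim: k c => [c x _|k IH c]; first exact: cst_continuous.
split=> [x _|v]; first exact: differentiable_cst.
have -> : 'D_v (fun=> c) = (fun=> 0) :> (V -> W) by apply/funext => x; exact: derive_cst.
exact: IH.
Qed.

Lemma smooth_cst V W (U : set V) (c : W) : smooth U (fun=> c).
Proof. by move=> k; exact: diff_upto_cst. Qed.

Lemma diff_uptoD V W k (U : set V) (f g : V -> W) : open U ->
  diff_upto k U f -> diff_upto k U g -> diff_upto k U (fun x => f x + g x).
Proof.
move=> oU; elim: k f g => [f g cf cg x Ux|k IH f g [df Df] [dg Dg]].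
  by apply: continuousD; [exact: cf|exact: cg].
split=> [x Ux|v]; first by apply: differentiableD; [exact: df|exact: dg].
apply: diff_upto_ext (IH _ _ (Df v) (Dg v)) => // x Ux.
by rewrite -deriveD; [|apply: diff_derivable; exact: df|apply: diff_derivable; exact: dg].
Qed.

Lemma smoothD V W (U : set V) (f g : V -> W) : open U ->
  smooth U f -> smooth U g -> smooth U (fun x => f x + g x).
Proof. by move=> oU sf sg k; apply: diff_uptoD. Qed.

Lemma smooth_sum V W n (U : set V) (f : 'I_n -> V -> W) : open U ->
  (forall i, smooth U (f i)) -> smooth U (fun x => \sum_i f i x).
Proof.
move=> oU sf.
have -> : (fun x => \sum_i f i x) = \sum_i f i by apply/funext => x; rewrite fct_sumE.
elim/big_ind : _ => //; first exact: smooth_cst.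
by move=> f1 f2 s1 s2; exact: smoothD.
Qed.

(** The Leibniz formula multiplies a derivative by an undifferentiated factor, so the induction on
    the order also uses each factor at one order less, through [diff_upto_le]. *)
Lemma diff_uptoM V k (U : set V) (f g : V -> R) : open U ->
  diff_upto k U f -> diff_upto k U g -> diff_upto k U (fun x => f x * g x).
Proof.
move=> oU; elim: k f g => [f g cf cg x Ux|k IH f g sf sg].
  by apply: continuousM; [exact: cf|exact: cg].
have [df Df] := sf; have [dg Dg] := sg.
split=> [x Ux|v]; first by apply: differentiableM; [exact: df|exact: dg].
have H := diff_uptoD oU (IH _ _ (diff_upto_le sf) (Dg v)) (IH _ _ (diff_upto_le sg) (Df v)).
apply: diff_upto_ext H => // x Ux.
by rewrite deriveM //; apply: diff_derivable; [exact: df|exact: dg].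
Qed.

Lemma smoothM V (U : set V) (f g : V -> R) : open U ->
  smooth U f -> smooth U g -> smooth U (fun x => f x * g x).
Proof. by move=> oU sf sg k; apply: diff_uptoM. Qed.

Lemma diff_upto_mx V m n k (U : set V) (M : V -> 'M[R]_(m, n)) : open U ->
  diff_upto k U M <-> forall i j, diff_upto k U (fun x => M x i j).
Proof.
move=> oU; elim: k M => [M|k IH M].
  split=> [cM i j x Ux|H x Ux]; first by move/cM/continuous_mxP : Ux; exact.
  by apply/continuous_mxP => i j; exact: H.
split=> [[dM DM] i j|H]; split=> [x Ux|v].
- by move/dM/differentiable_mxP: Ux; exact.
- have /IH/(_ i j) := DM v; apply: diff_upto_ext => // x /dM dMx.
  by rewrite derive_mx ?mxE //; exact: diff_derivable.
- by apply/differentiable_mxP => i j; have [+ _] := H i j; exact.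
- apply/IH => i j; have [_ /(_ v)] := H i j; apply: diff_upto_ext => // x Ux.
  rewrite derive_mx ?mxE //; apply: diff_derivable.
  by apply/differentiable_mxP => i' j'; have [+ _] := H i' j'; exact.
Qed.

Lemma smooth_mxP V m n (U : set V) (M : V -> 'M[R]_(m, n)) : open U ->
  smooth U M <-> forall i j, smooth U (fun x => M x i j).
Proof.
move=> oU; split=> [H i j k|H k]; first by have /(diff_upto_mx _ _ oU) := H k; exact.
by apply/diff_upto_mx => // i j; exact: H.
Qed.

Lemma smooth_mulmx V m n p (U : set V) (A : V -> 'M[R]_(m, n))
    (B : V -> 'M[R]_(n, p)) : open U ->
  smooth U A -> smooth U B -> smooth U (fun x => A x *m B x).
Proof.
move=> oU /(smooth_mxP _ oU) sA /(smooth_mxP _ oU) sB.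
apply/smooth_mxP => // i j; under eq_fun do rewrite mxE.
by apply: smooth_sum => // k; apply: smoothM.
Qed.

Lemma smooth_scalemx V m n (U : set V) (f : V -> R) (B : V -> 'M[R]_(m, n)) :
  open U -> smooth U f -> smooth U B -> smooth U (fun x => f x *: B x).
Proof.
move=> oU sf /(smooth_mxP _ oU) sB; apply/smooth_mxP => // i j.
by under eq_fun do rewrite mxE; exact: smoothM.
Qed.

(** For linear [L] the derivative of [f \o L] along [v] is ['D_(L v) f \o L], again a smooth map
    composed with [L], so the induction closes. The linear maps in view are the projections [lsubmx]
    and [rsubmx] of the product charts. *)
Lemma smooth_comp_lin V' V W (L : {linear V' -> V}) (U : set V) (f : V -> W) :
  continuous L -> open U -> smooth U f -> smooth (L @^-1` U) (f \o L).
Proof.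
move=> cL oU sf k; elim: k f sf => [f sf x Ux|k IH f sf].
  by apply: continuous_comp; [exact: cL|exact: (sf 0%N)].
have dL x : differentiable L x by exact: linear_differentiable.
split=> [x Ux|v].
  by apply: differentiable_comp => //; exact: smooth_differentiable sf Ux.
apply: diff_upto_ext (IH _ (smooth_derive (L v) sf)) => [|x Ux].
  by apply: open_comp => // x _; exact: cL.
have df := smooth_differentiable sf Ux.
have dLv : is_derive x v L (L v).
  by apply: DeriveDef; [exact: diff_derivable|rewrite deriveE // diff_lin].
by have [_ ->] := is_derive_comp df dLv.
Qed.

End SmoothMaps.

(** * Schwarz's theorem on mixed derivatives *)

Section SecondDerivatives.
Context {R : realType}.
Implicit Types V : normedModType R.

Lemma le_dist_half (e a b c : R) :
  `|a - c| <= e / 2 -> `|b - c| <= e / 2 -> `|b - a| <= e.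
Proof.
by move=> ac bc; rewrite ler_norml; move: ac bc; rewrite !ler_norml; lra.
Qed.

(** The mean value theorem is used twice: along [u] for the increment [f (h *: v + y) - f y], then
    along [v] for ['D_u f]. The left side is symmetric in [u] and [v] while the right side is not,
    which is what Schwarz's theorem exploits. *)
Lemma second_difference V (f : V -> R) (U : set V) (x u v : V) (h : R) : 0 < h ->
  open U -> diff_upto 2 U f ->
  (forall r s : R, 0 <= r <= h -> 0 <= s <= h -> U (r *: u + s *: v + x)) ->
  exists r s : R, [/\ 0 <= r <= h, 0 <= s <= h &
    f (h *: u + h *: v + x) - f (h *: u + x) - (f (h *: v + x) - f x) =
    h * h * 'D_v ('D_u f) (r *: u + s *: v + x)].
Proof.
move=> h0 oU [df Df] Uxy.
have hh : 0 <= h <= h by rewrite lexx ltW.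
have zh : 0 <= (0 : R) <= h by rewrite lexx ltW.
pose g := fun y => f (h *: v + y) - f y.
have dshift y : U (h *: v + y) -> is_derive y u (fun z => f (h *: v + z)) ('D_u f (h *: v + y)).
  move=> Uy; have D : is_derive y u (fun z => h *: v + z) u.
    by have := is_deriveD (is_derive_cst (h *: v) y u) (is_derive_id y u); rewrite add0r.
  exact: is_derive_comp (df _ Uy) D.
have dfshift y : U (h *: v + y) -> differentiable (fun z => f (h *: v + z)) y.
  move=> Uy; apply: (@differentiable_comp _ _ _ _ (fun z => h *: v + z) f) => //; last exact: df.
have [r rh E] : exists2 c, 0 < c < h & g (h *: u + x) - g x = h * 'D_u g (c *: u + x).
  apply: mvt_line => // s sh; apply: differentiableB.
    by apply: dfshift; rewrite addrA [h *: v + _]addrC; exact: Uxy.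
  by apply: df; have := Uxy s 0 sh zh; rewrite scale0r addr0.
have rh' : 0 <= r <= h by case/andP: rh => ? ?; rewrite !ltW.
have Ur : U (r *: u + x) by have := Uxy r 0 rh' zh; rewrite scale0r addr0.
have Ur' : U (h *: v + (r *: u + x)) by rewrite addrA [h *: v + _]addrC; exact: Uxy.
have Dg : 'D_u g (r *: u + x) = 'D_u f (h *: v + (r *: u + x)) - 'D_u f (r *: u + x).
  by have [_ ->] := is_deriveB (dshift _ Ur') (is_derive_diff u (df _ Ur)).
have [|s sh E2] := @mvt_line _ _ ('D_u f) (r *: u + x) v h h0.
  move=> s' sh'; have [+ _] := Df u; apply.
  by rewrite addrA [s' *: v + _]addrC; exact: Uxy.
exists r, s; split; first exact: rh'.
  by case/andP: sh => ? ?; rewrite !ltW.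
move: E; rewrite Dg => E.
have swap (a b : V) : a + b + x = b + (a + x) by rewrite addrA [b + a]addrC.
by rewrite (swap (h *: u) (h *: v)) (swap (r *: u) (s *: v)) -[RHS]mulrA -E2.
Qed.

Lemma near_square V (x u v : V) (P : V -> Prop) : (\forall y \near x, P y) ->
  exists2 h : R, 0 < h &
    forall r s : R, 0 <= r <= h -> 0 <= s <= h -> P (r *: u + s *: v + x).
Proof.
move=> /nbhs_ballP[e e0 He].
have uv0 : 0 < `|u| + `|v| + 1 by rewrite ltr_wpDl // addr_ge0.
(* The summand 1 keeps the denominator positive when both vectors are zero. *)
exists (e / 2 / (`|u| + `|v| + 1)); first by rewrite !divr_gt0.
move=> r s /andP[r0 rh] /andP[s0 sh]; apply: He.
rewrite -ball_normE /ball_ /= opprD addrCA subrr addr0 normrN.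
apply: le_lt_trans (ler_normD _ _) _; rewrite !normrZ !ger0_norm //.
apply: (@le_lt_trans _ _ (e / 2 / (`|u| + `|v| + 1) * (`|u| + `|v|))).
  by rewrite mulrDr lerD // ler_wpM2r.
rewrite -mulrA mulrC -ltr_pdivlMr; last by rewrite divr_gt0.
rewrite (_ : e / (e / 2) = 2); last by rewrite invf_div mulrC divfK ?gt_eqF.
by rewrite ltr_pdivrMl // mulrC; lra.
Qed.

(** The two orders of applying [second_difference] express the same number, so the mixed derivatives
    agree at two intermediate points of a small parallelogram. Continuity at [x] puts each within e
    / 2 of its value at [x]. *)
Lemma derive_comm_real V (f : V -> R) (U : set V) x u v : open U -> U x ->
  diff_upto 2 U f -> 'D_u ('D_v f) x = 'D_v ('D_u f) x.
Proof.
move=> oU Ux sf; have [_ Df] := sf.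
have cvu : {for x, continuous ('D_v ('D_u f))} by exact: (proj2 (Df u) v x Ux).
have cuv : {for x, continuous ('D_u ('D_v f))} by exact: (proj2 (Df v) u x Ux).
apply/eqP; rewrite -subr_eq0 -normr_le0; apply/ler_addgt0Pr => e e0; rewrite add0r.
have e20 : 0 < e / 2 by rewrite divr_gt0.
have N1 : \forall y \near x, `|'D_v ('D_u f) x - 'D_v ('D_u f) y| <= e / 2.
  by have /cvgrPdist_le/(_ _ e20) := cvu.
have N2 : \forall y \near x, `|'D_u ('D_v f) x - 'D_u ('D_v f) y| <= e / 2.
  by have /cvgrPdist_le/(_ _ e20) := cuv.
have NU : \forall y \near x, U y by exact: open_nbhs_nbhs.
have [h h0 Hh] := near_square u v (filterI N1 (filterI N2 NU)).
have [|r [s [rh sh E1]]] := @second_difference _ f U x u v h h0 oU sf.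
  by move=> r s rh sh; have [_ []] := Hh r s rh sh.
have [|s' [r' [sh' rh' E2]]] := @second_difference _ f U x v u h h0 oU sf.
  by move=> s' r' sh' rh'; rewrite [s' *: v + _]addrC; have [_ []] := Hh r' s' rh' sh'.
have E : 'D_v ('D_u f) (r *: u + s *: v + x) = 'D_u ('D_v f) (s' *: v + r' *: u + x).
  have sw (a b c d k m n : R) : k != 0 -> a - b - (c - d) = k * m ->
      a - c - (b - d) = k * n -> m = n.
    by move=> k0 km kn; apply: (mulfI k0); rewrite -km -kn; ring.
  rewrite (addrC (h *: v) (h *: u)) in E2.
  by apply: sw E1 E2; rewrite mulf_neq0 // gt_eqF.
have [A1 _] := Hh r s rh sh; have [_ [A2 _]] := Hh r' s' rh' sh'.
rewrite (addrC (r' *: u) (s' *: v)) -E in A2.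
exact: le_dist_half A1 A2.
Qed.

Lemma derive_comm V m n (f : V -> 'M[R]_(m, n)) (U : set V) x u v :
  open U -> U x -> smooth U f -> 'D_u ('D_v f) x = 'D_v ('D_u f) x.
Proof.
move=> oU Ux sf; have sfij := (smooth_mxP _ oU).1 sf.
have dD w y : U y -> differentiable ('D_w f) y.
  by move=> Uy; exact: smooth_differentiable (smooth_derive w sf) Uy.
have entry w w' i j : ('D_w ('D_w' f) x) i j = 'D_w ('D_w' (fun t => f t i j)) x.
  have [_ <-] := (is_derive_mxP _ _ _ _).1 (is_derive_diff w (dD w' x Ux)) i j.
  apply: near_eq_derive; near=> y.
  have Uy : U y by near: y; exact: open_nbhs_nbhs.
  have dfy := smooth_differentiable sf Uy.
  by have [_ ->] := (is_derive_mxP _ _ _ _).1 (is_derive_diff w' dfy) i j.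
apply/matrixP => i j; apply: (etrans (entry u v i j)).
apply: etrans (esym (entry v u i j)).
exact: derive_comm_real oU Ux (sfij i j 2%N).
Unshelve. all: by end_near. Qed.

End SecondDerivatives.

(** * Locally Lipschitz maps and ordinary differential equations *)

Section LocallyLipschitz.
Context {R : realType}.
Implicit Types U V W : normedModType R.

(** Exactly what Picard iteration and Gronwall's inequality consume. The class is stable under
    products, inverses and square roots, so it accommodates the normalized field Z directly. *)
Definition locally_lipschitz V W (f : V -> W) (x : V) :=
  exists2 e : R, 0 < e & exists2 L : R, 0 <= L & forall y z,
    `|y - x| < e -> `|z - x| < e -> `|f y - f z| <= L * `|y - z|.

Lemma near_normP V (x : V) (P : V -> Prop) :
  (\forall y \near x, P y) <-> exists2 e : R, 0 < e & forall y, `|y - x| < e -> P y.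
Proof.
split=> [/nbhs_ballP[e e0 H]|[e e0 H]]; last apply/nbhs_ballP; exists e => // y.
  by rewrite distrC => ye; apply: H; rewrite -ball_normE.
by rewrite -ball_normE /ball_ /= distrC; exact: H.
Qed.

Lemma locally_lipschitz_near V W (f g : V -> W) x : {near x, f =1 g} ->
  locally_lipschitz f x -> locally_lipschitz g x.
Proof.
move=> /near_normP[d d0 fg] [e e0 [L L0 H]].
exists (Num.min d e); first by rewrite lt_min d0.
have fgE y : `|y - x| < Num.min d e -> f y = g y.
  by rewrite lt_min => /andP[yd _]; exact: fg.
exists L => // y z yx zx; rewrite -!fgE //.
by apply: H; [move: yx|move: zx]; rewrite lt_min => /andP[].
Qed.

Lemma locally_lipschitz_cst V W (c : W) (x : V) : locally_lipschitz (fun=> c) x.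
Proof.
exists 1 => //; exists 0 => // y z _ _.
by rewrite subrr normr0 mul0r.
Qed.

Lemma locally_lipschitzD V W (f g : V -> W) x : locally_lipschitz f x ->
  locally_lipschitz g x -> locally_lipschitz (fun y => f y + g y) x.
Proof.
move=> [d d0 [K K0 HK]] [e e0 [L L0 HL]].
exists (Num.min d e); first by rewrite lt_min d0.
exists (K + L) => [|y z]; first exact: addr_ge0.
rewrite !lt_min => /andP[yd ye] /andP[zd ze].
rewrite opprD addrACA mulrDl (le_trans (ler_normD _ _)) // lerD //.
  exact: HK.
exact: HL.
Qed.

Lemma locally_lipschitz_bounded V W (f : V -> W) x : locally_lipschitz f x ->
  exists2 e : R, 0 < e & exists2 B : R, 0 <= B & forall y, `|y - x| < e -> `|f y| <= B.
Proof.
move=> [e e0 [L L0 H]]; exists e => //; exists (`|f x| + L * e).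
  by rewrite addr_ge0 // mulr_ge0 // ltW.
move=> y ye; rewrite -(subrKC (f x) (f y)) (le_trans (ler_normD _ _)) // lerD //.
have xx : `|x - x| < e by rewrite subrr normr0.
by rewrite (le_trans (H _ _ ye xx)) // ler_wpM2l // ltW.
Qed.

Lemma locally_lipschitzZ V W (f : V -> R) (g : V -> W) x : locally_lipschitz f x ->
  locally_lipschitz g x -> locally_lipschitz (fun y => f y *: g y) x.
Proof.
move=> lf lg.
have [d1 d10 [B B0 HB]] := locally_lipschitz_bounded lf.
have [d2 d20 [C C0 HC]] := locally_lipschitz_bounded lg.
have [d3 d30 [K K0 HK]] := lf; have [d4 d40 [L L0 HL]] := lg.
exists (Num.min (Num.min d1 d2) (Num.min d3 d4)).
  by rewrite !lt_min d10 d20 d30.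
exists (B * L + K * C) => [|y z]; first by rewrite addr_ge0 // mulr_ge0.
rewrite !lt_min => /andP[/andP[y1 y2] /andP[y3 y4]] /andP[/andP[z1 z2] /andP[z3 z4]].
have -> : f y *: g y - f z *: g z = f y *: (g y - g z) + (f y - f z) *: g z.
  by rewrite scalerBr scalerBl addrA subrK.
rewrite (le_trans (ler_normD _ _)) // !normrZ mulrDl lerD //.
  by rewrite -mulrA ler_pM // ?HB ?HL.
by rewrite mulrAC ler_pM // ?HC ?HK.
Qed.

Lemma locally_lipschitz_continuous V W (f : V -> W) x :
  locally_lipschitz f x -> {for x, continuous f}.
Proof.
move=> [e e0 [L L0 H]]; apply/cvgrPdist_lt => /= d d0.
have L1 : 0 < L + 1 by rewrite ltr_wpDl.
have xx : `|x - x| < e by rewrite subrr normr0.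
apply/near_normP; exists (Num.min e (d / (L + 1))).
  by rewrite lt_min e0 divr_gt0.
move=> y; rewrite lt_min ltr_pdivlMr // => /andP[ye yd].
apply: le_lt_trans (H _ _ xx ye) _; rewrite distrC.
by apply: le_lt_trans yd; rewrite mulrC ler_wpM2l // lerDl.
Qed.

Lemma locally_lipschitz_comp U V W (f : U -> V) (g : V -> W) x :
  locally_lipschitz f x -> locally_lipschitz g (f x) -> locally_lipschitz (g \o f) x.
Proof.
move=> lf [d d0 [K K0 HK]]; have [e e0 [L L0 HL]] := lf.
have cf := locally_lipschitz_continuous lf.
have /near_normP[r r0 rB] : \forall y \near x, `|f y - f x| < d.
  by have /cvgrPdist_lt/(_ _ d0) := cf; apply: filterS => y; rewrite distrC.
exists (Num.min e r); first by rewrite lt_min e0.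
exists (K * L) => [|y z]; first exact: mulr_ge0.
rewrite !lt_min => /andP[ye yr] /andP[ze zr] /=.
rewrite -mulrA; apply: le_trans (HK _ _ (rB _ yr) (rB _ zr)) _.
by rewrite ler_wpM2l // HL.
Qed.

Lemma mx_norm_entry m n (M : 'M[R]_(m, n)) i j : `|M i j| <= `|M|.
Proof.
rewrite [leRHS]/Num.Def.normr /= mx_normrE.
exact: (@le_bigmax _ _ _ 0 (fun ij : 'I_m * 'I_n => `|M ij.1 ij.2|) (i, j)).
Qed.

Lemma mx_norm_le m n (M : 'M[R]_(m, n)) B : 0 <= B ->
  (forall i j, `|M i j| <= B) -> `|M| <= B.
Proof.
move=> B0 H; rewrite /Num.Def.normr /= mx_normrE (bigmax_le _ B0) //= => -[i j] _.
Qed.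

Lemma locally_lipschitz_mx V m n (M : V -> 'M[R]_(m, n)) x :
  (forall i j, locally_lipschitz (fun y => M y i j) x) -> locally_lipschitz M x.
Proof.
move=> H.
have {}H ij : exists eL : R * R, [/\ 0 < eL.1, 0 <= eL.2 &
    forall y z, `|y - x| < eL.1 -> `|z - x| < eL.1 ->
      `|M y ij.1 ij.2 - M z ij.1 ij.2| <= eL.2 * `|y - z|].
  by have [e e0 [L L0 HL]] := H ij.1 ij.2; exists (e, L).
have [eL HeL] := choice H.
exists (\big[Num.min/1]_ij (eL ij).1).
  by apply: lt_bigmin => // ij _; have [] := HeL ij.
have L0 : 0 <= \big[Num.max/0]_ij (eL ij).2.
  exact: bigmax_ge_id.
exists (\big[Num.max/0]_ij (eL ij).2) => // y z yx zx.
apply: mx_norm_le => [|i j]; first exact: mulr_ge0.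
rewrite !mxE; have [_ _ /(_ y z)] := HeL (i, j).
have le1 : \big[Num.min/1]_ij (eL ij).1 <= (eL (i, j)).1 by exact: bigmin_le.
have le2 : (eL (i, j)).2 <= \big[Num.max/0]_ij (eL ij).2 by exact: (le_bigmax _ (fun ij => (eL ij).2)).
move=> /(_ (lt_le_trans yx le1) (lt_le_trans zx le1)) /= /le_trans; apply.
by rewrite ler_wpM2r.
Qed.

Lemma locally_lipschitz_entry V m n (M : V -> 'M[R]_(m, n)) x i j :
  locally_lipschitz M x -> locally_lipschitz (fun y => M y i j) x.
Proof.
move=> [e e0 [L L0 H]]; exists e => //; exists L => // y z ye ze.
apply: le_trans (H _ _ ye ze).
by have := mx_norm_entry (M y - M z) i j; rewrite !mxE.
Qed.

(** Within distance |a| / 2 of [a] every point has absolute value at least |a| / 2, and 1/y - 1/z =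
    (z - y)/(yz); this gives the constant 4 / |a|^2. *)
Lemma locally_lipschitz_inv (a : R) : a != 0 -> locally_lipschitz (fun r : R => r^-1) a.
Proof.
move=> a0; have na : 0 < `|a| by rewrite normr_gt0.
exists (`|a| / 2); first by rewrite divr_gt0.
exists (4 / `|a| ^+ 2) => [|y z]; first by rewrite divr_ge0 // exprn_ge0.
have big t : `|t - a| < `|a| / 2 -> `|a| / 2 <= `|t|.
  move=> ta; have := ler_normD (a - t) t; rewrite subrK distrC.
  by move: ta; move: `|a| `|t| `|t - a| => A B C; lra.
move=> /big yb /big zb.
have y0 : 0 < `|y| by apply: lt_le_trans yb; rewrite divr_gt0.
have z0 : 0 < `|z| by apply: lt_le_trans zb; rewrite divr_gt0.
have -> : y^-1 - z^-1 = (z - y) / (y * z).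
  by field; rewrite -!normr_gt0 y0 z0.
rewrite normrM normfV normrM distrC mulrC ler_wpM2r //.
rewrite (_ : 4 / `|a| ^+ 2 = (`|a| / 2 * (`|a| / 2))^-1); last by field; rewrite gt_eqF.
rewrite lef_pV2 ?posrE ?mulr_gt0 ?divr_gt0 //.
by rewrite ler_pM // divr_ge0.
Qed.

(** The radius 3a/4 keeps points above a/4, hence their roots above half the root of [a]. Two such
    roots sum to at least the root of [a], and y - z factors as the sum times the difference of the
    roots. *)
Lemma locally_lipschitz_sqrt (a : R) : 0 < a -> locally_lipschitz (@Num.sqrt R) a.
Proof.
move=> a0; have sa : 0 < Num.sqrt a by rewrite sqrtr_gt0.
exists (3 / 4 * a); first by rewrite mulr_gt0 // divr_gt0.
exists (Num.sqrt a)^-1 => [|y z]; first by rewrite invr_ge0 ltW.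
have big t : `|t - a| < 3 / 4 * a -> 0 <= t /\ Num.sqrt a / 2 <= Num.sqrt t.
  rewrite ltr_norml => /andP[ta _].
  have t4 : a / 4 <= t by lra.
  have t0 : 0 <= t by lra.
  split=> //; rewrite -[_ / 2]ger0_norm; last by rewrite divr_ge0 // ltW.
  rewrite -sqrtr_sqr ler_wsqrtr // expr_div_n sqr_sqrtr ?(ltW a0) //.
  by rewrite (_ : 2 ^+ 2 = 4) //; ring.
move=> /big[y0 yb] /big[z0 zb].
have sum_ge : Num.sqrt a <= Num.sqrt y + Num.sqrt z by lra.
rewrite -ler_pdivrMl ?invr_gt0 // invrK.
have -> : y - z = (Num.sqrt y + Num.sqrt z) * (Num.sqrt y - Num.sqrt z).
  by rewrite mulrC -subr_sqr !sqr_sqrtr.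
by rewrite normrM ler_wpM2r // ger0_norm // addr_ge0 // sqrtr_ge0.
Qed.

Lemma derive_rV_sum n (f : 'rV[R]_n -> R) x v : differentiable f x ->
  'D_v f x = \sum_i v 0 i * 'D_(delta_mx 0 i) f x.
Proof.
move=> df; rewrite deriveE // {1}(row_sum_delta v) linear_sum.
by apply: eq_bigr => i _; rewrite linearZ deriveE.
Qed.

(** The partial derivatives are continuous, so near [x] each is bounded by its size at [x] plus 1.
    The mean value theorem on a segment then bounds each entry by the sum of these bounds. *)
Lemma smooth_locally_lipschitz n m p (f : 'rV[R]_n -> 'M[R]_(m, p)) (U : set 'rV[R]_n) x :
  open U -> U x -> smooth U f -> locally_lipschitz f x.
Proof.
move=> oU Ux /(smooth_mxP _ oU) sf; apply: locally_lipschitz_mx => i j.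
have {sf} := sf i j; move: (fun y => f y i j) => {}f sf.
have B i' : \forall y \near x, `|'D_(delta_mx 0 i') f y| <= `|'D_(delta_mx 0 i') f x| + 1.
  have c : {for x, continuous ('D_(delta_mx 0 i') f)}.
    have s0 := smooth_derive (delta_mx 0 i') sf; exact: (s0 0%N x Ux).
  have /cvgrPdist_le/(_ _ ltr01) := c; apply: filterS => y.
  move: ('D_(delta_mx 0 i') f y) ('D_(delta_mx 0 i') f x) => a b.
  by rewrite distrC => ab; rewrite -(subrKC b a) (le_trans (ler_normD _ _)) // lerD2l.
have {}B : \forall y \near x, U y /\ forall i', `|'D_(delta_mx 0 i') f y| <= `|'D_(delta_mx 0 i') f x| + 1.
  by near do split; [exact: open_nbhs_nbhs|exact: filter_forall].
have /near_normP[e e0 He] := B.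
exists e => //; pose C := \sum_i' (`|'D_(delta_mx 0 i') f x| + 1).
exists C => [|y z yx zx]; first by apply: sumr_ge0 => i' _; rewrite addr_ge0.
have Bs (s : R) : 0 <= s <= 1 -> `|s *: (y - z) + z - x| < e.
  move=> /andP[s0 s1].
  rewrite (_ : _ - x = s *: (y - x) + (1 - s) *: (z - x)); last first.
    by apply/matrixP => a b; rewrite !mxE; ring.
  apply: le_lt_trans (ler_normD _ _) _; rewrite !normrZ !ger0_norm ?subr_ge0 //.
  have [->|s0'] := eqVneq s 0; first by rewrite mul0r add0r subr0 mul1r.
  have sp : 0 < s by rewrite lt0r s0'.
  rewrite [ltRHS](_ : e = s * e + (1 - s) * e); last by ring.
  rewrite ltr_leD //.
    by rewrite ltr_pM2l.
  by rewrite ler_wpM2l ?subr_ge0 // ltW.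
have [s|s /andP[s0 s1]] := @mvt_line _ _ f z (y - z) 1 ltr01.
  by move=> /Bs /He[Us _]; exact: smooth_differentiable sf Us.
have s01 : 0 <= s <= 1 by rewrite !ltW.
have [Us Ds] := He _ (Bs s s01).
rewrite scale1r subrK mul1r => ->.
rewrite derive_rV_sum; last exact: smooth_differentiable sf Us.
apply: le_trans (ler_norm_sum _ _ _) _.
rewrite /C mulr_suml ler_sum // => k _; rewrite normrM mulrC ler_pM //.
exact: mx_norm_entry.
Unshelve. all: by end_near. Qed.

End LocallyLipschitz.

(** * Induction along a real interval *)

Section RealInduction.
Context {R : realType}.

(** The infimum of the points where [P] fails is excluded by the first hypothesis if it is itself a
    failure and by the second if failures accumulate at it from above. This takes the place of a
    compactness argument on [[a, b]]. *)
Lemma real_induction (a b : R) (P : R -> Prop) :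
  (forall t, a <= t <= b -> (forall s, a <= s < t -> P s) -> P t) ->
  (forall t, a <= t < b -> (forall s, a <= s <= t -> P s) ->
     exists2 e : R, 0 < e & forall s, t < s < t + e -> s <= b -> P s) ->
  forall t, a <= t <= b -> P t.
Proof.
move=> closedP openP t0 /andP[at0 t0b]; apply: contrapT => nP.
pose E := [set t | a <= t <= b /\ ~ P t].
have Et0 : E t0 by split => //; rewrite at0.
have lbE : has_lbound E by exists a => t [/andP[]].
pose T := inf E.
have aT : a <= T by apply: lb_le_inf; [exists t0|move=> t [/andP[]]].
have Tt0 : T <= t0 by exact: ge_inf.
have below s : a <= s < T -> P s.
  move=> /andP[as_ sT]; apply: contrapT => nPs.
  have Es : E s by split => //; rewrite as_ (le_trans (ltW sT)) // (le_trans Tt0).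
  by have := ge_inf lbE Es; rewrite leNgt sT.
have PT : P T by apply: closedP => //; rewrite aT (le_trans Tt0).
have upto s : a <= s <= T -> P s.
  by move=> /andP[as_]; rewrite le_eqVlt => /predU1P[->//|sT]; apply: below; rewrite as_.
have Tb : T < b.
  rewrite lt_neqAle (le_trans Tt0 t0b) andbT; apply/eqP => Tb; apply: nP.
  by apply: upto; rewrite at0 Tb.
have [|e e0 He] := openP T _ upto; first by rewrite aT.
have [t [/andP[at_ tb] nPt] tTe] := inf_adherent e0 (conj (ex_intro _ t0 Et0) lbE).
have Tt : T <= t by apply: ge_inf => //; split => //; rewrite at_.
move: Tt; rewrite le_eqVlt => /predU1P[Tt|Tt]; first by apply: nPt; rewrite -Tt.
by apply: nPt; apply: He; rewrite // Tt.
Qed.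

(** Connectedness of an interval: each point has a neighbourhood on which [P] holds everywhere or
    nowhere. Times before [t0] are reached by applying [real_induction] to the reflected
    variable. *)
Lemma interval_constant (J : set R) (P : R -> Prop) (t0 : R) : is_interval J -> J t0 ->
  (forall t, J t -> exists2 e : R, 0 < e & forall s s', J s -> J s' ->
     `|s - t| < e -> `|s' - t| < e -> P s -> P s') ->
  P t0 -> forall t, J t -> P t.
Proof.
move=> iJ Jt0 H Pt0.
have right t1 : J t1 -> t0 <= t1 -> P t1.
  move=> Jt1 t01; have Jin s : t0 <= s <= t1 -> J s by exact: iJ.
  apply: (@real_induction t0 t1 P) => [t tin below|t tin upto|]; last by rewrite t01 lexx.
    have [e e0 He] := H t (Jin _ tin); have /andP[t0t tt1] := tin.
    have [->//|t0t'] := eqVneq t t0.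
    have lt0t : t0 < t by rewrite lt_neqAle eq_sym t0t'.
    have mt : Num.max t0 (t - e / 2) < t by rewrite gt_max lt0t gtrBl divr_gt0.
    apply: (He (Num.max t0 (t - e / 2))).
    - by apply: Jin; rewrite le_max lexx /= (le_trans (ltW mt)).
    - exact: Jin.
    - rewrite ltr_norml; have : t - e / 2 <= Num.max t0 (t - e / 2) by rewrite le_max lexx orbT.
      by move: mt; move: (Num.max _ _) => m; lra.
    - by rewrite subrr normr0.
    - by apply: below; rewrite mt le_max lexx.
  have /andP[t0t tt1] := tin.
  have [e e0 He] := H t (Jin t (introT andP (conj t0t (ltW tt1)))).
  exists e => // s /andP[ts ste] st1; apply: (He t).
  - by apply: Jin; rewrite t0t ltW.
  - by apply: Jin; rewrite st1 (le_trans t0t (ltW ts)).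
  - by rewrite subrr normr0.
  - by rewrite ltr_norml; lra.
  - by apply: upto; rewrite t0t lexx.
have left t1 : J t1 -> t1 <= t0 -> P t1.
  move=> Jt1 t10; have Jin s : t1 <= s <= t0 -> J s by exact: iJ.
  have K s : - t0 <= s <= - t1 -> t1 <= - s <= t0.
    by move=> /andP[h1 h2]; rewrite lerNr h2 lerNl h1.
  rewrite -[t1]opprK; apply: (@real_induction (- t0) (- t1) (fun s => P (- s))); last first.
  - by rewrite lerN2 t10 lexx.
  - move=> t /andP[h1 h2] upto.
    have tin : t1 <= - t <= t0 by apply: K; rewrite h1 ltW.
    have [e e0 He] := H (- t) (Jin _ tin).
    exists e => // s /andP[ts ste] st1; apply: (He (- t)).
    + exact: Jin.
    + by apply: Jin; apply: K; rewrite st1 (le_trans h1 (ltW ts)).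
    + by rewrite subrr normr0.
    + by rewrite ltr_norml; lra.
    + by apply: upto; rewrite h1 lexx.
  - move=> t tin below; have tin' := K _ tin.
    have [e e0 He] := H (- t) (Jin _ tin'); have /andP[t0t tt1] := tin.
    have [->|t0t'] := eqVneq t (- t0); first by rewrite opprK.
    have lt0t : - t0 < t by rewrite lt_neqAle eq_sym t0t'.
    have mt : Num.max (- t0) (t - e / 2) < t by rewrite gt_max lt0t gtrBl divr_gt0.
    apply: (He (- Num.max (- t0) (t - e / 2))).
    + by apply: Jin; apply: K; rewrite le_max lexx /= (le_trans (ltW mt)).
    + exact: Jin.
    + rewrite ltr_norml; have : t - e / 2 <= Num.max (- t0) (t - e / 2) by rewrite le_max lexx orbT.
      by move: mt; move: (Num.max _ _) => m; lra.
    + by rewrite subrr normr0.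
    + by apply: below; rewrite mt le_max lexx.
by move=> t Jt; have [/right|/ltW/left] := leP t0 t; apply.
Qed.

End RealInduction.

(** * Mean value and Gronwall inequalities with a null exceptional set *)

Section AlmostEverywhereDerivative.
Context {R : realType} {V : normedModType R}.
Notation mu := (@lebesgue_measure R).

Lemma is_derive_growth (D : R -> V) (t : R) (d : V) (e : R) : is_derive t 1 D d ->
  0 < e -> exists2 r : R, 0 < r &
    forall s, `|s - t| < r -> `|D s - D t| <= (`|d| + e) * `|s - t|.
Proof.
move=> [dD <-] e0.
have /cvgrPdist_le/(_ _ e0) : h^-1 *: (D (h *: 1 + t) - D t) @[h --> 0^'] --> 'D_1 D t.
  exact: dD.
move=> /nbhs_ballP[r r0 Hr]; exists r => // s st.
have [->|sneq] := eqVneq s t; first by rewrite !subrr !normr0 mulr0.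
have s0 : s - t != 0 by rewrite subr_eq0.
have := Hr (s - t); rewrite /ball /= sub0r normrN => /(_ st s0).
rewrite /GRing.scale /= mulr1 subrK => H.
have E : D s - D t = (s - t) *: ((s - t)^-1 *: (D s - D t)).
  by rewrite scalerA mulfV // scale1r.
rewrite E normrZ mulrC ler_wpM2r //.
set q := _ *: _ in H *.
rewrite -[q](subrKC ('D_1 D t)) (le_trans (ler_normD _ _)) // lerD2l.
by rewrite distrC.
Qed.

Lemma negligible_open_cover (N : set R) (e : R) : mu.-negligible N -> 0 < e ->
  exists2 U : set R, open U /\ N `<=` U & (mu U < e%:E)%E.
Proof.
move=> [A [mA A0 NA]] e0.
have muA : mu A = 0%E by exact: A0.
have [|U [oU AU UA]] := @lebesgue_regularity_outer R A e mA _ e0.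
  by apply: (eq_ind_r (fun x => (x < +oo)%E) _ A0).
exists U; first by split=> //; exact: subset_trans NA AU.
have mU : measurable U by exact: measurable_realfun.open_measurable.
apply: le_lt_trans UA.
rewrite -[leRHS]adde0 -A0.
rewrite [in leLHS](_ : U = (U `\` A) `|` A); last by rewrite setUC setDUK.
by apply: (@measureU2 _ _ _ mu) => //; exact: measurableD.
Qed.

(* The null set N is covered by an open set of small measure; on it the crude bound L is
   used, and elsewhere the bound C, by real induction along the interval. *)
Lemma ae_derive_lipschitz (D : R -> V) (a b L C : R) (N : set R) : 0 <= L -> 0 <= C ->
  mu.-negligible N ->
  (forall s t, a <= s <= b -> a <= t <= b -> `|D s - D t| <= L * `|s - t|) ->
  (forall t, a < t < b -> ~ N t -> exists2 d, is_derive t 1 D d & `|d| <= C) ->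
  forall s t, a <= s -> s <= t -> t <= b -> `|D t - D s| <= C * (t - s).
Proof.
move=> L0 C0 nN lipD derD s t as_ st tb.
suff main (e : R) : 0 < e -> `|D t - D s| <= (C + e) * (t - s) + L * e.
  apply/ler_addgt0Pr => e e0.
  have k0 : 0 < t - s + L + 1 by rewrite ltr_wpDl // addr_ge0 // subr_ge0.
  apply: le_trans (main (e / (t - s + L + 1)) (divr_gt0 e0 k0)) _.
  rewrite mulrDl -addrA lerD2l [L * _]mulrC -mulrDr.
  by rewrite -mulrA ger_pMr // ler_pdivrMl // mulr1 lerDl.
move=> e0.
(* The derivative bound is available only at times after [a], so [a] joins the exceptional set. *)
have nN' : mu.-negligible (N `|` [set a]).
  apply: negligibleU => //.
  by exists [set a]; split => //; exact: lebesgue_measure_set1.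
have [W [oO NO] Oe] := negligible_open_cover nN' e0.
have mOI (r : R) : measurable (W `&` `[s, r]).
  by apply: measurableI; [exact: measurable_realfun.open_measurable|exact: measurable_itv].
have leO (r : R) : (mu (W `&` `[s, r]) <= mu W)%E.
  by apply: le_measure; rewrite ?inE; [exact: mOI|exact: measurable_realfun.open_measurable|exact: subIsetl].
have finO (r : R) : mu (W `&` `[s, r]) \is a fin_num.
  by rewrite ge0_fin_numE ?measure_ge0 //; apply: le_lt_trans (leO r) (lt_trans Oe (ltry _)).
pose G r := fine (mu (W `&` `[s, r])).
have GE r : mu (W `&` `[s, r]) = (G r)%:E by rewrite fineK.
have G0 r : 0 <= G r by rewrite fine_ge0 // measure_ge0.
have Ge r : G r <= e by rewrite -lee_fin -GE ltW // (le_lt_trans (leO r)).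
have Gmono r r' : r <= r' -> G r <= G r'.
  move=> rr; rewrite -lee_fin -!GE; apply: le_measure; rewrite ?inE; try exact: mOI.
  by apply: setIS => x /=; rewrite !in_itv /= => /andP[-> /le_trans]; exact.
have Gjump r r' : s <= r -> r < r' -> (forall x, r < x <= r' -> W x) ->
    G r + (r' - r) <= G r'.
  move=> sr rr H; rewrite -lee_fin EFinD -!GE.
  have -> : (r' - r)%:E = mu `]r, r'].
    by rewrite lebesgue_measure_itv /= lte_fin rr EFinB.
  have dis : (W `&` `[s, r]) `&` `]r, r'] = set0.
    apply/seteqP; split=> [x|//] [[_]] /=; rewrite !in_itv /= => /andP[_ xr] /andP[rx _].
    by move: (lt_le_trans rx xr); rewrite ltxx.
  have <- := @measureU _ _ _ mu _ _ (mOI r) (measurable_itv `]r, r']) dis.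
  apply: le_measure; rewrite ?inE; [by apply: measurableU; [exact: mOI|exact: measurable_itv]|exact: mOI|].
  move=> x [[Ox]|] /=; rewrite !in_itv /= => /andP[h1 h2]; split=> //=.
  - by rewrite ?in_itv /= h1 (le_trans h2) // ltW.
  - by apply: H; rewrite h1.
  - by rewrite ?in_itv /= h2 (le_trans sr) // ltW.
(* [G r] is the length of the part of [W] inside [[s, r]]. Crossing [W] costs [L] per unit of length
   and is paid for by the growth of [G], whose total is at most [e]. *)
pose P r := `|D r - D s| <= (C + e) * (r - s) + L * G r.
have Ce : 0 <= C + e by rewrite addr_ge0 // ltW.
suff : P t.
  by move=> /le_trans; apply; rewrite lerD2l ler_wpM2l.
apply: (@real_induction _ s t P); last by rewrite st lexx.
  move=> r /andP[sr rt] below.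
  have [->|rs] := eqVneq r s; first by rewrite /P !subrr normr0 mulr0 add0r mulr_ge0.
  have sr' : s < r by rewrite lt_neqAle eq_sym rs.
  apply/ler_addgt0Pr => d d0.
  pose r' := Num.max s (r - d / (L + 1)).
  have L1 : 0 < L + 1 by rewrite ltr_wpDl.
  have sr'' : s <= r' by rewrite le_max lexx.
  have r'r : r' < r by rewrite gt_max sr' gtrBl divr_gt0.
  have rr' : r - r' <= d / (L + 1) by rewrite lerBlDr addrC -lerBlDr le_max lexx orbT.
  have := below r'; rewrite sr'' r'r => /(_ isT); rewrite /P => Pr'.
  rewrite -(subrKA (D r')) (le_trans (ler_normD _ _)) // addrC.
  apply: lerD.
    apply: le_trans Pr' _; apply: lerD; last by rewrite ler_wpM2l // Gmono // ltW.
    by rewrite ler_wpM2l // lerD2r ltW.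
  apply: le_trans (lipD _ _ _ _) _.
  - by rewrite (le_trans as_ sr) (le_trans rt).
  - by rewrite (le_trans as_ sr'') (le_trans (ltW r'r)) // (le_trans rt).
  rewrite gtr0_norm ?subr_gt0 //.
  apply: (@le_trans _ _ (L * (d / (L + 1)))); first by rewrite ler_wpM2l.
  by rewrite mulrCA ger_pMr // ler_pdivrMr // mul1r lerDl.
move=> r /andP[sr rt] upto.
have Pr : P r by apply: upto; rewrite sr lexx.
have [Or|nOr] := pselect (W r).
  have /near_normP[d d0 Hd] : \forall y \near r, W y by exact: open_nbhs_nbhs.
  exists d => // r' /andP[rr' r'd] r't.
  have Gr : G r + (r' - r) <= G r'.
    apply: Gjump => // x /andP[rx xr]; apply: Hd.
    by rewrite gtr0_norm ?subr_gt0 // ltrBlDl (le_lt_trans xr).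
  rewrite /P -(subrKA (D r)) (le_trans (ler_normD _ _)) // addrC.
  apply: (@le_trans _ _ (((C + e) * (r - s) + L * G r) + L * (r' - r))).
    apply: lerD => //; rewrite -(gtr0_norm (_ : 0 < r' - r)) ?subr_gt0 //.
    apply: lipD; first by rewrite (le_trans as_ (le_trans sr (ltW rr'))) (le_trans r't).
    by rewrite (le_trans as_ sr) (le_trans (ltW rt)).
  rewrite -addrA -mulrDr lerD //; last by rewrite ler_wpM2l.
  by rewrite ler_wpM2l // lerD2r ltW.
have nNr : ~ N r by move=> Nr; apply: nOr; apply: NO; left.
have ar : a < r.
  rewrite lt_neqAle (le_trans as_ sr) andbT; apply/eqP => ar.
  by apply: nOr; apply: NO; right.
have rb : a < r < b by rewrite ar (lt_le_trans rt).
have [d Dd dC] := derD r rb nNr.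
have [h h0 Hh] := is_derive_growth Dd e0.
exists h => // r' /andP[rr' r'h] r't.
have {}Hh : `|D r' - D r| <= (C + e) * (r' - r).
  apply: le_trans (Hh r' _) _; first by rewrite gtr0_norm ?subr_gt0 // ltrBlDl.
  by rewrite [in leLHS]gtr0_norm ?subr_gt0 // ler_wpM2r ?lerD2r // subr_ge0 ltW.
rewrite /P -(subrKA (D r)) (le_trans (ler_normD _ _)) // addrC.
apply: (@le_trans _ _ (((C + e) * (r - s) + L * G r) + (C + e) * (r' - r))).
  exact: lerD.
rewrite addrAC -mulrDr addrC [r - s + _]addrC subrKA addrC lerD2l.
by rewrite ler_wpM2l // Gmono // ltW.
Qed.

(** On an interval so short that [K] times its length is at most 1/2, a bound on [D] improves to
    half of itself as soon as [D] vanishes somewhere in the interval. Iteration gives zero there,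
    and [interval_constant] carries the zero along [[a, b]]. *)
Lemma lipschitz_gronwall (D : R -> V) (a b L K t0 : R) (N : set R) :
  0 <= L -> 0 <= K -> mu.-negligible N ->
  (forall s t, a <= s <= b -> a <= t <= b -> `|D s - D t| <= L * `|s - t|) ->
  (forall t, a < t < b -> ~ N t -> exists2 d, is_derive t 1 D d & `|d| <= K * `|D t|) ->
  a <= t0 <= b -> D t0 = 0 -> forall t, a <= t <= b -> D t = 0.
Proof.
move=> L0 K0 nN lipD derD t0ab Dt0.
pose h := (4 * (K + 1))^-1.
have K1 : 0 < K + 1 by rewrite ltr_wpDl.
have h0 : 0 < h by rewrite invr_gt0 mulr_gt0.
have Kh : K * (2 * h) <= 2^-1.
  have -> : 2 * h = (K + 1)^-1 / 2 by rewrite /h; field; rewrite gt_eqF.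
  by rewrite mulrA ger_pMl ?invr_gt0 // ler_pdivrMr // mul1r lerDl.
suff loc t1 t2 : a <= t1 -> t1 <= t2 -> t2 <= b -> t2 - t1 <= 2 * h ->
    (D t1 = 0 \/ D t2 = 0) -> D t1 = 0 /\ D t2 = 0.
  have ab : is_interval [set t | a <= t <= b].
    by move=> x y /= /andP[ax _] /andP[_ yb] z /andP[xz zy]; rewrite (le_trans ax xz) (le_trans zy).
  apply: (interval_constant ab t0ab) => // t _; exists h => // s s' /andP[a1 b1] /andP[a2 b2].
  rewrite !ltr_norml => /andP[h1 h2] /andP[h3 h4] Ds.
  have [ss|/ltW ss] := leP s s'.
    by apply: (proj2 (loc s s' a1 ss b2 _ (or_introl Ds))); lra.
  by apply: (proj1 (loc s' s a2 ss b1 _ (or_intror Ds))); lra.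
move=> at1 t12 t2b th Dz.
pose B := L * (t2 - t1).
have B0 : 0 <= B by rewrite mulr_ge0 // subr_ge0.
have [z [z12 Dz0]] : exists z, t1 <= z <= t2 /\ D z = 0.
  by case: Dz => Dz; [exists t1|exists t2]; rewrite lexx t12.
have inab s : t1 <= s <= t2 -> a <= s <= b.
  by move=> /andP[h1 h2]; rewrite (le_trans at1 h1) (le_trans h2 t2b).
(* The Lipschitz bound starts the iteration; each further step feeds the previous bound into the
   derivative estimate. *)
have step k : forall s, t1 <= s <= t2 -> `|D s| <= B / 2 ^+ k.
  elim: k => [|k IH] s s12.
    rewrite expr0 divr1 -[D s]subr0 -Dz0 (le_trans (lipD _ _ (inab _ s12) (inab _ z12))) //.
    rewrite ler_wpM2l // ler_norml; move: s12 z12; lra.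
  have Bk0 : 0 <= B / 2 ^+ k by rewrite divr_ge0 // exprn_ge0.
  have H := @ae_derive_lipschitz D t1 t2 L (K * (B / 2 ^+ k)) N L0 (mulr_ge0 K0 Bk0) nN.
  have {}H u v : t1 <= u -> u <= v -> v <= t2 -> `|D v - D u| <= K * (B / 2 ^+ k) * (v - u).
    apply: H => [x y x12 y12|x /andP[h1 h2] nx].
      by apply: lipD; exact: inab.
    have [|d Dd dK] := derD x _ nx; first by rewrite (le_lt_trans at1 h1) (lt_le_trans h2 t2b).
    by exists d => //; apply: le_trans dK _; rewrite ler_wpM2l // IH // !ltW.
  have small c : 0 <= c -> c <= 2 * h -> K * (B / 2 ^+ k) * c <= B / 2 ^+ k.+1.
    move=> c0 ch; rewrite exprSr invfM [_ * (_ / 2)]mulrA mulrAC [K * _ * _]mulrC.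
    by rewrite ler_wpM2l // (le_trans _ Kh) // ler_wpM2l.
  have [zs|/ltW zs] := leP z s.
    rewrite -[D s]subr0 -Dz0 (le_trans (H z s _ _ _)) //; [by case/andP: z12|by case/andP: s12|].
    by apply: small; move: s12 z12; lra.
  rewrite -[D s]subr0 -Dz0 distrC (le_trans (H s z _ _ _)) //; [by case/andP: s12|by case/andP: z12|].
  by apply: small; move: s12 z12; lra.
suff zero s : t1 <= s <= t2 -> D s = 0 by rewrite !zero ?lexx ?t12.
move=> s12; apply/eqP; rewrite -normr_le0.
apply/ler_addgt0Pr => e e0; rewrite add0r.
have /(@upper_nthrootP R) := leqnn (Num.bound (B / e)).
set k := Num.bound _ => Bk.
apply: le_trans (step k s s12) _.
by rewrite ler_pdivrMr ?exprn_gt0 // mulrC -ler_pdivrMr // ltW.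
Qed.

End AlmostEverywhereDerivative.

(** * Antiderivatives and the Picard theorem *)

Section OrdinaryDifferentialEquations.
Context {R : realType}.
Notation mu := (@lebesgue_measure R).

Lemma antiderivative (f : R -> R) (r : R) : continuous f -> 0 < r ->
  exists2 F : R -> R, F 0 = 0 & forall t : R, `|t| < r -> is_derive t 1 F (f t).
Proof.
(* Integrating from [- r] makes 0 an interior point, so negative times cause no case distinction;
   subtracting [G 0] restores the initial value. *)
move=> cf r0; pose G := fun x => \int[mu]_(t in `[- r, x]) f t.
exists (fun x => G x - G 0) => [|t]; first by rewrite subrr.
rewrite ltr_norml => /andP[rt tr].
have int : mu.-integrable `[- r, r] (EFin \o f).
  apply: continuous_compact_integrable; first exact: segment_compact.
  exact: continuous_subspaceT.
have [dG Gt] := continuous_FTC1_closed tr int rt (cf t).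
have DG : is_derive t 1 G (f t) := DeriveDef dG (etrans (esym (derive1E G t)) Gt).
by have := is_deriveB DG (is_derive_cst (G 0) t 1); rewrite subr0.
Qed.

Lemma antiderivative_rV n (f : R -> 'rV[R]_n) (r : R) : continuous f -> 0 < r ->
  exists2 F : R -> 'rV[R]_n, F 0 = 0 & forall t : R, `|t| < r -> is_derive t 1 F (f t).
Proof.
move=> cf r0.
have /choice[F HF] (i : 'I_n) : exists F : R -> R,
    F 0 = 0 /\ forall t : R, `|t| < r -> is_derive t 1 F (f t 0 i).
  have cfi : continuous (fun t => f t 0 i).
    by move=> t; have /continuous_mxP := cf t; exact.
  by have [F F0 dF] := antiderivative cfi r0; exists F.
exists (fun t => \row_i F i t); first by apply/rowP => i; rewrite !mxE; have [] := HF i.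
move=> t tr; apply/is_derive_mxP => i j; rewrite ord1.
under eq_fun do rewrite mxE.
by have [_] := HF j; exact.
Qed.

(** Values lie in a normed space, where the mean value equality fails. Real induction with the
    slightly larger slope [C + e'] gives the inequality instead. *)
Lemma derive_lipschitz (V : normedModType R) (D : R -> V) (a b C : R) : 0 <= C ->
  (forall t, a <= t <= b -> exists2 d, is_derive t 1 D d & `|d| <= C) ->
  forall s t, a <= s -> s <= t -> t <= b -> `|D t - D s| <= C * (t - s).
Proof.
move=> C0 derD s t as_ st tb; apply/ler_addgt0Pr => e e0.
have k0 : 0 < t - s + 1 by rewrite ltr_wpDl // subr_ge0.
pose e' := e / (t - s + 1); have e'0 : 0 < e' by rewrite divr_gt0.
suff main : `|D t - D s| <= (C + e') * (t - s).
  apply: le_trans main _; rewrite mulrDl lerD2l -mulrA ger_pMr // ler_pdivrMl // mulr1.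
  by rewrite lerDl.
have growth r : a <= r <= b -> exists2 h : R, 0 < h &
    forall x, `|x - r| < h -> `|D x - D r| <= (C + e') * `|x - r|.
  move=> /derD[d Dd dC]; have [h h0 Hh] := is_derive_growth Dd e'0.
  by exists h => // x /Hh /le_trans; apply; rewrite ler_wpM2r // lerD2r.
apply: (@real_induction _ s t (fun r => `|D r - D s| <= (C + e') * (r - s))); last first.
- by rewrite st lexx.
- move=> r /andP[sr rt] upto.
  have [|h h0 Hh] := growth r; first by rewrite (le_trans as_ sr) (le_trans (ltW rt)).
  exists h => // x /andP[rx xh] xt.
  rewrite -(subrKA (D r)) (le_trans (ler_normD _ _)) //.
  have -> : x - s = (x - r) + (r - s) by rewrite addrA subrK.
  rewrite mulrDr lerD //; last by apply: upto; rewrite sr lexx.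
  have := Hh x; rewrite gtr0_norm ?subr_gt0 //; apply.
  by rewrite ltrBlDl.
move=> r /andP[sr rt] below.
have [->|rs] := eqVneq r s; first by rewrite !subrr normr0 mulr0.
have {rs}sr : s < r by rewrite lt_neqAle eq_sym rs.
have [|h h0 Hh] := growth r; first by rewrite (le_trans as_ (ltW sr)) (le_trans rt).
pose x := Num.max s (r - h / 2).
have xr : x < r by rewrite gt_max sr gtrBl divr_gt0.
have xh : r - h / 2 <= x by rewrite le_max lexx orbT.
have sx : s <= x by rewrite le_max lexx.
have := below x; rewrite sx xr => /(_ isT) Dx.
rewrite -(subrKA (D x)) (le_trans (ler_normD _ _)) //.
have -> : r - s = (r - x) + (x - s) by rewrite addrA subrK.
rewrite mulrDr lerD // distrC.
have := Hh x; rewrite ltr0_norm ?subr_lt0 // opprB; apply.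
by rewrite ltrBlDr -ltrBlDl (lt_le_trans _ xh) // ltrD2l ltrN2 ltr_pdivrMr // ltr_pMr // ltr1n.
Qed.

Lemma geometric_cauchy_limit n (u : nat -> 'rV[R]_n) (c : R) : 0 <= c ->
  (forall k, `|u k.+1 - u k| <= c / 2 ^+ k.+1) ->
  exists x, forall k, `|x - u k| <= c / 2 ^+ k.
Proof.
move=> c0 Hu.
have tail k p : `|u (p + k)%N - u k| <= c / 2 ^+ k - c / 2 ^+ (p + k).
  elim: p => [|p IH]; first by rewrite add0n !subrr normr0.
  rewrite addSn -(subrKA (u (p + k)%N)) (le_trans (ler_normD _ _)) //.
  apply: le_trans (lerD (Hu _) IH) _; rewrite exprS.
  have half (b q : R) : q != 0 -> c / (2 * q) + (b - c / q) <= b - c / (2 * q).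
    by move=> q0; rewrite le_eqVlt; apply/orP; left; apply/eqP; field.
  by apply: half; rewrite expf_neq0.
have tail' k m : (k <= m)%N -> `|u m - u k| <= c / 2 ^+ k.
  move=> km; rewrite -(subnK km) (le_trans (tail _ _)) // gerBl.
  by rewrite divr_ge0 // exprn_ge0.
have small e : 0 < e -> exists k, c / 2 ^+ k < e.
  move=> e0; have /(@upper_nthrootP R) := leqnn (Num.bound (c / e)).
  set k := Num.bound _ => Bk; exists k.
  by rewrite ltr_pdivrMr ?exprn_gt0 // mulrC -ltr_pdivrMr.
have cv : cvg (u @ \oo).
  apply/cauchy_cvgP/cauchyP => e e0; have [k ke] := small e e0.
  exists (u k); exists k => // m /= km.
  by rewrite -ball_normE /ball_ /= distrC (le_lt_trans (tail' _ _ km)).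
exists (lim (u @ \oo)) => k; apply/ler_addgt0Pr => e e0.
have /cvgrPdist_le/(_ _ e0)[m _ Hm] := cv.
have := Hm (maxn m k) (leq_maxl _ _) => lm.
rewrite -(subrKA (u (maxn m k))) (le_trans (ler_normD _ _)) // addrC lerD //.
by rewrite tail' // leq_maxr.
Qed.

(** For [a <= b] the retraction of the line onto [[a, b]]. Being 1-Lipschitz, it extends maps known
    only near a point to the whole line or space without changing Lipschitz constants. *)
Definition clamp (a b x : R) := Num.max a (Num.min b x).

Lemma max_lipschitz (a x y : R) : `|Num.max a x - Num.max a y| <= `|x - y|.
Proof.
have [xy1 xy2] : x - y <= `|x - y| /\ y - x <= `|x - y|.
  by split; [exact: ler_norm|rewrite distrC; exact: ler_norm].
rewrite ler_norml; have [h1|h1] := leP a x; have [h2|h2] := leP a y; lra.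
Qed.

Lemma min_lipschitz (a x y : R) : `|Num.min a x - Num.min a y| <= `|x - y|.
Proof.
have [xy1 xy2] : x - y <= `|x - y| /\ y - x <= `|x - y|.
  by split; [exact: ler_norm|rewrite distrC; exact: ler_norm].
rewrite ler_norml; have [h1|h1] := leP a x; have [h2|h2] := leP a y; lra.
Qed.

Lemma clamp_lipschitz a b x y : `|clamp a b x - clamp a b y| <= `|x - y|.
Proof. exact: le_trans (max_lipschitz _ _ _) (min_lipschitz _ _ _). Qed.

Lemma clamp_itv a b x : a <= b -> a <= clamp a b x <= b.
Proof.
by move=> ab; rewrite /clamp le_max lexx /= ge_max ab ge_min lexx.
Qed.

Lemma clamp_id a b x : a <= x <= b -> clamp a b x = x.
Proof. by move=> /andP[ax xb]; rewrite /clamp (min_idPr xb) (max_idPr ax). Qed.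

Lemma clamp_continuous a b : continuous (clamp a b).
Proof.
move=> x; apply: locally_lipschitz_continuous.
exists 1 => //; exists 1 => // y z _ _.
by rewrite mul1r; exact: clamp_lipschitz.
Qed.

Lemma derive_bound0 (V : normedModType R) (D : R -> V) (r C : R) : 0 <= r -> 0 <= C ->
  (forall t, - r <= t <= r -> exists2 d, is_derive t 1 D d & `|d| <= C) ->
  D 0 = 0 -> forall t, - r <= t <= r -> `|D t| <= C * r.
Proof.
move=> r0 C0 HD D0 t /andP[rt tr].
have H := derive_lipschitz C0 HD.
have [t0|/ltW t0] := leP 0 t.
  rewrite -[D t]subr0 -D0 (le_trans (H 0 t _ t0 tr)) ?oppr_le0 // subr0.
  by rewrite ler_wpM2l.
rewrite -[D t]subr0 -D0 distrC (le_trans (H t 0 rt t0 r0)) // sub0r.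
by rewrite ler_wpM2l // lerNl.
Qed.

(** Picard iteration with time clamped to [[- r, r]], so that every iterate is continuous on the
    whole line. The condition on [L * r] makes the iteration a contraction of ratio 1/2. *)
Lemma picard_global n (f : 'rV[R]_n -> 'rV[R]_n) (L r : R) (x0 : 'rV[R]_n) :
  0 <= L -> 0 < r -> L * r <= 2^-1 ->
  (forall y z, `|f y - f z| <= L * `|y - z|) ->
  exists2 x : R -> 'rV[R]_n, x 0 = x0 &
    forall t : R, `|t| < r -> is_derive t 1 x (f (x t)).
Proof.
move=> L0 r0 Lr lipf.
have r00 := ltW r0.
have rr : - r <= r by rewrite (le_trans _ r00) // oppr_le0.
have cf : continuous f.
  move=> y; apply: locally_lipschitz_continuous.
  by exists 1 => //; exists L => // z z' _ _; exact: lipf.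
pose tau := clamp (- r) r.
have tau_r t : - r <= tau t <= r by exact: clamp_itv.
(* Antiderivatives are taken on a twice larger interval, so that they are derivable at the end
   points of [[- r, r]] too. *)
have tau2 t : - r <= t <= r -> `|t| < 2 * r.
  rewrite -ler_norml => /le_lt_trans; apply.
  by rewrite ltr_pMl // ltr1n.
(* An antiderivative is only known to exist, so one Picard step is a relation first; [choice] turns
   it into the operator [T] below. *)
pose step (u v : R -> 'rV[R]_n) := exists F : R -> 'rV[R]_n, [/\ F 0 = 0,
  forall t : R, `|t| < 2 * r -> is_derive t 1 F (f (u t)) &
  forall t, v t = x0 + F (tau t)].
have stepE (u : R -> 'rV[R]_n) : exists v, continuous u -> step u v.
  have [cu|] := pselect (continuous u); last by exists u.
  have cfu : continuous (f \o u) by move=> t; apply: continuous_comp; [exact: cu|exact: cf].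
  have [F F0 HF] := antiderivative_rV cfu (mulr_gt0 (ltr0Sn R 1) r0).
  by exists (fun t => x0 + F (tau t)) => _; exists F; split.
have step_cont u v : step u v -> continuous v.
  move=> [F [F0 HF vE]] t.
  have -> : v = (fun t => x0 + F (tau t)) by exact/funext.
  have cF : {for tau t, continuous F}.
    apply: differentiable_continuous; apply/derivable1_diffP.
    by have [] := HF (tau t) (tau2 _ (tau_r t)).
  have ct : {for t, continuous (F \o tau)}.
    by apply: continuous_comp => //; exact: clamp_continuous.
  by apply: continuousD => //; exact: cst_continuous.
have step_lip u v u' v' c : step u v -> step u' v' -> 0 <= c ->
    (forall t, `|u t - u' t| <= c) -> forall t, `|v t - v' t| <= c / 2.
  move=> [F [F0 HF vE]] [F' [F'0 HF' vE']] c0 uu t.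
  rewrite vE vE' opprD addrACA subrr add0r.
  have := @derive_bound0 _ (fun s => F s - F' s) r (L * c) r00 (mulr_ge0 L0 c0).
  rewrite F0 F'0 subrr => /(_ _ erefl _ (tau_r t)) H.
  apply: le_trans (H _) _; last first.
    by rewrite mulrAC mulrC ler_wpM2l.
  move=> s /tau2 sr; exists (f (u s) - f (u' s)); last first.
    by rewrite (le_trans (lipf _ _)) // ler_wpM2l.
  exact: is_deriveB (HF s sr) (HF' s sr).
have [T HT] := choice stepE.
pose u k := iter k T (fun=> x0).
have cu k : continuous (u k).
  elim: k => [|k IH]; first by move=> t; exact: cst_continuous.
  exact: step_cont (HT _ IH).
(* The first increment is at most |f x0| r, which is c / 2; halving then yields the geometric
   bounds. *)
pose c := 2 * (`|f x0| * r).
have c0 : 0 <= c by rewrite !mulr_ge0.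
have ck k : 0 <= c / 2 ^+ k by rewrite divr_ge0 // exprn_ge0.
have uk k t : `|u k.+1 t - u k t| <= c / 2 ^+ k.+1.
  elim: k t => [|k IH] t.
    have [F [F0 HF vE]] := HT _ (cu 0%N).
    rewrite /= vE addrC addKr expr1 /c [2 * _]mulrC mulfK //.
    apply: (@derive_bound0 _ F r) => // s /tau2 sr.
    by exists (f x0) => //; exact: HF.
  rewrite [2 ^+ _.+1]exprSr invfM mulrA.
  apply: step_lip (HT _ (cu k.+1)) (HT _ (cu k)) (ck _) IH t.
have /choice[x Hx] t : exists xt, forall k, `|xt - u k t| <= c / 2 ^+ k.
  by apply: geometric_cauchy_limit => // k; exact: uk.
have small e : 0 < e -> exists k, c / 2 ^+ k < e.
  move=> e0; have /(@upper_nthrootP R) := leqnn (Num.bound (c / e)).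
  set k := Num.bound _ => Bk; exists k.
  by rewrite ltr_pdivrMr ?exprn_gt0 // mulrC -ltr_pdivrMr.
have cx : continuous x.
  move=> t; apply/cvgrPdist_le => e e0.
  have e30 : 0 < e / 3 by rewrite divr_gt0.
  have [k ke] := small _ e30.
  have /cvgrPdist_le/(_ _ e30) := cu k t.
  apply: filterS => s us.
  have -> : x t - x s = (x t - u k t) + (u k t - u k s) - (x s - u k s).
    by apply/rowP => i; rewrite !mxE; ring.
  rewrite (le_trans (ler_normB _ _)) // (_ : e = e / 3 + e / 3 + e / 3); last by field.
  apply: lerD; last by rewrite (le_trans (Hx s k)) // ltW.
  apply: le_trans (ler_normD _ _) _; apply: lerD => //.
  by rewrite (le_trans (Hx t k)) // ltW.
have xT t : x t = T x t.
  apply/eqP; rewrite -subr_eq0 -normr_le0; apply/ler_addgt0Pr => e e0; rewrite add0r.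
  have [k ke] := small _ e0.
  have A1 := step_lip _ _ _ _ _ (HT _ cx) (HT _ (cu k)) (ck k) (fun s => Hx s k) t.
  have A2 := Hx t k.+1.
  rewrite -(subrKA (u k.+1 t)) (le_trans (ler_normD _ _)) //.
  rewrite [`|u k.+1 t - _|]distrC (le_trans (lerD A2 A1)) //.
  rewrite exprSr invfM mulrA -splitr.
  exact: ltW.
have [F [F0 HF xE]] := HT _ cx.
exists x; first by rewrite xT xE /tau clamp_id ?F0 ?addr0 // oppr_le0 r00.
move=> t tr.
have tr2 : `|t| < 2 * r by rewrite (lt_trans tr) // ltr_pMl // ltr1n.
apply: near_eq_is_derive (_ : is_derive t 1 (fun s => x0 + F s) (f (x t))).
  apply/near_normP; exists (r - `|t|) => [|s st]; first by rewrite subr_gt0.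
  rewrite xT xE /tau clamp_id // -ler_norml.
  rewrite -(subrK t s) (le_trans (ler_normD _ _)) //.
  by rewrite -lerBrDr ltW.
by have := is_deriveD (is_derive_cst x0 t 1) (HF t tr2); rewrite add0r.
Qed.

(** Clamping each coordinate to a cube around [x0], which is a ball of the maximum norm, makes [f]
    globally Lipschitz. For short times the solution stays inside the cube, where the clamp is the
    identity. *)
Lemma picard_local n (f : 'rV[R]_n -> 'rV[R]_n) (x0 : 'rV[R]_n) : locally_lipschitz f x0 ->
  exists2 r : R, 0 < r & exists2 x : R -> 'rV[R]_n, x 0 = x0 &
    forall t : R, `|t| < r -> is_derive t 1 x (f (x t)).
Proof.
move=> [e e0 [L L0 lipf]].
pose d := e / 2; have d0 : 0 < d by rewrite divr_gt0.
pose cl (y : 'rV[R]_n) : 'rV[R]_n := \row_i clamp (x0 0 i - d) (x0 0 i + d) (y 0 i).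
have cl_lip y z : `|cl y - cl z| <= `|y - z|.
  apply: mx_norm_le => // i j; rewrite !mxE (le_trans (clamp_lipschitz _ _ _ _)) //.
  by have := mx_norm_entry (y - z) 0 j; rewrite !mxE.
have cl_ball y : `|cl y - x0| < e.
  apply: (@le_lt_trans _ _ d); last by rewrite ltr_pdivrMr // ltr_pMr // ltr1n.
  apply: mx_norm_le => [|i j]; first exact: ltW.
  rewrite !mxE ord1 ler_distl.
  by apply: clamp_itv; rewrite lerBlDr -addrA lerDl addr_ge0 // ltW.
have cl_id y : `|y - x0| <= d -> cl y = y.
  move=> yd; apply/rowP => i; rewrite !mxE clamp_id // -ler_distl.
  by have := mx_norm_entry (y - x0) 0 i; rewrite !mxE => /le_trans; exact.
pose r := (2 * (L + 1))^-1.
have L1 : 0 < L + 1 by rewrite ltr_wpDl.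
have r0 : 0 < r by rewrite invr_gt0 mulr_gt0.
have Lr : L * r <= 2^-1.
  by rewrite /r invfM mulrCA ger_pMr // ler_pdivrMr // mul1r lerDl.
have lipfc y z : `|(f \o cl) y - (f \o cl) z| <= L * `|y - z|.
  by rewrite (le_trans (lipf _ _ (cl_ball _) (cl_ball _))) // ler_wpM2l.
have [x xx0 Hx] := picard_global x0 L0 r0 Lr lipfc.
have cx : {for 0, continuous x}.
  apply: differentiable_continuous; apply/derivable1_diffP.
  by have [] := Hx 0; rewrite ?normr0.
have /near_normP[s s0 Hs] : \forall t \near 0, `|x t - x0| <= d.
  have /cvgrPdist_le/(_ _ d0) := cx; apply: filterS => t.
  by rewrite xx0 distrC.
exists (Num.min r s); first by rewrite lt_min r0.
exists x => // t; rewrite lt_min => /andP[tr ts].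
by have := Hx t tr; rewrite /= cl_id // Hs // subr0.
Qed.

End OrdinaryDifferentialEquations.

(** * Charts, forms and vector fields *)

Section Atlas.
Context {R : realType} {n : nat} {T : topologicalType}.
Variable ch : charted R n T.

(** The chart conditions of [smooth_manifold] alone, in a form that passes to [times_line ch].
    Separation is invoked where integral curves are compared, and second countability where null
    sets are united. *)
Definition atlas : Prop :=
  (forall p, [/\ cdom (ch p) p, open (cdom (ch p)),
      open (cmap (ch p) @` cdom (ch p)),
      {in cdom (ch p), cancel (cmap (ch p)) (cinv (ch p))} &
      {within cdom (ch p), continuous (cmap (ch p))} /\
      {within cmap (ch p) @` cdom (ch p), continuous (cinv (ch p))}]) /\
  (forall p q, smooth (cmap (ch p) @` (cdom (ch p) `&` cdom (ch q)))
                      (cmap (ch q) \o cinv (ch p))).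

Hypothesis atl : atlas.

Lemma cdom_self p : cdom (ch p) p. Proof. by have [] := atl.1 p. Qed.

Lemma cdom_open p : open (cdom (ch p)). Proof. by have [] := atl.1 p. Qed.

Lemma cmapK p q : cdom (ch p) q -> cinv (ch p) (cmap (ch p) q) = q.
Proof. by move=> pq; have [_ _ _ + _] := atl.1 p; apply; rewrite inE. Qed.

Lemma cmap_continuous p q : cdom (ch p) q -> {for q, continuous (cmap (ch p))}.
Proof.
move=> pq; have [_ oD _ _ [+ _]] := atl.1 p.
by rewrite continuous_open_subspace // => /(_ q); apply; rewrite inE.
Qed.

Lemma cinv_continuous p x : (cmap (ch p) @` cdom (ch p)) x -> {for x, continuous (cinv (ch p))}.
Proof.
move=> px; have [_ _ oI _ [_ +]] := atl.1 p.
by rewrite continuous_open_subspace // => /(_ x); apply; rewrite inE.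
Qed.

Lemma image_in_open p U : open U -> open (image_in ch p U).
Proof.
move=> oU; have [_ _ oI _ _] := atl.1 p.
rewrite openE => _ [q [pq Uq] <-].
have px : (cmap (ch p) @` cdom (ch p)) (cmap (ch p) q) by exists q.
have NI : \forall y \near cmap (ch p) q, (cmap (ch p) @` cdom (ch p)) y.
  exact: open_nbhs_nbhs.
have NU : \forall y \near cmap (ch p) q, U (cinv (ch p) y).
  have := cinv_continuous px; rewrite /prop_for /continuous_at cmapK //; apply.
  exact: open_nbhs_nbhs.
apply: filterS2 NI NU => y [q' pq' <-]; rewrite cmapK // => Uq'.
by exists q'.
Qed.

Lemma image_in_mem p (U : set T) q : cdom (ch p) q -> U q -> image_in ch p U (cmap (ch p) q).
Proof. by move=> pq Uq; exists q. Qed.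

Lemma cinv_near p q U : cdom (ch p) q -> open U -> U q ->
  \forall y \near cmap (ch p) q,
    [/\ cdom (ch p) (cinv (ch p) y), U (cinv (ch p) y) &
        cmap (ch p) (cinv (ch p) y) = y].
Proof.
move=> pq oU Uq.
have : \forall y \near cmap (ch p) q, image_in ch p U y.
  by apply: open_nbhs_nbhs; split; [exact: image_in_open|exact: image_in_mem].
by apply: filterS => y [q' [pq' Uq'] <-]; rewrite cmapK.
Qed.

Definition transition p p' := cmap (ch p') \o cinv (ch p).

Lemma transitionE p p' q : cdom (ch p) q -> transition p p' (cmap (ch p) q) = cmap (ch p') q.
Proof. by move=> pq; rewrite /transition /= cmapK. Qed.

Lemma transition_smooth p p' : smooth (image_in ch p (cdom (ch p'))) (transition p p').
Proof. exact: atl.2. Qed.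

Lemma transition_diff p p' q : cdom (ch p) q -> cdom (ch p') q ->
  differentiable (transition p p') (cmap (ch p) q).
Proof.
move=> pq pq'; apply: smooth_differentiable (@transition_smooth p p') _.
exact: image_in_mem.
Qed.

Lemma jacobian_smooth m (U : set 'rV[R]_n) (f : 'rV[R]_n -> 'rV[R]_m) : open U ->
  smooth U f -> smooth U (fun x => 'J f x).
Proof.
move=> oU sf; apply/smooth_mxP => // i j.
have H := (smooth_mxP _ oU).1 (smooth_derive (delta_mx 0 i) sf) 0 j.
apply: smooth_ext H => // x Ux.
by rewrite jacobianE //; exact: smooth_differentiable sf Ux.
Qed.

Lemma mulmx_trans_jac p p' q v : cdom (ch p) q -> cdom (ch p') q ->
  v *m trans_jac ch p p' q = 'D_v (transition p p') (cmap (ch p) q).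
Proof. by move=> pq pq'; rewrite deriveEjacobian //; exact: transition_diff. Qed.

Lemma trans_jac_comp p p' p'' q : cdom (ch p) q -> cdom (ch p') q -> cdom (ch p'') q ->
  trans_jac ch p p' q *m trans_jac ch p' p'' q = trans_jac ch p p'' q.
Proof.
move=> h h' h''; apply/row_matrixP => i; rewrite !rowE mulmxA.
set v := delta_mx 0 i.
transitivity ('D_('D_v (transition p p') (cmap (ch p) q)) (transition p' p'') (cmap (ch p') q)).
  by rewrite -(mulmx_trans_jac v h h') -(mulmx_trans_jac _ h' h'').
rewrite (mulmx_trans_jac v h h'').
have D : is_derive (cmap (ch p) q) v (transition p p') ('D_v (transition p p') (cmap (ch p) q)).
  by apply: is_derive_diff; exact: transition_diff.
have E := transitionE p' h.
have D' : differentiable (transition p' p'') (transition p p' (cmap (ch p) q)).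
  by rewrite E; exact: transition_diff.
have [_] := is_derive_comp D' D; rewrite E => <-.
apply: near_eq_derive; apply: filterS (cinv_near h (cdom_open p') h') => y [h1 h2 h3].
by rewrite /= /transition /= cmapK.
Qed.

Lemma trans_jac_id p q : cdom (ch p) q -> trans_jac ch p p q = 1%:M.
Proof.
move=> pq; apply/row_matrixP => i; rewrite !rowE (mulmx_trans_jac _ pq pq) mulmx1.
rewrite (@near_eq_derive _ _ _ _ id) ?derive_id //.
by apply: filterS (cinv_near pq (cdom_open p) pq) => y [].
Qed.

Lemma trans_jacK p p' q : cdom (ch p) q -> cdom (ch p') q ->
  trans_jac ch p p' q *m trans_jac ch p' p q = 1%:M.
Proof. by move=> h h'; rewrite (trans_jac_comp h h' h) (trans_jac_id h). Qed.

Lemma near_eq_continuous (S : topologicalType) (f g : S -> T) s :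
  (\forall r \near s, f r = g r) -> {for s, continuous f} -> {for s, continuous g}.
Proof.
move=> fg cf; have : f @ s --> f s := cf.
rewrite (nbhs_singleton fg) => cgx; suff : g @ s --> g s by [].
by apply: cvg_trans cgx; exact: near_eq_cvg fg.
Qed.

Lemma chart_curve_continuous p (c : R -> T) t :
  (\forall s \near t, cdom (ch p) (c s)) -> {for t, continuous (cmap (ch p) \o c)} ->
  {for t, continuous c}.
Proof.
move=> cp cc.
apply: (@near_eq_continuous _ (cinv (ch p) \o (cmap (ch p) \o c))).
  by apply: filterS cp => s /= cs; rewrite cmapK.
apply: continuous_comp => //; apply: cinv_continuous.
by exists (c t) => //; exact: nbhs_singleton cp.
Qed.

Lemma has_velocity_continuous (c : R -> T) t v : has_velocity ch c t v ->
  {for t, continuous c}.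
Proof.
move=> [cp [dc _]]; apply: (chart_curve_continuous cp).
by apply: differentiable_continuous; exact/derivable1_diffP.
Qed.

Lemma curve_near (c : R -> T) t (U : set T) : {for t, continuous c} -> open U -> U (c t) ->
  \forall s \near t, U (c s).
Proof. by move=> cc oU Ut; apply: cc; exact: open_nbhs_nbhs. Qed.

Lemma has_velocity_chart p (c : R -> T) t v : cdom (ch p) (c t) ->
  has_velocity ch c t v ->
  is_derive t 1 (cmap (ch p) \o c) (v *m trans_jac ch (c t) p (c t)).
Proof.
move=> pc Hv; have cc := has_velocity_continuous Hv.
have [cp dc] := Hv.
have Dtr : differentiable (transition (c t) p) ((cmap (ch (c t)) \o c) t).
  by apply: transition_diff => //; exact: cdom_self.
have := is_derive_comp Dtr dc.
rewrite -mulmx_trans_jac //; last exact: cdom_self.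
apply: near_eq_is_derive; apply: filterS cp => s cs.
by rewrite /= transitionE.
Qed.

Lemma chart_has_velocity p (c : R -> T) t w :
  (\forall s \near t, cdom (ch p) (c s)) -> is_derive t 1 (cmap (ch p) \o c) w ->
  has_velocity ch c t (w *m trans_jac ch p (c t) (c t)).
Proof.
move=> cp dc.
have ct : cdom (ch p) (c t) := nbhs_singleton cp.
have cc : {for t, continuous c}.
  apply: (chart_curve_continuous cp); have [d _] := dc.
  by apply: differentiable_continuous; exact/derivable1_diffP.
split; first exact: curve_near cc (cdom_open _) (cdom_self _).
have Dtr : differentiable (transition p (c t)) ((cmap (ch p) \o c) t).
  by apply: transition_diff => //; exact: cdom_self.
have := is_derive_comp Dtr dc.
rewrite -mulmx_trans_jac //; last exact: cdom_self.
apply: near_eq_is_derive; apply: filterS cp => s cs.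
by rewrite /= transitionE.
Qed.

Lemma vec_inE p (X : T -> 'rV[R]_n) q : cdom (ch p) q ->
  vec_in ch p X (cmap (ch p) q) = X q *m trans_jac ch q p q.
Proof. by move=> pq; rewrite /vec_in cmapK. Qed.

Lemma vec_in_self p (X : T -> 'rV[R]_n) : vec_in ch p X (cmap (ch p) p) = X p.
Proof. by rewrite (vec_inE X (cdom_self p)) (trans_jac_id (cdom_self p)) mulmx1. Qed.

Lemma cov_inE p (a : T -> 'cV[R]_n) q : cdom (ch p) q ->
  cov_in ch p a (cmap (ch p) q) = trans_jac ch p q q *m a q.
Proof. by move=> pq; rewrite /cov_in cmapK. Qed.

Lemma cov_in_self p (a : T -> 'cV[R]_n) : cov_in ch p a (cmap (ch p) p) = a p.
Proof. by rewrite (cov_inE a (cdom_self p)) (trans_jac_id (cdom_self p)) mul1mx. Qed.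

Lemma fun_inE p (f : T -> R) q : cdom (ch p) q -> fun_in ch p f (cmap (ch p) q) = f q.
Proof. by move=> pq; rewrite /fun_in cmapK. Qed.

Lemma mulmx_in p (a : T -> 'cV[R]_n) (X : T -> 'rV[R]_n) q : cdom (ch p) q ->
  vec_in ch p X (cmap (ch p) q) *m cov_in ch p a (cmap (ch p) q) = X q *m a q.
Proof.
move=> pq; rewrite (vec_inE X pq) (cov_inE a pq) -mulmxA; congr (_ *m _).
by rewrite mulmxA (trans_jacK (cdom_self q) pq) mul1mx.
Qed.

Lemma vec_in_transition p p' (X : T -> 'rV[R]_n) q : cdom (ch p) q -> cdom (ch p') q ->
  vec_in ch p' X (cmap (ch p') q) =
  vec_in ch p X (cmap (ch p) q) *m trans_jac ch p p' q.
Proof.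
move=> pq pq'; apply: etrans (vec_inE X pq') _.
rewrite -(trans_jac_comp (cdom_self q) pq pq').
rewrite mulmxA.
exact: (congr1 (fun w => w *m trans_jac ch p p' q) (esym (vec_inE X pq))).
Qed.

Lemma cov_in_transition p p' (a : T -> 'cV[R]_n) q : cdom (ch p) q -> cdom (ch p') q ->
  cov_in ch p a (cmap (ch p) q) =
  trans_jac ch p p' q *m cov_in ch p' a (cmap (ch p') q).
Proof.
move=> pq pq'; apply: etrans (cov_inE a pq) _.
rewrite -(trans_jac_comp pq pq' (cdom_self q)) -mulmxA.
exact: (congr1 (mulmx (trans_jac ch p p' q)) (esym (cov_inE a pq'))).
Qed.

(** The derivative of a Jacobian is the non-tensorial part of every change of chart. Writing it as a
    second derivative of the transition lets [derive_comm] cancel it in brackets and in exterior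
    derivatives. *)
Lemma is_derive_trans_jac p p' q u : cdom (ch p) q -> cdom (ch p') q ->
  exists2 dJ : 'M[R]_n, is_derive (cmap (ch p) q) u
      (fun y => trans_jac ch p p' (cinv (ch p) y)) dJ &
    forall v, v *m dJ = 'D_u ('D_v (transition p p')) (cmap (ch p) q).
Proof.
move=> pq pq'; have oI := @image_in_open p _ (@cdom_open p').
have xI := image_in_mem pq pq'.
have sJ := jacobian_smooth oI (@transition_smooth p p').
have dJ := smooth_differentiable sJ xI.
have nI : \forall y \near cmap (ch p) q, image_in ch p (cdom (ch p')) y by exact: open_nbhs_nbhs.
exists ('D_u (fun y => 'J (transition p p') y) (cmap (ch p) q)).
  apply: near_eq_is_derive (is_derive_diff u dJ); apply: filterS nI => y [q' [pq1 _] <-].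
  by rewrite cmapK.
move=> v.
have [_] := is_derive_mulmx (is_derive_cst v (cmap (ch p) q) u) (is_derive_diff u dJ).
rewrite mul0mx add0r => E; apply: etrans (esym E) _; apply: near_eq_derive; apply: filterS nI => y Iy.
by rewrite deriveEjacobian //; exact: smooth_differentiable (@transition_smooth p p') Iy.
Qed.

End Atlas.

Section Calculus.
Context {R : realType}.

Lemma differentiable_mulmx (V : normedModType R) m n p
    (A : V -> 'M[R]_(m, n)) (B : V -> 'M[R]_(n, p)) x :
  differentiable A x -> differentiable B x -> differentiable (fun y => A y *m B y) x.
Proof.
move=> /differentiable_mxP dA /differentiable_mxP dB; apply/differentiable_mxP => i j.
have -> : (fun y => (A y *m B y) i j) =
   \sum_(k < n) ((fun y => A y i k) * (fun y => B y k j)).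
  by rewrite funeqE => y; rewrite mxE fct_sumE.
by apply: differentiable_sum => k; exact: differentiableM.
Qed.

Lemma derive_rV_basis n (W : normedModType R) (f : 'rV[R]_n -> W) x v :
  differentiable f x -> 'D_v f x = \sum_i v 0 i *: 'D_(delta_mx 0 i) f x.
Proof.
move=> df; rewrite deriveE // {1}(row_sum_delta v) linear_sum.
by apply: eq_bigr => i _; rewrite linearZ deriveE.
Qed.

Lemma smooth_directional n m k (U : set 'rV[R]_n) (f : 'rV[R]_n -> 'M[R]_(m, k))
    (w : 'rV[R]_n -> 'rV[R]_n) : open U -> smooth U f -> smooth U w ->
  smooth U (fun x => 'D_(w x) f x).
Proof.
move=> oU sf sw.
have sw' := (smooth_mxP _ oU).1 sw.
have : smooth U (fun x => \sum_i w x 0 i *: 'D_(delta_mx 0 i) f x).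
  apply: smooth_sum => // i; apply: smooth_scalemx => //.
  exact: smooth_derive.
apply: smooth_ext => // x Ux; rewrite derive_rV_basis //.
exact: smooth_differentiable sf Ux.
Qed.

Lemma addKr_eq (V : zmodType) (a b c d : V) : c = d -> a + c - (b + d) = a - b.
Proof. by move=> ->; rewrite opprD addrACA subrr addr0. Qed.

Lemma cartan_entries n (P Q : 'rV[R]_n) (a : 'cV[R]_n) (B E : 'M[R]_1) :
  (P *m a + B) 0 0 - (Q *m a + E) 0 0 - ((P - Q) *m a) 0 0 = (B - E) 0 0.
Proof.
rewrite mulmxBl; move: (P *m a) (Q *m a) => p q.
by rewrite !mxE; ring.
Qed.

Lemma mx11_tr (M : 'M[R]_1) : M^T = M.
Proof. by apply/matrixP => i j; rewrite mxE !ord1. Qed.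

End Calculus.

(** * Chart independence of exterior derivatives and brackets; Cartan's formula *)

Section FormsAndFields.
Context {R : realType} {n : nat} {T : topologicalType}.
Variable ch : charted R n T.
Hypothesis atl : atlas ch.

Lemma dform1E (a : T -> 'cV[R]_n) p u v :
  differentiable (cov_in ch p a) (cmap (ch p) p) ->
  form2 (dform1 ch a p) u v =
  (v *m 'D_u (cov_in ch p a) (cmap (ch p) p)
   - u *m 'D_v (cov_in ch p a) (cmap (ch p) p)) 0 0.
Proof.
move=> da; rewrite /form2 /dform1; move: da.
move: (cov_in ch p a) (cmap (ch p) p) => c x dc.
pose G : 'M[R]_n := \matrix_(i, j) ('D_(delta_mx 0 i) c x) j 0.
have DG w : 'D_w c x = (w *m G)^T.
  rewrite derive_rV_basis //; apply/colP => j; rewrite summxE !mxE.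
  by apply: eq_bigr => i _; rewrite !mxE.
have -> : (\matrix_(i, j) (('D_(delta_mx 0 i) c x) j 0 - ('D_(delta_mx 0 j) c x) i 0))
   = G - G^T by apply/matrixP => i j; rewrite !mxE.
have E : u *m (G - G^T) *m v^T = v *m (u *m G)^T - u *m (v *m G)^T.
  rewrite mulmxBr mulmxBl -[u *m G *m v^T]mx11_tr trmx_mul trmxK.
  by rewrite -(mulmxA u) -trmx_mul.
by rewrite !DG E.
Qed.

(** Near [q] the form read in [ch q] is the transition Jacobian times the form read in [ch p]. The
    Leibniz rule splits its derivative into a tensorial term and one in which the Jacobian is
    differentiated. *)
Lemma is_derive_cov_in (a : T -> 'cV[R]_n) p q u : cdom (ch p) q ->
  differentiable (cov_in ch p a) (cmap (ch p) q) ->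
  exists2 dJ : 'M[R]_n,
    is_derive (cmap (ch q) q) u (cov_in ch q a)
      (dJ *m cov_in ch p a (cmap (ch p) q) + trans_jac ch q p q *m
         'D_(u *m trans_jac ch q p q) (cov_in ch p a) (cmap (ch p) q)) &
    forall v, v *m dJ = 'D_u ('D_v (transition ch q p)) (cmap (ch q) q).
Proof.
move=> pq da; have qq := cdom_self atl q.
have [dJ DJ vdJ] := is_derive_trans_jac atl u qq pq; exists dJ => //.
have E := transitionE atl p qq.
have dt : is_derive (cmap (ch q) q) u (transition ch q p) (u *m trans_jac ch q p q).
  by rewrite (mulmx_trans_jac atl u qq pq); apply: is_derive_diff; exact: transition_diff.
have Dc : is_derive (cmap (ch q) q) u (cov_in ch p a \o transition ch q p)
    ('D_(u *m trans_jac ch q p q) (cov_in ch p a) (cmap (ch p) q)).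
  have da' : differentiable (cov_in ch p a) (transition ch q p (cmap (ch q) q)) by rewrite E.
  by have := is_derive_comp da' dt; rewrite E.
have := is_derive_mulmx DJ Dc; rewrite (cmapK atl qq) /= E.
apply: near_eq_is_derive.
apply: filterS (cinv_near atl qq (cdom_open atl p) pq) => y [h1 h2 h3].
have K := cov_in_transition atl a h1 h2; rewrite h3 in K.
exact: esym K.
Qed.

Lemma differentiable_trans_jac p p' q : cdom (ch p) q -> cdom (ch p') q ->
  differentiable (fun y => trans_jac ch p p' (cinv (ch p) y)) (cmap (ch p) q).
Proof.
move=> pq pq'; have oI := @image_in_open _ _ _ _ atl p _ (cdom_open atl p').
have xI := image_in_mem pq pq'.
have dJ := smooth_differentiable (jacobian_smooth oI (transition_smooth atl p p')) xI.
apply: near_eq_differentiable dJ.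
have : \forall y \near cmap (ch p) q, image_in ch p (cdom (ch p')) y by exact: open_nbhs_nbhs.
apply: filterS => y [q' [pq1 _] <-]; rewrite (cmapK atl pq1) //.
Qed.

Lemma differentiable_cov_in (a : T -> 'cV[R]_n) p q : cdom (ch p) q ->
  differentiable (cov_in ch p a) (cmap (ch p) q) ->
  differentiable (cov_in ch q a) (cmap (ch q) q).
Proof.
move=> pq da; have qq := cdom_self atl q.
have E := transitionE atl p qq.
have d1 := differentiable_trans_jac qq pq.
have d2 : differentiable (cov_in ch p a \o transition ch q p) (cmap (ch q) q).
  by apply: differentiable_comp; [exact: transition_diff|rewrite E].
apply: near_eq_differentiable (differentiable_mulmx d1 d2).
apply: filterS (cinv_near atl qq (cdom_open atl p) pq) => y [h1 h2 h3].
have K := cov_in_transition atl a h1 h2; rewrite h3 in K.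
exact: esym K.
Qed.

(** The terms with a differentiated Jacobian are symmetric in [u] and [v], hence disappear under
    antisymmetrization. *)
Lemma dform1_in_chart (a : T -> 'cV[R]_n) p q u v : cdom (ch p) q ->
  differentiable (cov_in ch p a) (cmap (ch p) q) ->
  form2 (dform1 ch a q) u v =
  (v *m trans_jac ch q p q *m
     'D_(u *m trans_jac ch q p q) (cov_in ch p a) (cmap (ch p) q)
   - u *m trans_jac ch q p q *m
     'D_(v *m trans_jac ch q p q) (cov_in ch p a) (cmap (ch p) q)) 0 0.
Proof.
move=> pq da; have qq := cdom_self atl q.
rewrite (dform1E _ _ (differentiable_cov_in pq da)).
have [dJu [_ ->] vdJu] := is_derive_cov_in u pq da.
have [dJv [_ ->] vdJv] := is_derive_cov_in v pq da.
have comm : v *m dJu = u *m dJv.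
  rewrite vdJu vdJv.
  apply: derive_comm (image_in_open atl (p := q) (cdom_open atl p)) _ (transition_smooth atl q p).
  exact: image_in_mem.
rewrite !mulmxDr !mulmxA comm.
by rewrite opprD addrACA subrr add0r.
Qed.

Lemma differentiable_vec_in (X : T -> 'rV[R]_n) p q : cdom (ch p) q ->
  differentiable (vec_in ch p X) (cmap (ch p) q) ->
  differentiable (vec_in ch q X) (cmap (ch q) q).
Proof.
move=> pq dX; have qq := cdom_self atl q.
have E := transitionE atl p qq.
have d2 : differentiable (vec_in ch p X \o transition ch q p) (cmap (ch q) q).
  by apply: differentiable_comp; [exact: transition_diff|rewrite E].
have d1 : differentiable ((fun y => trans_jac ch p q (cinv (ch p) y)) \o transition ch q p)
    (cmap (ch q) q).
  apply: differentiable_comp; first exact: transition_diff.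
  by rewrite E; exact: differentiable_trans_jac.
apply: near_eq_differentiable (differentiable_mulmx d2 d1).
apply: filterS (cinv_near atl qq (cdom_open atl p) pq) => y [h1 h2 h3].
have K := vec_in_transition atl X h2 h1; rewrite h3 in K.
apply: etrans (esym K).
have K2 : cinv (ch p) (transition ch q p y) = cinv (ch q) y by exact: cmapK.
exact: (congr1 (fun r => vec_in ch p X (transition ch q p y) *m trans_jac ch p q r) K2).
Qed.

Lemma derive_vec_in (X : T -> 'rV[R]_n) p q u : cdom (ch p) q ->
  differentiable (vec_in ch p X) (cmap (ch p) q) ->
  exists2 dJ : 'M[R]_n,
   'D_(u *m trans_jac ch q p q) (vec_in ch p X) (cmap (ch p) q) =
     'D_u (vec_in ch q X) (cmap (ch q) q) *m trans_jac ch q p q + X q *m dJ &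
   forall v, v *m dJ = 'D_u ('D_v (transition ch q p)) (cmap (ch q) q).
Proof.
move=> pq dX; have qq := cdom_self atl q.
have [dJ DJ vdJ] := is_derive_trans_jac atl u qq pq; exists dJ => //.
have E := transitionE atl p qq.
have dt : is_derive (cmap (ch q) q) u (transition ch q p) (u *m trans_jac ch q p q).
  by rewrite (mulmx_trans_jac atl u qq pq); apply: is_derive_diff; exact: transition_diff.
have dX' : differentiable (vec_in ch p X) (transition ch q p (cmap (ch q) q)) by rewrite E.
have [_ K0] := is_derive_comp dX' dt; rewrite E in K0; apply: etrans (esym K0) _.
have [_ K1] := is_derive_mulmx (is_derive_diff u (differentiable_vec_in pq dX)) DJ.
rewrite (cmapK atl qq) (vec_in_self atl) in K1; apply: etrans _ K1.
apply: near_eq_derive.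
apply: filterS (cinv_near atl qq (cdom_open atl p) pq) => y [h1 h2 h3].
have K := vec_in_transition atl X h1 h2; rewrite h3 in K.
exact: K.
Qed.

(** Both directional derivatives pick up a second derivative of the transition in the directions
    [X q] and [Y q]; by symmetry the two corrections are equal and their difference drops out. *)
Lemma lie_bracket_in_chart (X Y : T -> 'rV[R]_n) p q : cdom (ch p) q ->
  differentiable (vec_in ch p X) (cmap (ch p) q) ->
  differentiable (vec_in ch p Y) (cmap (ch p) q) ->
  vec_in ch p (lie_bracket ch X Y) (cmap (ch p) q) =
  'D_(vec_in ch p X (cmap (ch p) q)) (vec_in ch p Y) (cmap (ch p) q)
  - 'D_(vec_in ch p Y (cmap (ch p) q)) (vec_in ch p X) (cmap (ch p) q).
Proof.
move=> pq dX dY; have qq := cdom_self atl q.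
apply: etrans (vec_inE atl (lie_bracket ch X Y) pq) _.
have [J1 E1 H1] := derive_vec_in (X q) pq dY.
have [J2 E2 H2] := derive_vec_in (Y q) pq dX.
have -> : vec_in ch p X (cmap (ch p) q) = X q *m trans_jac ch q p q by exact: vec_inE.
have -> : vec_in ch p Y (cmap (ch p) q) = Y q *m trans_jac ch q p q by exact: vec_inE.
have comm : Y q *m J1 = X q *m J2.
  rewrite H1 H2.
  apply: derive_comm (image_in_open atl (p := q) (cdom_open atl p)) _ (transition_smooth atl q p).
  exact: image_in_mem.
apply: esym; apply: etrans (congr2 (fun a b : 'rV[R]_n => a - b) E1 E2) _.
by apply: etrans (addKr_eq _ _ comm) _; exact: esym (mulmxBl _ _ _).
Qed.

Lemma smooth_vec_diff U (X : T -> 'rV[R]_n) p q : smooth_vec ch U X -> U q ->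
  cdom (ch p) q -> differentiable (vec_in ch p X) (cmap (ch p) q).
Proof.
by move=> sX Uq pq; apply: smooth_differentiable (sX p) _; exact: image_in_mem.
Qed.

Lemma smooth_cov_diff U (a : T -> 'cV[R]_n) p q : smooth_cov ch U a -> U q ->
  cdom (ch p) q -> differentiable (cov_in ch p a) (cmap (ch p) q).
Proof.
by move=> sa Uq pq; apply: smooth_differentiable (sa p) _; exact: image_in_mem.
Qed.

(** The bracket at [q] is defined through the chart of [q] itself, which varies with [q] in no
    regular way. Smoothness shows only in the formula for a fixed chart. *)
Lemma smooth_vec_bracket U (X Y : T -> 'rV[R]_n) : open U -> smooth_vec ch U X ->
  smooth_vec ch U Y -> smooth_vec ch U (lie_bracket ch X Y).
Proof.
move=> oU sX sY p.
have oI := image_in_open atl (p := p) oU.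
have sN (f : 'rV[R]_n -> 'rV[R]_n) : smooth (image_in ch p U) f ->
    smooth (image_in ch p U) (fun x => - f x).
  move=> sf; have := smooth_scalemx oI (smooth_cst (V := 'rV[R]_n) (W := R) (image_in ch p U) (-1)) sf.
  by apply: smooth_ext => // x _; rewrite scaleN1r.
have := smoothD oI (smooth_directional oI (sY p) (sX p))
  (sN _ (smooth_directional oI (sX p) (sY p))).
apply: smooth_ext => // x [q [pq Uq] <-]; apply: esym.
by apply: lie_bracket_in_chart; [|exact: smooth_vec_diff sX Uq pq|exact: smooth_vec_diff sY Uq pq].
Qed.

Lemma smooth_fun_dform1 U (a : T -> 'cV[R]_n) (X Y : T -> 'rV[R]_n) : open U ->
  smooth_cov ch U a -> smooth_vec ch U X -> smooth_vec ch U Y ->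
  smooth_fun ch U (fun p => form2 (dform1 ch a p) (X p) (Y p)).
Proof.
move=> oU sa sX sY p.
have oI := image_in_open atl (p := p) oU.
have s1 := smooth_mulmx oI (sY p) (smooth_directional oI (sa p) (sX p)).
have s2 := smooth_mulmx oI (sX p) (smooth_directional oI (sa p) (sY p)).
have s1' := (smooth_mxP _ oI).1 s1 0 0.
have s2' := (smooth_mxP _ oI).1 s2 0 0.
have := smoothD oI s1' (smoothM oI (smooth_cst (V := 'rV[R]_n) (W := R) (image_in ch p U) (-1)) s2').
apply: smooth_ext => // x [q [pq Uq] <-].
rewrite mulN1r; apply: esym; apply: etrans (fun_inE atl _ pq) _.
rewrite (dform1_in_chart _ _ pq (smooth_cov_diff sa Uq pq)).
have -> : vec_in ch p X (cmap (ch p) q) = X q *m trans_jac ch q p q by exact: vec_inE.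
have -> : vec_in ch p Y (cmap (ch p) q) = Y q *m trans_jac ch q p q by exact: vec_inE.
by rewrite mxE [X in _ + X]mxE.
Qed.

Lemma derive_fun_pairing (a : T -> 'cV[R]_n) (X : T -> 'rV[R]_n) p u :
  differentiable (cov_in ch p a) (cmap (ch p) p) ->
  differentiable (vec_in ch p X) (cmap (ch p) p) ->
  'D_u (fun_in ch p (fun q => pairing (a q) (X q))) (cmap (ch p) p) =
  ('D_u (vec_in ch p X) (cmap (ch p) p) *m a p
   + X p *m 'D_u (cov_in ch p a) (cmap (ch p) p)) 0 0.
Proof.
move=> da dX; have pp := cdom_self atl p.
have H := is_derive_mulmx (is_derive_diff u dX) (is_derive_diff u da).
rewrite (vec_in_self atl) (cov_in_self atl) in H.
have [_ <-] := (is_derive_mxP _ _ _ _).1 H 0 0.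
apply: near_eq_derive.
apply: filterS (cinv_near atl pp (cdom_open atl p) pp) => y [h1 _ h3].
rewrite /fun_in /pairing; have K := mulmx_in atl a X h1; rewrite h3 in K.
exact: (congr1 (fun M : 'M[R]_1 => M 0 0) (esym K)).
Qed.

(** Expanding the two derivatives of pairings by the Leibniz rule, the terms in which a field is
    differentiated assemble into a([X, Y]) and cancel. *)
Lemma dform1_cartan (a : T -> 'cV[R]_n) (X Y : T -> 'rV[R]_n) p :
  differentiable (cov_in ch p a) (cmap (ch p) p) ->
  differentiable (vec_in ch p X) (cmap (ch p) p) ->
  differentiable (vec_in ch p Y) (cmap (ch p) p) ->
  form2 (dform1 ch a p) (X p) (Y p) =
  'D_(X p) (fun_in ch p (fun q => pairing (a q) (Y q))) (cmap (ch p) p)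
  - 'D_(Y p) (fun_in ch p (fun q => pairing (a q) (X q))) (cmap (ch p) p)
  - pairing (a p) (lie_bracket ch X Y p).
Proof.
move=> da dX dY.
apply: etrans (dform1E _ _ da) _; apply: esym.
apply: etrans (congr2 (fun r s => r - s - pairing (a p) (lie_bracket ch X Y p))
  (derive_fun_pairing (X p) da dY) (derive_fun_pairing (Y p) da dX)) _.
exact: cartan_entries.
Qed.

End FormsAndFields.

(** * Hamiltonian vector fields on the cotangent bundle *)

Section Cotangent.
Context {R : realType} {n : nat} {T : topologicalType}.
Variable ch : charted R n T.
Hypothesis atl : atlas ch.
Implicit Types z : T * 'cV[R]_n.

Lemma is_derive_lsub_id (y u : 'rV[R]_(n + n)) :
  is_derive y u (fun y' => lsubmx y') (lsubmx u : 'rV[R]_n).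
Proof. exact: is_derive_lsubmx (is_derive_id y u). Qed.

Lemma is_derive_rsub_id (y u : 'rV[R]_(n + n)) :
  is_derive y u (fun y' => rsubmx y') (rsubmx u : 'rV[R]_n).
Proof. exact: is_derive_rsubmx (is_derive_id y u). Qed.

Lemma differentiable_trmx (V : normedModType R) m k (M : V -> 'M[R]_(m, k)) x :
  differentiable M x -> differentiable (fun y => (M y)^T) x.
Proof.
move=> /differentiable_mxP dM; apply/differentiable_mxP => i j.
by under eq_fun do rewrite mxE; exact: dM.
Qed.

Lemma differentiable_row_mx (V : normedModType R) m k1 k2 (A : V -> 'M[R]_(m, k1))
    (B : V -> 'M[R]_(m, k2)) x :
  differentiable A x -> differentiable B x -> differentiable (fun y => row_mx (A y) (B y)) x.
Proof.
move=> /differentiable_mxP dA /differentiable_mxP dB; apply/differentiable_mxP => i j.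
under eq_fun do rewrite mxE.
by case: (fintype.split j) => k; [exact: dA|exact: dB].
Qed.

Lemma cotangent_near p q (U : set T) (y : 'rV[R]_(n + n)) :
  cdom (ch p) q -> open U -> U q -> lsubmx y = cmap (ch p) q ->
  \forall y' \near y, [/\ cdom (ch p) (cinv (ch p) (lsubmx y')),
     U (cinv (ch p) (lsubmx y')) &
     cmap (ch p) (cinv (ch p) (lsubmx y')) = lsubmx y'].
Proof.
move=> pq oU Uq yz.
have := cinv_near atl pq oU Uq; rewrite -yz.
have cl : {for y, continuous (fun y' : 'rV[R]_(n + n) => lsubmx y' : 'rV[R]_n)}.
  exact: differentiable_continuous (differentiable_lsubmx _).
exact: cl.
Qed.

Lemma cotangent_cmapK z (y : 'rV[R]_(n + n)) :
  cdom (ch z.1) (cinv (ch z.1) (lsubmx y)) ->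
  cmap (ch z.1) (cinv (ch z.1) (lsubmx y)) = lsubmx y ->
  cmap (cotangent ch z) (cinv (cotangent ch z) y) = y.
Proof.
move=> h1 h2; rewrite /= h2 mulmxA (trans_jacK atl h1 (cdom_self atl _)) mul1mx trmxK.
exact: hsubmxK.
Qed.

Lemma cotangent_cmap_self z : cmap (cotangent ch z) z = row_mx (cmap (ch z.1) z.1) z.2^T.
Proof. by rewrite /= (trans_jac_id atl (cdom_self atl _)) mul1mx. Qed.

(** Only the base part of the Jacobian between induced charts is computed, because the tautological
    form has zero fibre components and sees nothing else. *)
Lemma cotangent_trans_jac z q0 (y u : 'rV[R]_(n + n)) :
  cdom (ch z.1) (cinv (ch z.1) (lsubmx y)) ->
  cmap (ch z.1) (cinv (ch z.1) (lsubmx y)) = lsubmx y ->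
  q0 = cinv (ch z.1) (lsubmx y) ->
  lsubmx (u *m trans_jac (cotangent ch) z (cinv (cotangent ch z) y) (cinv (cotangent ch z) y))
  = lsubmx u *m trans_jac ch z.1 q0 q0.
Proof.
move=> h1 h2 q0E; have wy := cotangent_cmapK h1 h2; rewrite -q0E in h1 h2.
have q00 := cdom_self atl q0.
pose w := cinv (cotangent ch z) y.
have w1 : w.1 = q0 by rewrite q0E.
pose F := cmap (cotangent ch w) \o cinv (cotangent ch z).
have near0 := cotangent_near h1 (cdom_open atl q0) q00 (esym h2).
have nearF : \forall y' \near y, let r := cinv (ch z.1) (lsubmx y') in
    F y' = row_mx (transition ch z.1 q0 (lsubmx y')) (trans_jac ch q0 z.1 r *m (rsubmx y')^T)^T.
  apply: filterS near0 => y' [k1 k2 k3] r.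
  rewrite /F /= -q0E; congr (row_mx _ (_^T)).
  apply: etrans (mulmxA _ _ _) _.
  exact: (congr1 (mulmx^~ (rsubmx y')^T) (trans_jac_comp atl k2 (cdom_self atl r) k1)).
have dl : differentiable (fun y' : 'rV[R]_(n + n) => lsubmx y' : 'rV[R]_n) y.
  exact: differentiable_lsubmx.
have dtr : differentiable (transition ch z.1 q0) (lsubmx y).
  by rewrite -h2; exact: transition_diff.
have dF1 : differentiable (transition ch z.1 q0 \o (fun y' : 'rV[R]_(n + n) => lsubmx y')) y.
  exact: differentiable_comp.
have tE : transition ch z.1 q0 (lsubmx y) = cmap (ch q0) q0.
  by rewrite -h2; exact: transitionE.
have dF2 : differentiable (fun y' : 'rV[R]_(n + n) =>
    trans_jac ch q0 z.1 (cinv (ch z.1) (lsubmx y'))) y.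
  have d3 : differentiable ((fun x => trans_jac ch q0 z.1 (cinv (ch q0) x)) \o
      (transition ch z.1 q0 \o (fun y' : 'rV[R]_(n + n) => lsubmx y'))) y.
    apply: differentiable_comp => //.
    have -> : (transition ch z.1 q0 \o (fun y' : 'rV[R]_(n + n) => lsubmx y')) y = cmap (ch q0) q0 by exact: tE.
    exact: differentiable_trans_jac.
  apply: near_eq_differentiable d3.
  apply: filterS near0 => y' [k1 k2 k3].
  exact: (congr1 (trans_jac ch q0 z.1) (cmapK atl k2)).
have dF3 : differentiable (fun y' : 'rV[R]_(n + n) => (rsubmx y' : 'rV[R]_n)^T) y.
  by apply: differentiable_trmx; exact: differentiable_rsubmx.
have dF : differentiable F y.
  have := differentiable_row_mx dF1 (differentiable_trmx (differentiable_mulmx dF2 dF3)).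
  by apply: near_eq_differentiable; apply: filterS nearF => y' /= ->.
have -> : u *m trans_jac (cotangent ch) z w w = 'D_u F y.
  by rewrite /trans_jac wy; exact: esym (deriveEjacobian u dF).
have [_ <-] := is_derive_lsubmx (is_derive_diff u dF).
have K : is_derive y u (transition ch z.1 q0 \o (fun y' : 'rV[R]_(n + n) => lsubmx y'))
    ('D_(lsubmx u) (transition ch z.1 q0) (lsubmx y)).
  exact: is_derive_comp dtr (is_derive_lsub_id y u).
have E := mulmx_trans_jac atl (lsubmx u) h1 q00; rewrite h2 in E.
apply: etrans (esym E).
have [_ <-] := K.
apply: near_eq_derive; apply: filterS nearF => y' /= ->.
exact: row_mxKl.
Qed.

(** In every induced chart the form is xi dx: the base Jacobian from the change of chart cancels the
    one built into the fibre coordinate. *)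
Lemma tautological_in z (y : 'rV[R]_(n + n)) :
  cdom (ch z.1) (cinv (ch z.1) (lsubmx y)) ->
  cmap (ch z.1) (cinv (ch z.1) (lsubmx y)) = lsubmx y ->
  cov_in (cotangent ch) z (@tautological R n T) y = col_mx (rsubmx y)^T 0.
Proof.
move=> h1 h2; pose q0 := cinv (ch z.1) (lsubmx y).
apply/row_matrixP => i; rewrite !rowE; set u := delta_mx 0 i.
have E := @cotangent_trans_jac z q0 y u h1 h2 erefl.
rewrite /cov_in mulmxA; set M := u *m trans_jac _ _ _ _ in E *.
rewrite -[M]hsubmxK -[in RHS](hsubmxK u) /tautological !mul_row_col !mulmx0 !addr0.
rewrite E -mulmxA.
have K : trans_jac ch z.1 q0 q0 *m (trans_jac ch q0 z.1 q0 *m (rsubmx y)^T) = (rsubmx y)^T.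
  by rewrite mulmxA (trans_jacK atl h1 (cdom_self atl q0)) mul1mx.
exact: (congr1 (mulmx (lsubmx u)) K).
Qed.

(** This is the canonical form dxi wedge dx, since the fibre coordinate is linear in the chart and
    its derivative is immediate. *)
Lemma tautological_form2 z (v h : 'rV[R]_(n + n)) :
  form2 (dform1 (cotangent ch) (@tautological R n T) z) v h =
  (rsubmx v *m (lsubmx h)^T - lsubmx v *m (rsubmx h)^T) 0 0.
Proof.
have zE := cotangent_cmap_self z.
set y0 := cmap (cotangent ch z) z in zE *.
have nearE : \forall y \near y0, cov_in (cotangent ch) z (@tautological R n T) y =
    col_mx (rsubmx y)^T 0.
  have ly : lsubmx y0 = cmap (ch z.1) z.1 by rewrite zE row_mxKl.
  apply: filterS (cotangent_near (cdom_self atl _) (cdom_open atl z.1) (cdom_self atl _) ly) => y [h1 _ h3].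
  exact: tautological_in.
have D w : is_derive y0 w (cov_in (cotangent ch) z (@tautological R n T)) (col_mx (rsubmx w)^T 0).
  have := is_derive_col_mx (is_derive_trmx (is_derive_rsub_id y0 w)) (is_derive_cst (0 : 'cV[R]_n) y0 w).
  by apply: near_eq_is_derive; apply: filterS nearE => y ->.
have dc : differentiable (cov_in (cotangent ch) z (@tautological R n T)) y0.
  have d1 : differentiable (fun y : 'rV[R]_(n + n) => row_mx (rsubmx y : 'rV[R]_n) (0 : 'rV[R]_n)) y0.
    by apply: differentiable_row_mx; [exact: differentiable_rsubmx|exact: differentiable_cst].
  have := differentiable_trmx d1.
  apply: near_eq_differentiable; apply: filterS nearE => y ->.
  by rewrite tr_row_mx trmx0.
rewrite (dform1E _ _ dc).
have [_ ->] := D v; have [_ ->] := D h.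
have mul_top (w w' : 'rV[R]_(n + n)) :
    w *m col_mx (rsubmx w')^T (0 : 'cV[R]_n) = lsubmx w *m (rsubmx w')^T.
  by rewrite -{1}(hsubmxK w) mul_row_col mulmx0 addr0.
by rewrite !mul_top -[lsubmx h *m _]mx11_tr trmx_mul trmxK.
Qed.

Lemma hamiltonian_vectorP (H : T * 'cV[R]_n -> R) z (h : 'rV[R]_(n + n)) :
  hamiltonian_vector ch H z h <->
  forall v, (rsubmx v *m (lsubmx h)^T - lsubmx v *m (rsubmx h)^T) 0 0 =
     dfun (cotangent ch) H z v.
Proof.
split=> Hh v; first by apply: etrans (Hh v); rewrite tautological_form2.
by apply: etrans (Hh v); rewrite tautological_form2.
Qed.

Lemma momentum_in (X : T -> 'rV[R]_n) z :
  fun_in (cotangent ch) z (momentum X) =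
  (fun y => (vec_in ch z.1 X (lsubmx y) *m (rsubmx y)^T) 0 0).
Proof. by apply/funext => y; rewrite /fun_in /momentum /pairing /vec_in /= mulmxA. Qed.

Lemma dfun_momentum (X : T -> 'rV[R]_n) z v :
  differentiable (vec_in ch z.1 X) (cmap (ch z.1) z.1) ->
  dfun (cotangent ch) (momentum X) z v =
  ('D_(lsubmx v) (vec_in ch z.1 X) (cmap (ch z.1) z.1) *m z.2 + X z.1 *m (rsubmx v)^T) 0 0.
Proof.
move=> dX; rewrite /dfun momentum_in cotangent_cmap_self.
set y0 := row_mx _ _.
have ly : lsubmx y0 = cmap (ch z.1) z.1 by exact: row_mxKl.
have ry : rsubmx y0 = z.2^T by exact: row_mxKr.
have dX' : differentiable (vec_in ch z.1 X) (lsubmx y0) by rewrite ly.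
have K := is_derive_mulmx (is_derive_comp dX' (is_derive_lsub_id y0 v))
  (is_derive_trmx (is_derive_rsub_id y0 v)).
have [_ ->] := (is_derive_mxP _ _ _ _).1 K 0 0.
by rewrite /= ly ry trmxK (vec_in_self atl).
Qed.

(** Hamilton's equations for the fibrewise linear function [momentum X]: purely vertical test
    vectors give the base velocity, purely horizontal ones give the fibre velocity, which is minus
    the transposed derivative of [X] applied to the covector. *)
Lemma hamiltonian_momentumP (X : T -> 'rV[R]_n) z (h : 'rV[R]_(n + n)) :
  differentiable (vec_in ch z.1 X) (cmap (ch z.1) z.1) ->
  hamiltonian_vector ch (momentum X) z h <->
  lsubmx h = X z.1 /\
  forall u, u *m (rsubmx h)^T = - ('D_u (vec_in ch z.1 X) (cmap (ch z.1) z.1) *m z.2).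
Proof.
move=> dX.
have D0 : 'D_0 (vec_in ch z.1 X) (cmap (ch z.1) z.1) = 0 by exact: derive0.
split=> [/hamiltonian_vectorP Hh|[hl hr]].
  split.
    apply/trmx_inj/row_matrixP => i; rewrite !rowE.
    have := Hh (row_mx 0 (delta_mx 0 i)).
    rewrite (dfun_momentum _ dX) row_mxKl row_mxKr mul0mx subr0 D0 mul0mx add0r.
    move=> E; apply/matrixP => k l; rewrite !ord1 E.
    by rewrite -[X z.1 *m _]mx11_tr trmx_mul trmxK.
  move=> u; have := Hh (row_mx u 0).
  rewrite (dfun_momentum _ dX) row_mxKl row_mxKr mul0mx trmx0 mulmx0 sub0r addr0 => E.
  apply/matrixP => k l; rewrite !ord1; move: E; rewrite !mxE => <-.
  by rewrite opprK.
apply/hamiltonian_vectorP => v; rewrite (dfun_momentum _ dX) hl hr opprK addrC.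
by rewrite -[rsubmx v *m _]mx11_tr trmx_mul trmxK.
Qed.

Lemma has_velocity_cotangent (c : R -> T) (zeta : R -> 'cV[R]_n) t (h : 'rV[R]_(n + n)) :
  has_velocity (cotangent ch) (fun s => (c s, zeta s)) t h <->
  has_velocity ch c t (lsubmx h) /\
  is_derive t 1 (fun s => trans_jac ch (c t) (c s) (c s) *m zeta s) (rsubmx h)^T.
Proof.
split=> [[cd dh]|[[cd dl] dr]].
  split; first split => //.
    have E : cmap (ch (c t)) \o c =
        (fun s => lsubmx ((cmap (cotangent ch (c t, zeta t)) \o (fun r => (c r, zeta r))) s)).
      by apply/funext => s; exact: esym (row_mxKl _ _).
    by rewrite E; exact: is_derive_lsubmx dh.
  have E : (fun s => trans_jac ch (c t) (c s) (c s) *m zeta s) =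
      (fun s => (rsubmx ((cmap (cotangent ch (c t, zeta t)) \o (fun r => (c r, zeta r))) s))^T).
    by apply/funext => s; rewrite /= row_mxKr trmxK.
  by rewrite E; exact: is_derive_trmx (is_derive_rsubmx dh).
split=> //; rewrite -[h]hsubmxK -[rsubmx h]trmxK.
exact: is_derive_row_mx dl (is_derive_trmx dr).
Qed.

End Cotangent.

(** * Integral curves on manifolds *)

Section IntegralCurves.
Context {R : realType} {n : nat} {T : topologicalType}.
Variable ch : charted R n T.
Hypothesis atl : atlas ch.
Variables (Om : set T) (Z : T -> 'rV[R]_n).
Hypothesis oOm : open Om.
Hypothesis lipZ : forall p, Om p -> locally_lipschitz (vec_in ch p Z) (cmap (ch p) p).

Definition integral_curve (J : set R) (c : R -> T) :=
  forall t, J t -> Om (c t) /\ has_velocity ch c t (Z (c t)).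

Lemma has_velocity_near (c d : R -> T) t v : (\forall s \near t, c s = d s) ->
  has_velocity ch c t v -> has_velocity ch d t v.
Proof.
move=> cd [h1 h2]; have cdt : c t = d t := nbhs_singleton cd.
split; first by rewrite -cdt; apply: filterS2 cd h1 => s ->.
by rewrite -cdt; apply: near_eq_is_derive h2; apply: filterS cd => s /= ->.
Qed.

Lemma has_velocity_shift (c : R -> T) (k : R) t v : has_velocity ch c (t + k) v ->
  has_velocity ch (fun s => c (s + k)) t v.
Proof.
move=> [h1 h2].
have D : is_derive t 1 (fun s : R => s + k) 1.
  by have := is_deriveD (is_derive_id t 1) (is_derive_cst k t (1 : R)); rewrite addr0.
have ck : {for t, continuous (fun s : R => s + k)}.
  apply: differentiable_continuous; have [d _] := D; exact/derivable1_diffP.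
split; first exact: (ck _ h1).
have d2 : differentiable (cmap (ch (c (t + k))) \o c) (t + k).
  by have [d _] := h2; exact/derivable1_diffP.
have [_ E] := h2; have := @is_derive_comp R R R 'rV[R]_n (fun s : R => s + k) _ t 1 1 d2 D.
by rewrite E.
Qed.

Lemma integral_chart p (c : R -> T) t : cdom (ch p) (c t) ->
  has_velocity ch c t (Z (c t)) ->
  is_derive t 1 (cmap (ch p) \o c) (vec_in ch p Z ((cmap (ch p) \o c) t)).
Proof. by move=> pc /(has_velocity_chart atl pc); rewrite -(vec_inE atl Z pc). Qed.

Lemma integral_curve_exists p : Om p ->
  exists2 r : R, 0 < r & exists2 c : R -> T, c 0 = p & integral_curve [set t | `|t| < r] c.
Proof.
move=> Op; have pp := cdom_self atl p.
have [r r0 [x x0 dx]] := picard_local (lipZ Op).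
have cx : {for 0, continuous x}.
  apply: differentiable_continuous; apply/derivable1_diffP.
  by have [] := dx 0; rewrite ?normr0.
have N := cinv_near atl pp oOm Op; rewrite -x0 in N.
have /near_normP[s s0 Hs] := cx _ N.
exists (Num.min r s); first by rewrite lt_min r0.
exists (fun t => cinv (ch p) (x t)) => [|t]; first by rewrite x0 cmapK.
rewrite /= lt_min => /andP[tr ts].
have nt : \forall u \near t, `|u - 0| < s.
  apply/near_normP; exists (s - `|t|) => [|u ut]; first by rewrite subr_gt0.
  rewrite subr0 -(subrK t u) (le_lt_trans (ler_normD _ _)) //.
  by rewrite -ltrBrDr.
have [h1 h2 h3] : [/\ cdom (ch p) (cinv (ch p) (x t)), Om (cinv (ch p) (x t)) &
    cmap (ch p) (cinv (ch p) (x t)) = x t] by apply: Hs; rewrite subr0.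
split=> //.
have D : is_derive t 1 (cmap (ch p) \o (fun s => cinv (ch p) (x s))) (vec_in ch p Z (x t)).
  apply: near_eq_is_derive (dx t tr); apply: filterS nt => u /Hs[_ _ /= ->] //.
have cd : \forall u \near t, cdom (ch p) (cinv (ch p) (x u)).
  by apply: filterS nt => u /Hs[].
have := chart_has_velocity atl cd D.
rewrite -[X in vec_in _ _ _ X]h3 (vec_inE atl Z h1) -mulmxA.
by rewrite (trans_jacK atl (cdom_self atl _) h1) mulmx1.
Qed.

(** In the chart of the common point the difference of the two curves satisfies a Gronwall
    inequality whose constant is the local Lipschitz constant of the field. *)
Lemma integral_curve_unique_near (c1 c2 : R -> T) t0 :
  (\forall t \near t0, Om (c1 t) /\ has_velocity ch c1 t (Z (c1 t))) ->
  (\forall t \near t0, Om (c2 t) /\ has_velocity ch c2 t (Z (c2 t))) ->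
  c1 t0 = c2 t0 -> \forall t \near t0, c1 t = c2 t.
Proof.
move=> I1 I2 c12; pose p := c1 t0; have pp := cdom_self atl p.
have Op : Om p := (nbhs_singleton I1).1.
have [e e0 [L L0 lipf]] := lipZ Op.
have near_ok c : (\forall t \near t0, Om (c t) /\ has_velocity ch c t (Z (c t))) ->
    c t0 = p -> \forall t \near t0, [/\ has_velocity ch c t (Z (c t)), cdom (ch p) (c t) &
       `|cmap (ch p) (c t) - cmap (ch p) p| < e].
  move=> Ic cp.
  have cc : {for t0, continuous c} := has_velocity_continuous atl (nbhs_singleton Ic).2.
  have cm : {for t0, continuous (cmap (ch p) \o c)}.
    by apply: continuous_comp => //; rewrite cp; exact: (cmap_continuous atl).
  have N1 : \forall t \near t0, cdom (ch p) (c t).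
    by apply: curve_near cc (cdom_open atl p) _; rewrite cp.
  have N2 : \forall t \near t0, `|cmap (ch p) (c t) - cmap (ch p) p| < e.
    have /cvgrPdist_lt/(_ _ e0) := cm; apply: filterS => t.
    by rewrite /= cp distrC.
  near=> t; split; [|exact: (near N1 t)|exact: (near N2 t)].
  exact: (near Ic t _).2.
have [d d0 Hd] := (near_normP _ _).1 (filterI (near_ok _ I1 erefl) (near_ok _ I2 (esym c12))).
pose D := fun t => cmap (ch p) (c1 t) - cmap (ch p) (c2 t).
have dD t : `|t - t0| < d -> exists2 v, is_derive t 1 D v & `|v| <= L * `|D t|.
  move=> /Hd[[v1 d1 n1] [v2 d2 n2]].
  have D1 := integral_chart d1 v1; have D2 := integral_chart d2 v2.
  exists (vec_in ch p Z (cmap (ch p) (c1 t)) - vec_in ch p Z (cmap (ch p) (c2 t))).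
    exact: is_deriveB D1 D2.
  exact: lipf.
have bD t : `|t - t0| < d -> `|D t| <= e + e.
  move=> /Hd[[_ _ n1] [_ _ n2]].
  have -> : D t = (cmap (ch p) (c1 t) - cmap (ch p) p) - (cmap (ch p) (c2 t) - cmap (ch p) p).
    by rewrite opprB addrA subrK.
  by rewrite (le_trans (ler_normB _ _)) // lerD // ltW.
apply/near_normP; exists (d / 2); first by rewrite divr_gt0.
have d2 : d / 2 < d by rewrite ltr_pdivrMr // ltr_pMr // ltr1n.
pose a := t0 - d / 2; pose b := t0 + d / 2.
have inab t : a <= t <= b -> `|t - t0| < d.
  by rewrite -ler_distl => /le_lt_trans; apply.
have C0 : 0 <= L * (e + e) by rewrite mulr_ge0 // addr_ge0 // ltW.
have lipD s t : a <= s <= b -> a <= t <= b -> `|D s - D t| <= L * (e + e) * `|s - t|.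
  have H : forall t, a <= t <= b -> exists2 v, is_derive t 1 D v & `|v| <= L * (e + e).
    move=> u /inab ud; have [v Dv vb] := dD u ud; exists v => //.
    by rewrite (le_trans vb) // ler_wpM2l // bD.
  move=> /andP[as_ sb] /andP[at_ tb].
  have [st|/ltW st] := leP s t.
    rewrite distrC [`|s - t|]distrC (ger0_norm (_ : 0 <= t - s)) ?subr_ge0 //.
    exact: derive_lipschitz C0 H _ _ as_ st tb.
  rewrite (ger0_norm (_ : 0 <= s - t)) ?subr_ge0 //.
  exact: derive_lipschitz C0 H _ _ at_ st sb.
have t0ab : a <= t0 <= b by rewrite -ler_distl subrr normr0 divr_ge0 // ltW.
move=> t td.
have := @lipschitz_gronwall _ _ D a b _ L t0 set0 C0 L0 (negligible_set0 _) lipD _ t0ab.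
have Dt0 : D t0 = 0 by rewrite /D c12 subrr.
have tab : a <= t <= b by rewrite -ler_distl ltW.
move=> /(_ _ Dt0 t tab) Dt.
have {}Dt : D t = 0.
  apply: Dt => u /andP[au ub] _; apply: dD; apply: inab.
  by rewrite !ltW.
have [[_ h1 _] [_ h2 _]] := Hd t (inab t tab).
rewrite -(cmapK atl h1) -(cmapK atl h2).
by move/eqP: Dt; rewrite subr_eq0 => /eqP ->.
Unshelve. all: by end_near. Qed.

Hypothesis hT : hausdorff_space T.

(** Agreement is an open condition by local uniqueness, and disagreement is open because the space
    is Hausdorff; [interval_constant] concludes. *)
Lemma integral_curve_unique (J : set R) (c1 c2 : R -> T) t0 : open J -> is_interval J ->
  integral_curve J c1 -> integral_curve J c2 -> J t0 -> c1 t0 = c2 t0 ->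
  forall t, J t -> c1 t = c2 t.
Proof.
move=> oJ iJ I1 I2 Jt0 c12.
have near_int c t : integral_curve J c -> J t ->
    \forall s \near t, Om (c s) /\ has_velocity ch c s (Z (c s)).
  move=> Ic Jt; have : \forall s \near t, J s by exact: open_nbhs_nbhs.
  by apply: filterS => s /Ic.
apply: (interval_constant iJ Jt0) => // t Jt.
have [ct|ct] := pselect (c1 t = c2 t).
  have /near_normP[e e0 He] := integral_curve_unique_near (near_int _ _ I1 Jt) (near_int _ _ I2 Jt) ct.
  by exists e => // s s' _ _ _ s't _; exact: He.
have cc1 := has_velocity_continuous atl (I1 t Jt).2.
have cc2 := has_velocity_continuous atl (I2 t Jt).2.
have : c1 t != c2 t by exact/eqP.
move: hT; rewrite open_hausdorff => sep /sep[[A B] /= [/set_mem At /set_mem Bt] [oA oB /eqP AB]].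
have [e e0 He] := (near_normP _ _).1 (filterI (curve_near cc1 oA At) (curve_near cc2 oB Bt)).
exists e => // s s' _ _ st _ E; have [As Bs] := He s st.
by have : (A `&` B) (c1 s); [split => //; rewrite E|rewrite AB].
Qed.


Lemma shift_interval (J : set R) (k : R) : is_interval J -> is_interval [set t | J (t + k)].
Proof.
by move=> iJ x y Jx Jy z /andP[xz zy]; apply: (iJ _ _ Jx Jy); rewrite !lerD2r xz.
Qed.

Lemma shift_open (J : set R) (k : R) : open J -> open [set t | J (t + k)].
Proof.
move=> oJ; apply: (@open_comp _ _ (fun t : R => t + k)) => // t _.
by apply: continuousD; [exact: cvg_id|exact: cst_continuous].
Qed.

Lemma setU_interval (I J : set R) (t : R) : is_interval I -> is_interval J -> I t -> J t ->
  is_interval (I `|` J).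
Proof.
move=> iI iJ It Jt x y Ix Jy z /andP[xz zy].
case: Ix => Ix; case: Jy => Jy.
- by left; apply: (iI _ _ Ix Jy); rewrite xz.
- have [zt|/ltW tz] := leP z t; first by left; apply: (iI _ _ Ix It); rewrite xz.
  by right; apply: (iJ _ _ Jt Jy); rewrite tz.
- have [zt|/ltW tz] := leP z t; first by right; apply: (iJ _ _ Ix Jt); rewrite xz.
  by left; apply: (iI _ _ It Jy); rewrite tz.
- by right; apply: (iJ _ _ Ix Jy); rewrite xz.
Qed.

Lemma setI_interval (I J : set R) : is_interval I -> is_interval J -> is_interval (I `&` J).
Proof. by move=> iI iJ x y [Ix Jx] [Iy Jy] z h; split; [exact: (iI _ _ Ix Iy)|exact: (iJ _ _ Jx Jy)]. Qed.

(** Maximality in the form that path lifting uses: any integral curve that meets [c], at whatever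
    times, is a piece of [c] after a shift of time. The shift is harmless because the equation is
    autonomous. *)
Definition maximal_curve (J : set R) (c : R -> T) :=
  forall (I : set R) (d : R -> T) (s s' : R), open I -> is_interval I -> I s' -> J s ->
    integral_curve I d -> d s' = c s ->
    forall u, I u -> J (u - s' + s) /\ c (u - s' + s) = d u.

(** The union of all integral curves on open intervals that pass through [p] at time 0; they agree
    on overlaps by uniqueness. *)
Lemma maximal_curve_exists p : Om p -> exists (J : set R) (c : R -> T),
  [/\ open J, is_interval J, J 0 & c 0 = p] /\ integral_curve J c /\ maximal_curve J c.
Proof.
move=> Op.
pose good (I : set R) (d : R -> T) :=
  [/\ open I, is_interval I, I 0, d 0 = p & integral_curve I d].
have agree I d I' d' t : good I d -> good I' d' -> I t -> I' t -> d t = d' t.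
  move=> [oI iI I0 d0 cI] [oI' iI' I0' d0' cI'] It It'.
  apply: (@integral_curve_unique (I `&` I') d d' 0) => //.
  - exact: openI.
  - exact: setI_interval.
  - by move=> s [/cI].
  - by move=> s [_ /cI'].
  - by rewrite d0 d0'.
pose J := [set t | exists I d, good I d /\ I t].
(* A curve is chosen for each time separately; agreement makes the diagonal [D t t] coincide with
   every admissible curve defined at [t]. *)
have /choice[D HD] (t : R) : exists d, J t -> exists I, good I d /\ I t.
  have [[I [d gI]]|nJ] := pselect (J t); last by exists (fun=> p).
  by exists d => _; exists I.
pose c t := D t t.
have cE I d t : good I d -> I t -> c t = d t.
  move=> gI It; have [|I' [gI' It']] := HD t; first by exists I, d.
  exact: agree gI' gI It' It.
have oJ : open J.
  rewrite openE => t [I [d [gI It]]].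
  have [oI _ _ _ _] := gI; have : \forall s \near t, I s by exact: open_nbhs_nbhs.
  by apply: filterS => s Is; exists I, d.
have J0 : J 0.
  have [r r0 [d d0 cd]] := integral_curve_exists Op.
  exists [set t | `|t| < r], d; split; last by rewrite /= normr0.
  split => //; last by rewrite /= normr0.
    have -> : [set t : R | `|t| < r] = ball (0 : R) r.
      by apply/seteqP; split=> t; rewrite /ball /= sub0r normrN.
    exact: ball_open.
  move=> x y /=; rewrite !ltr_norml => /andP[rx _] /andP[_ yr] z /andP[xz zy].
  by rewrite ltr_norml (lt_le_trans rx xz) (le_lt_trans zy yr).
have c0 : c 0 = p.
  have [I [d [gI I0]]] := J0; rewrite (cE _ _ _ gI I0).
  by have [] := gI.
have iJ : is_interval J.
  move=> x y [I [d [gI Ix]]] [I' [d' [gI' Iy]]] z /andP[xz zy].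
  have [oI iI I0 _ _] := gI; have [oI' iI' I0' _ _] := gI'.
  have [z0|/ltW z0] := leP z 0.
    by exists I, d; split => //; apply: (iI _ _ Ix I0); rewrite xz.
  by exists I', d'; split => //; apply: (iI' _ _ I0' Iy); rewrite z0.
have cJ : integral_curve J c.
  move=> t [I [d [gI It]]]; have [oI _ _ _ cI] := gI.
  have [Od vd] := cI t It; rewrite (cE _ _ _ gI It); split=> //.
  apply: has_velocity_near vd.
  have : \forall s \near t, I s by exact: open_nbhs_nbhs.
  by apply: filterS => s Is; rewrite (cE _ _ _ gI Is).
exists J, c; split=> //; split=> // I d s s' oI iI Is' Js cI dc u Iu.
pose I1 := [set t | I (t + (s' - s))]; pose d1 t := d (t + (s' - s)).
have oI1 : open I1 by exact: shift_open.
have iI1 : is_interval I1 by exact: shift_interval.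
have I1s : I1 s by rewrite /I1 /= addrC subrK.
have cI1 : integral_curve I1 d1.
  move=> t It; have [h1 h2] := cI _ It; split=> //.
  exact: has_velocity_shift.
have eqI1 t : J t -> I1 t -> c t = d1 t.
  move=> Jt It; apply: (@integral_curve_unique (J `&` I1) c d1 s) => //.
  - exact: openI.
  - exact: setI_interval.
  - by move=> x [/cJ].
  - by move=> x [_ /cI1].
  - by rewrite /d1 addrC subrK.
(* The shifted curve glued to [c] is again an integral curve through [p] at time 0, so its domain
   already lies in [J]. *)
pose d2 t := if pselect (J t) then c t else d1 t.
have d2J t : J t -> d2 t = c t by rewrite /d2; case: pselect.
have d2I t : I1 t -> d2 t = d1 t.
  by rewrite /d2; case: pselect => // Jt It; exact: eqI1.
have g2 : good (J `|` I1) d2.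
  split.
  - exact: openU.
  - exact: setU_interval iJ iI1 Js I1s.
  - by left.
  - by rewrite d2J.
  - move=> t [Jt|It].
      have [h1 h2] := cJ t Jt; rewrite d2J //; split=> //.
      apply: has_velocity_near h2.
      have : \forall x \near t, J x by exact: open_nbhs_nbhs.
      by apply: filterS => x Jx; rewrite d2J.
    have [h1 h2] := cI1 t It; rewrite d2I //; split=> //.
    apply: has_velocity_near h2.
    have : \forall x \near t, I1 x by exact: open_nbhs_nbhs.
    by apply: filterS => x Jx; rewrite d2I.
have K : u - s' + s + (s' - s) = u by ring.
have I1u : I1 (u - s' + s) by rewrite /I1 /= K.
have Ju : J (u - s' + s) by exists (J `|` I1), d2; split => //; right.
split=> //; rewrite (eqI1 _ Ju I1u) /d1.
by rewrite K.
Qed.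

End IntegralCurves.

(** * Lifting a path to the parameter line of a curve *)

Section PathLifting.
Context {R : realType} {T : Type}.

(** Gluing as phi1(min) + phi2(max) minus the common value is a sum of continuous functions, so no
    continuity at the junction has to be argued by cases. *)
Lemma continuous_glue (phi1 phi2 f g : R -> R) (k : R) : continuous phi1 -> continuous phi2 ->
  (forall x y, `|f x - f y| <= `|x - y|) -> (forall x y, `|g x - g y| <= `|x - y|) ->
  continuous (fun u => phi1 (f u) + phi2 (g u) - k).
Proof.
move=> c1 c2 lf lg u.
have cont (h : R -> R) : (forall x y, `|h x - h y| <= `|x - y|) -> {for u, continuous h}.
  move=> lh; apply: locally_lipschitz_continuous; exists 1 => //; exists 1 => // y z _ _.
  by rewrite mul1r.
have k1 : {for u, continuous (phi1 \o f)} by apply: continuous_comp; [exact: cont|exact: c1].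
have k2 : {for u, continuous (phi2 \o g)} by apply: continuous_comp; [exact: cont|exact: c2].
have k3 : {for u, continuous (fun=> k : R)} by exact: cst_continuous.
exact: (continuousB (continuousD k1 k2) k3).
Qed.

(** The curve [c] may be periodic, so a lift is not determined by [eta]. The local hypothesis
    therefore starts from any prescribed parameter [s1] over any nearby time, which lets real
    induction prolong a given lift. *)
Lemma path_lifting_right (J : set R) (c eta : R -> T) (b t0 s0 : R) : t0 <= b ->
  J s0 -> eta t0 = c s0 ->
  (forall t, t0 <= t <= b -> exists2 e : R, 0 < e & forall t1 s1, t0 <= t1 <= b ->
     `|t1 - t| < e -> J s1 -> eta t1 = c s1 ->
     exists phi : R -> R, [/\ continuous phi, phi t1 = s1 &
       forall u, t0 <= u <= b -> `|u - t| < e -> J (phi u) /\ eta u = c (phi u)]) ->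
  exists phi : R -> R, [/\ continuous phi, phi t0 = s0 &
    forall u, t0 <= u <= b -> J (phi u) /\ eta u = c (phi u)].
Proof.
move=> t0b Js0 eta0 step.
pose Q t := exists phi : R -> R, [/\ continuous phi, phi t0 = s0 &
    forall u, t0 <= u <= t -> J (phi u) /\ eta u = c (phi u)].
have glue t1 t2 (phi1 phi2 : R -> R) : t0 <= t1 -> continuous phi1 -> phi1 t0 = s0 ->
    (forall u, t0 <= u <= t1 -> J (phi1 u) /\ eta u = c (phi1 u)) ->
    continuous phi2 -> phi2 t1 = phi1 t1 ->
    (forall u, t1 <= u <= t2 -> J (phi2 u) /\ eta u = c (phi2 u)) -> Q t2.
  move=> t01 c1 p10 H1 c2 p21 H2.
  exists (fun u => phi1 (Num.min t1 u) + phi2 (Num.max t1 u) - phi2 t1).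
  have lo u : u <= t1 -> phi1 (Num.min t1 u) + phi2 (Num.max t1 u) - phi2 t1 = phi1 u.
    by move=> ut; rewrite (min_idPr ut) (max_idPl ut) addrK.
  split; last 1 first.
  - move=> u /andP[t0u ut2] /=; have [ut1|/ltW t1u] := leP u t1.
      by rewrite addrK; apply: H1; rewrite t0u.
    rewrite -p21 addrC addKr.
    by apply: H2; rewrite t1u.
  - by apply: continuous_glue => // x y; [exact: min_lipschitz|exact: max_lipschitz].
  - by rewrite /= lo.
suff : Q b by [].
apply: (@real_induction _ t0 b Q); last by rewrite t0b lexx.
  move=> t /andP[t0t tb] below.
  have [->|tt0] := eqVneq t t0.
    exists (fun=> s0); split=> // [u|u]; first exact: cst_continuous.
    by rewrite -eq_le => /eqP <-.
  have {tt0}t0t' : t0 < t by rewrite lt_neqAle eq_sym tt0.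
  have [e e0 He] := step t (introT andP (conj t0t tb)).
  pose t1 := Num.max t0 (t - e / 2).
  have t1t : t1 < t by rewrite gt_max t0t' gtrBl divr_gt0.
  have t01 : t0 <= t1 by rewrite le_max lexx.
  have te1 : t - e / 2 <= t1 by rewrite le_max lexx orbT.
  have close u : t1 <= u <= t -> `|u - t| < e.
    move=> /andP[h1 h2]; rewrite ltr_norml; lra.
  have [|phi1 [c1 p10 H1]] := below t1; first by rewrite t01.
  have [Js1 eta1] := H1 t1 (introT andP (conj t01 (lexx _))).
  have [||phi2 [c2 p21 H2]] := He t1 (phi1 t1) _ _ Js1 eta1.
  - by rewrite t01 (le_trans (ltW t1t)).
  - by apply: close; rewrite lexx ltW.
  apply: (glue _ _ _ _ t01 c1 p10 H1 c2 p21) => u uin; apply: H2; last exact: close.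
  by case/andP: uin => h1 h2; rewrite (le_trans t01 h1) (le_trans h2).
move=> t /andP[t0t tb] upto.
have tin : t0 <= t <= b by rewrite t0t ltW.
have [e e0 He] := step t tin.
exists e => // t2 /andP[tt2 t2e] t2b.
have [|phi1 [c1 p10 H1]] := upto t; first by rewrite t0t lexx.
have [Js1 eta1] := H1 t (introT andP (conj t0t (lexx _))).
have [|phi2 [c2 p21 H2]] := He t (phi1 t) tin _ Js1 eta1.
  by rewrite subrr normr0.
apply: (glue _ _ _ _ t0t c1 p10 H1 c2 p21) => u /andP[h1 h2]; apply: H2.
  by rewrite (le_trans t0t h1) (le_trans h2).
by rewrite ger0_norm ?subr_ge0 // ltrBlDl (le_lt_trans h2).
Qed.

Lemma path_lifting (J : set R) (c eta : R -> T) (a b t0 s0 : R) : a <= t0 <= b ->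
  J s0 -> eta t0 = c s0 ->
  (forall t, a <= t <= b -> exists2 e : R, 0 < e & forall t1 s1, a <= t1 <= b ->
     `|t1 - t| < e -> J s1 -> eta t1 = c s1 ->
     exists phi : R -> R, [/\ continuous phi, phi t1 = s1 &
       forall u, a <= u <= b -> `|u - t| < e -> J (phi u) /\ eta u = c (phi u)]) ->
  exists phi : R -> R, [/\ continuous phi, phi t0 = s0 &
    forall u, a <= u <= b -> J (phi u) /\ eta u = c (phi u)].
Proof.
move=> /andP[at0 t0b] Js0 eta0 step.
have [|phi1 [c1 p1 H1]] := @path_lifting_right J c eta b t0 s0 t0b Js0 eta0.
  move=> t /andP[t0t tb].
  have [e e0 He] := step t (introT andP (conj (le_trans at0 t0t) tb)).
  exists e => // t1 s1 /andP[h1 h2] t1e Js1 eta1.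
  have [|phi [cphi p H]] := He t1 s1 _ t1e Js1 eta1; first by rewrite (le_trans at0).
  by exists phi; split=> // u /andP[u1 u2] ue; apply: H => //; rewrite (le_trans at0).
have [|||phi2 [c2 p2 H2]] := @path_lifting_right J c (fun t => eta (- t)) (- a) (- t0) s0 _ Js0 _ _.
- by rewrite lerN2.
- by rewrite opprK.
- move=> t /andP[t0t ta].
  have tab : a <= - t <= b by rewrite lerNr ta lerNl (le_trans _ t0t) // lerN2.
  have [e e0 He] := step (- t) tab.
  exists e => // t1 s1 /andP[h1 h2] t1e Js1 eta1.
  have [||phi [cphi p H]] := He (- t1) s1 _ _ Js1 eta1.
  + by rewrite lerNr h2 lerNl (le_trans _ h1) // lerN2.
  + by rewrite -opprD normrN.
  exists (fun u => phi (- u)); split=> // [u|u /andP[u1 u2] ue].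
    by apply: continuous_comp; [exact: continuousN|exact: cphi].
  apply: H; first by rewrite lerNr u2 lerNl (le_trans _ u1) // lerN2.
  by rewrite -opprD normrN.
exists (fun t => phi1 (Num.max t0 t) + phi2 (- (Num.min t0 t)) - s0).
split.
- apply: (@continuous_glue phi1 phi2 _ (fun t => - Num.min t0 t)) => // x y.
    exact: max_lipschitz.
  by rewrite -opprD normrN; exact: min_lipschitz.
- by rewrite maxxx minxx p1 p2 addrK.
move=> u /andP[au ub]; have [t0u|/ltW ut0] := leP t0 u.
  rewrite p2 addrK.
  by apply: H1; rewrite t0u.
rewrite p1 addrC addKr.
have := H2 (- u); rewrite opprK; apply.
by rewrite !lerN2 ut0.
Qed.

End PathLifting.

(** * Curves tangent to a vector field run along its integral curves *)

Section Reparametrization.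
Context {R : realType}.
Notation mu := (@lebesgue_measure R).

Lemma derive_le_lipschitz (V : normedModType R) (D : R -> V) (t L e : R) d :
  is_derive t 1 D d -> 0 < e ->
  (forall s, `|s - t| < e -> `|D s - D t| <= L * `|s - t|) -> `|d| <= L.
Proof.
move=> [dD <-] e0 H; apply/ler_addgt0Pr => k k0.
have /cvgrPdist_le/(_ _ k0) : h^-1 *: (D (h *: 1 + t) - D t) @[h --> 0^'] --> 'D_1 D t.
  exact: dD.
move=> /nbhs_ballP[r r0 Hr].
pose h := Num.min e r / 2.
have m0 : 0 < Num.min e r by rewrite lt_min e0.
have h0 : 0 < h by rewrite divr_gt0.
have hm : h < Num.min e r by rewrite ltr_pdivrMr // ltr_pMr // ltr1n.
move: (hm); rewrite lt_min => /andP[he hr].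
have := Hr h; rewrite /ball /= sub0r normrN gtr0_norm // => /(_ hr (lt0r_neq0 h0)).
rewrite /GRing.scale /= mulr1 => Hd.
set q := h^-1 *: (D (h + t) - D t) in Hd.
have qL : `|q| <= L.
  rewrite /q normrZ normfV gtr0_norm // ler_pdivrMl // mulrC.
  by have := H (h + t); rewrite addrK gtr0_norm //; exact.
by rewrite -(subrK q ('D_1 D t)) (le_trans (ler_normD _ _)) // addrC lerD.
Qed.

Lemma half_le (u v w : R) : w < u / 2 -> u <= w + v -> u / 2 <= v.
Proof. lra. Qed.

Lemma norm_inv_le (c v : R) : 0 < c -> c <= `|v| -> `|v^-1| <= c^-1.
Proof. by move=> c0 cv; rewrite normfV lef_pV2 // posrE (lt_le_trans c0). Qed.

Lemma subrBB (V : zmodType) (a b c d : V) : a - b - (c - d) = a - c - (b - d).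
Proof. by rewrite !opprB addrACA [RHS]addrACA [- b + _]addrC. Qed.

Lemma is_derive_comp1 (V : normedModType R) (f : R -> V) (g : R -> R) t df (dg : R) :
  is_derive (g t) 1 f df -> is_derive t 1 g dg -> is_derive t 1 (f \o g) (dg *: df).
Proof.
move=> [f1 f2] Dg.
have df' : differentiable f (g t) by exact/derivable1_diffP.
have := is_derive_comp df' Dg.
suff -> : 'D_dg f (g t) = dg *: df by [].
by rewrite -f2 !deriveE // -linearZ [_ *: _]mulr1.
Qed.

Lemma derive_lipschitz_sym (V : normedModType R) (D : R -> V) (a b C : R) : 0 <= C ->
  (forall t, a <= t <= b -> exists2 d, is_derive t 1 D d & `|d| <= C) ->
  forall s t, a <= s <= b -> a <= t <= b -> `|D s - D t| <= C * `|s - t|.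
Proof.
move=> C0 H s t /andP[as_ sb] /andP[at_ tb].
have [st|/ltW st] := leP s t.
  rewrite distrC [`|s - t|]distrC (ger0_norm (_ : 0 <= t - s)) ?subr_ge0 //.
  exact: derive_lipschitz C0 H _ _ as_ st tb.
rewrite (ger0_norm (_ : 0 <= s - t)) ?subr_ge0 //.
exact: derive_lipschitz C0 H _ _ at_ st sb.
Qed.

(** The bound [B] on [D] bounds the derivative by [K * B], which supplies the Lipschitz constant
    that [lipschitz_gronwall] asks for. *)
Lemma derive_gronwall (V : normedModType R) (D : R -> V) (a b K B t0 : R) : 0 <= K -> 0 <= B ->
  (forall t, a <= t <= b -> exists2 d, is_derive t 1 D d & `|d| <= K * `|D t|) ->
  (forall t, a <= t <= b -> `|D t| <= B) -> a <= t0 <= b -> D t0 = 0 ->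
  forall t, a <= t <= b -> D t = 0.
Proof.
move=> K0 B0 H HB t0ab Dt0.
have KB : 0 <= K * B by rewrite mulr_ge0.
have lipD := @derive_lipschitz_sym _ D a b (K * B) KB.
apply: (@lipschitz_gronwall _ _ D a b (K * B) K t0 set0) => //.
- exact: negligible_set0.
- apply: lipD => t tab; have [d Dd dK] := H t tab; exists d => //.
  by rewrite (le_trans dK) // ler_wpM2l // HB.
- by move=> t /andP[at_ tb] _; apply: H; rewrite !ltW.
Qed.

Lemma locally_lipschitz_ball (V W : normedModType R) (f : V -> W) x e L : 0 <= L ->
  (forall y z, `|y - x| < e -> `|z - x| < e -> `|f y - f z| <= L * `|y - z|) ->
  forall y, `|y - x| < e -> locally_lipschitz f y.
Proof.
move=> L0 H y ye; exists (e - `|y - x|); first by rewrite subr_gt0.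
have tri z : `|z - y| < e - `|y - x| -> `|z - x| < e.
  by move=> zy; rewrite -(subrKA y) (le_lt_trans (ler_normD _ _)) // -ltrBrDr.
by exists L => // z z' /tri hz /tri hz'; exact: H.
Qed.

Context {n : nat} {T : topologicalType}.
Variable ch : charted R n T.
Hypothesis atl : atlas ch.
Variables (Om : set T) (Z : T -> 'rV[R]_n).
Hypothesis lipZ : forall p, Om p -> locally_lipschitz (vec_in ch p Z) (cmap (ch p) p).

(* Normalising one coordinate of the field to have derivative 1 turns that coordinate into
   a time: in terms of it, both the integral curve and any curve tangent to the field solve
   the same equation y' = W y, and Gronwall identifies them. *)
Lemma tangent_curve_reparametrization p (r : R) (delta eta : R -> T) (a b t0 e0 L : R) (N : set R) :
  Om p -> Z p != 0 -> 0 < r -> delta 0 = p ->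
  integral_curve ch Om Z [set s | `|s| < r] delta ->
  a <= t0 <= b -> eta t0 = p -> 0 < e0 -> 0 <= L ->
  (forall s, a <= s <= b -> `|s - t0| < e0 -> cdom (ch p) (eta s)) ->
  (forall s s', a <= s <= b -> a <= s' <= b -> `|s - t0| < e0 -> `|s' - t0| < e0 ->
     `|cmap (ch p) (eta s) - cmap (ch p) (eta s')| <= L * `|s - s'|) ->
  mu.-negligible N ->
  (forall t, a < t < b -> ~ N t -> exists f : R, has_velocity ch eta t (f *: Z (eta t))) ->
  exists2 e : R, 0 < e & exists psi : R -> R, [/\ continuous psi, forall t, `|psi t| < r &
    forall t, a <= t <= b -> `|t - t0| < e -> eta t = delta (psi t)].
Proof.
move=> Op Zp r0 d0 cdelta t0ab etat0 e00 L0 hdom hlip nN hvel.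
pose F := vec_in ch p Z; pose x0 := cmap (ch p) p.
have F0 : F x0 = Z p by exact: vec_in_self.
have [j Zj] : exists j, Z p 0 j != 0.
  apply: contrapT => nj; move/eqP: Zp; apply; apply/rowP => j; rewrite [RHS]mxE.
  by apply/eqP/negPn/negP => h; apply: nj; exists j.
pose g y := F y 0 j.
have gx0 : g x0 != 0 by rewrite /g F0.
have lipF : locally_lipschitz F x0 := lipZ Op.
have lipg : locally_lipschitz g x0 := locally_lipschitz_entry 0 j lipF.
(* Near [x0] the coordinate of index [j] of [W] is 1, so along solutions of y' = W y that coordinate
   is time up to a constant. *)
pose W y := (g y)^-1 *: F y.
have lipW : locally_lipschitz W x0.
  exact: locally_lipschitzZ (locally_lipschitz_comp lipg (locally_lipschitz_inv gx0)) lipF.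
have WF y k : g y != 0 -> (k * g y) *: W y = k *: F y.
  by move=> gy; rewrite /W scalerA (mulfK gy).
have [e1 e10 [LF LF0 HF]] := lipF.
have [e2 e20 [LW LW0 HW]] := lipW.
have [e3 e30 [BW BW0 HBW]] := locally_lipschitz_bounded lipW.
pose cg := `|g x0| / 2.
have cg0 : 0 < cg by rewrite divr_gt0 ?normr_gt0.
have /near_normP[e4 e40 Hg] : \forall y \near x0, `|g x0 - g y| < cg.
  by have /cvgrPdist_lt/(_ _ cg0) := locally_lipschitz_continuous lipg.
pose em := Num.min (Num.min e1 e2) (Num.min e3 e4).
have em0 : 0 < em by rewrite !lt_min e10 e20 e30.
have emP y : `|y - x0| < em -> [/\ `|y - x0| < e1, `|y - x0| < e2, `|y - x0| < e3 & cg <= `|g y|].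
  rewrite !lt_min => /andP[/andP[h1 h2] /andP[h3 h4]]; split=> //.
  have := ler_normD (g x0 - g y) (g y); rewrite subrK => h5.
  exact: half_le (Hg _ h4) h5.
have gneq y : `|y - x0| < em -> g y != 0.
  by move=> /emP[_ _ _ /(lt_le_trans cg0)]; rewrite normr_gt0.
have [r1 r10 [y yx0 dy]] := picard_local lipW.
have cy (s : R) : `|s| < r1 -> {for s, continuous y}.
  by move=> /dy[dys _]; apply: differentiable_continuous; exact/derivable1_diffP.
have /near_normP[r2' r2'0 Hy'] : \forall s \near 0, `|y s - x0| < em.
  have c0 : {for 0, continuous y} by apply: cy; rewrite normr0.
  have /cvgrPdist_lt/(_ _ em0) := c0; apply: filterS => s.
  by rewrite yx0 distrC.
pose r2 := Num.min r1 r2'.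
have r20 : 0 < r2 by rewrite lt_min r10.
have Hy s : `|s| < r2 -> `|s| < r1 /\ `|y s - x0| < em.
  by rewrite lt_min => /andP[h1 h2]; split=> //; apply: Hy'; rewrite subr0.
have cd0 : {for 0, continuous delta}.
  have [_ v] := cdelta 0 (eq_ind_r (fun x => x < r) r0 (normr0 R)).
  exact: has_velocity_continuous v.
have cx0 : {for 0, continuous (cmap (ch p) \o delta)}.
  by apply: continuous_comp => //; rewrite d0; apply: (cmap_continuous atl); exact: cdom_self.
have Nd1 : \forall s \near 0, cdom (ch p) (delta s).
  by apply: curve_near cd0 (cdom_open atl p) _; rewrite d0; exact: cdom_self.
have Nd2 : \forall s \near 0, `|cmap (ch p) (delta s) - x0| < em.
  have /cvgrPdist_lt/(_ _ em0) := cx0; apply: filterS => s.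
  by rewrite /= d0 distrC.
have [r3' r3'0 Hd'] := (near_normP _ _).1 (filterI Nd1 Nd2).
pose r3 := Num.min r r3'.
have r30 : 0 < r3 by rewrite lt_min r0.
have Hd s : `|s| < r3 -> [/\ `|s| < r, cdom (ch p) (delta s) & `|cmap (ch p) (delta s) - x0| < em].
  rewrite lt_min => /andP[h1 h2].
  by have [|] := Hd' s; rewrite ?subr0.
have dx (s : R) : `|s| < r3 -> is_derive s 1 (cmap (ch p) \o delta) (F (cmap (ch p) (delta s))).
  move=> /Hd[h1 h2 h3]; have [_ v] := cdelta s h1.
  by have := has_velocity_chart atl h2 v; rewrite -(vec_inE atl Z h2).
have r220 : 0 < r2 / 2 by rewrite divr_gt0.
have r22 : r2 / 2 < r2 by rewrite ltr_pdivrMr // ltr_pMr // ltr1n.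
(* The solution [y] is controlled for short times only; clamping makes the integrand below
   continuous on the whole line, as [antiderivative] requires. *)
pose tau := clamp (- (r2 / 2)) (r2 / 2).
have taur s : `|tau s| < r2.
  apply: le_lt_trans r22; rewrite ler_norml; apply: clamp_itv.
  by rewrite (le_trans _ (ltW r220)) // oppr_le0 ltW.
have taui s : `|s| < r2 / 2 -> tau s = s.
  by move=> sr; rewrite /tau clamp_id // -ler_norml ltW.
have ch_ : continuous (fun s => (g (y (tau s)))^-1).
  move=> s; have [h1 h2] := Hy _ (taur s); have [k1 k2 k3 k4] := emP _ h2.
  have c1 : {for s, continuous (y \o tau)}.
    by apply: continuous_comp; [exact: clamp_continuous|exact: cy].
  have c2 : {for (y \o tau) s, continuous g}.
    apply: locally_lipschitz_continuous; apply: locally_lipschitz_entry.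
    exact: locally_lipschitz_ball LF0 HF _ k1.
  have c3 : {for s, continuous (g \o (y \o tau))} by exact: continuous_comp c1 c2.
  apply: (@continuous_comp _ _ _ (g \o (y \o tau)) (fun r : R => r^-1)) => //.
  apply: locally_lipschitz_continuous; apply: locally_lipschitz_inv; exact: gneq.
(* [theta] has the rate 1/g(y), which turns the speed of [delta] into that of [W]: [delta] read
   after [theta] matches [y]. *)
have [theta theta0 dtheta] := antiderivative ch_ r220.
have ctheta (s : R) : `|s| < r2 / 2 -> {for s, continuous theta}.
  by move=> /dtheta[ds _]; apply: differentiable_continuous; exact/derivable1_diffP.
have /near_normP[r4' r4'0 Hth'] : \forall s \near 0, `|theta s| < r3.
  have c0 : {for 0, continuous theta} by apply: ctheta; rewrite normr0.
  have /cvgrPdist_lt/(_ _ r30) := c0; apply: filterS => s.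
  by rewrite theta0 sub0r normrN.
pose r4 := Num.min (r2 / 2) r4'.
have r40 : 0 < r4 by rewrite lt_min r220.
have Hth s : `|s| < r4 -> `|s| < r2 / 2 /\ `|theta s| < r3.
  by rewrite lt_min => /andP[h1 h2]; split=> //; apply: Hth'; rewrite subr0.
have matchy s : `|s| < r4 -> cmap (ch p) (delta (theta s)) = y s.
  move=> sr; pose D u := cmap (ch p) (delta (theta u)) - y u.
  have small u : - `|s| <= u <= `|s| -> `|u| < r4 by rewrite -ler_norml => /le_lt_trans; exact.
  suff : D s = 0 by move/eqP; rewrite subr_eq0 => /eqP.
  have K0 : 0 <= cg^-1 * LF by rewrite mulr_ge0 // invr_ge0 ltW.
  apply: (@derive_gronwall _ D (- `|s|) `|s| (cg^-1 * LF) (em + em) 0) => //.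
  - by rewrite addr_ge0 // ltW.
  - move=> u /small us; have [h1 h2] := Hth u us; have [k1 k2 k3] := Hd _ h2.
    have u2 : `|u| < r2 by exact: lt_trans r22.
    have [l1 l2] := Hy u u2; have [m1 m2 m3 m4] := emP _ l2; have [n1 n2 n3 n4] := emP _ k3.
    have Dth := dtheta u h1; rewrite taui // in Dth.
    exists ((g (y u))^-1 *: F (cmap (ch p) (delta (theta u))) - W (y u)).
      exact: is_deriveB (is_derive_comp1 (dx _ h2) Dth) (dy u l1).
    rewrite /W -scalerBr normrZ -mulrA.
    exact: ler_pM (normr_ge0 _) (normr_ge0 _) (norm_inv_le cg0 m4) (HF _ _ n1 m1).
  - move=> u /small us; have [h1 h2] := Hth u us; have [k1 k2 k3] := Hd _ h2.
    have u2 : `|u| < r2 by exact: lt_trans r22.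
    have [l1 l2] := Hy u u2.
    have -> : D u = (cmap (ch p) (delta (theta u)) - x0) - (y u - x0).
      by rewrite opprB addrA subrK.
    by rewrite (le_trans (ler_normB _ _)) // lerD // ltW.
  - by rewrite oppr_le0 normr_ge0.
  - by rewrite /D theta0 d0 yx0 subrr.
  - by rewrite -ler_norml.
have L1 : 0 < L + 1 by rewrite ltr_wpDl.
(* Within this time the Lipschitz curve stays in the ball of radius [em], and its coordinate of
   index [j] moves by less than r4 / 2. *)
pose e := Num.min e0 (Num.min em (r4 / 2) / (L + 1)).
have e_0 : 0 < e by rewrite lt_min e00 divr_gt0 // lt_min em0 divr_gt0.
pose z t := cmap (ch p) (eta t).
have zt0 : z t0 = x0 by rewrite /z etat0.
pose sg t := z t 0 j - x0 0 j.
have t0t0 : `|t0 - t0| < e0 by rewrite subrr normr0.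
have zP t : a <= t <= b -> `|t - t0| < e -> [/\ `|t - t0| < e0, `|z t - x0| < em & `|sg t| < r4 / 2].
  move=> tab; rewrite lt_min ltr_pdivlMr // lt_min => /andP[h1 /andP[h2 h3]].
  have zL : `|z t - x0| <= `|t - t0| * (L + 1).
    rewrite -zt0 (le_trans (hlip _ _ tab t0ab h1 t0t0)) // mulrC ler_wpM2l // lerDl //.
  have sz : `|sg t| <= `|z t - x0| by have := mx_norm_entry (z t - x0) 0 j; rewrite !mxE.
  split=> //; first exact: le_lt_trans h2.
  exact: le_lt_trans sz (le_lt_trans zL h3).
pose A := Num.max a (t0 - e / 2); pose B := Num.min b (t0 + e / 2).
have e2e : e / 2 < e by rewrite ltr_pdivrMr // ltr_pMr // ltr1n.
have e200 : 0 <= e / 2 by rewrite divr_ge0 // ltW.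
have inAB t : A <= t <= B -> a <= t <= b /\ `|t - t0| < e.
  rewrite ge_max le_min => /andP[/andP[h1 h2] /andP[h3 h4]]; rewrite h1 h3; split=> //.
  by apply: le_lt_trans e2e; rewrite ler_distl h2.
have [at0 t0b] := andP t0ab.
have t0AB : A <= t0 <= B by rewrite ge_max le_min at0 t0b gerBl lerDl e200.
have AB : A <= B by case/andP: t0AB => /le_trans; exact.
have r42 : r4 / 2 < r4 by rewrite ltr_pdivrMr // ltr_pMr // ltr1n.
have r4r2 : r4 <= r2 / 2 by rewrite ge_min lexx.
(* Off the null set the velocity of [z] is (f g(z)) W(z), and [sg] has derivative f g(z). So [z] and
   [y \o sg] obey the same equation with the same scalar factor, and their difference satisfies a
   Gronwall inequality. *)
have matchz t : A <= t <= B -> z t = y (sg t).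
  pose D u := z u - y (sg u).
  move=> tAB; suff : D t = 0 by move/eqP; rewrite subr_eq0 => /eqP.
  have lipy u v : `|u| < r4 / 2 -> `|v| < r4 / 2 -> `|y u - y v| <= BW * `|u - v|.
    rewrite !ltr_norml => /andP[h1 h2] /andP[h3 h4].
    apply: (@derive_lipschitz_sym _ y (- (r4 / 2)) (r4 / 2)) => //; last 2 first.
    - by rewrite !ltW.
    - by rewrite !ltW.
    move=> w; rewrite -ler_norml => wr.
    have w2 : `|w| < r2 by rewrite (le_lt_trans wr) // (lt_trans r42) // (le_lt_trans r4r2).
    have [k1 k2] := Hy w w2; exists (W (y w)); first exact: dy.
    by apply: HBW; have [] := emP _ k2.
  have lipsg u v : a <= u <= b -> a <= v <= b -> `|u - t0| < e0 -> `|v - t0| < e0 ->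
      `|sg u - sg v| <= L * `|u - v|.
    move=> h1 h2 h3 h4; apply: le_trans (hlip _ _ h1 h2 h3 h4).
    have := mx_norm_entry (z u - z v) 0 j; rewrite !mxE.
    by rewrite /sg opprB addrA subrK.
  have L10 : 0 <= L + BW * L by rewrite addr_ge0 // mulr_ge0.
  have K0 : 0 <= L * LW by rewrite mulr_ge0.
  apply: (@lipschitz_gronwall _ _ D A B _ (L * LW) t0 N L10 K0 nN) => //.
  - move=> u v /inAB[uab ue] /inAB[vab ve].
    have [h1 h2 h3] := zP u uab ue; have [h1' h2' h3'] := zP v vab ve.
    have -> : D u - D v = (z u - z v) - (y (sg u) - y (sg v)).
      exact: subrBB.
    rewrite (le_trans (ler_normB _ _)) // mulrDl lerD //; first exact: hlip.
    rewrite (le_trans (lipy _ _ h3 h3')) // -mulrA ler_wpM2l //.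
    exact: lipsg.
  - move=> u /andP[Au uB] nNu.
    have [uab ue] := inAB u (introT andP (conj (ltW Au) (ltW uB))).
    have [h1 h2 h3] := zP u uab ue.
    have au : a < u by apply: le_lt_trans Au; rewrite le_max lexx.
    have ub : u < b by apply: lt_le_trans uB _; rewrite ge_min lexx.
    have [|f vf] := hvel u _ nNu; first by rewrite au.
    have pu := hdom u uab h1.
    have Dz := has_velocity_chart atl pu vf.
    rewrite -scalemxAl -(vec_inE atl Z pu) in Dz.
    have Dzj := (is_derive_mxP _ _ _ _).1 Dz 0 j.
    (* The factor [f] is otherwise uncontrolled; a derivative of an [L]-Lipschitz map is bounded by
       [L], which bounds f g(z) as well. *)
    have dzL : `|f *: F (z u)| <= L.
      pose k := Num.min (e0 - `|u - t0|) (Num.min (u - a) (b - u)).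
      have k0 : 0 < k by rewrite !lt_min !subr_gt0 h1 au.
      apply: (derive_le_lipschitz Dz k0) => s.
      rewrite !lt_min => /andP[s1 /andP[s2 s3]].
      apply: hlip => //; last first.
        by rewrite -(subrKA u) (le_lt_trans (ler_normD _ _)) // -ltrBrDr.
      move: s2 s3; rewrite !ltr_norml opprB !ltrD2r => /andP[/ltW as_ _] /andP[_ /ltW sb].
      by rewrite as_.
    have fgL : `|f * g (z u)| <= L.
      by apply: le_trans dzL; have := mx_norm_entry (f *: F (z u)) 0 j; rewrite mxE.
    have Dsg : is_derive u 1 sg (f * g (z u)).
      have := is_deriveB Dzj (is_derive_cst (x0 0 j) u 1); rewrite subr0.
      by rewrite mxE.
    have sr2 : `|sg u| < r2 by rewrite (lt_trans h3) // (lt_trans r42) // (le_lt_trans r4r2).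
    have [k1 k2] := Hy _ sr2.
    exists ((f * g (z u)) *: (W (z u) - W (y (sg u)))).
      apply: is_derive_eq (is_deriveB Dz (is_derive_comp1 (dy _ k1) Dsg)) _.
      apply: esym; apply: etrans (scalerBr _ _ _) _.
      exact: (congr1 (fun q => q - (f * g (z u)) *: W (y (sg u))) (WF _ f (gneq _ h2))).
    have [_ z2 _ _] := emP _ h2; have [_ y2 _ _] := emP _ k2.
    rewrite normrZ -mulrA.
    exact: ler_pM (normr_ge0 _) (normr_ge0 _) fgL (HW _ _ z2 y2).
  - by rewrite /D zt0 /sg zt0 subrr yx0 subrr.
have czc : continuous (fun t => z (clamp A B t) 0 j - x0 0 j).
  move=> t; apply: locally_lipschitz_continuous; exists 1 => //; exists L => // u v _ _.
  have [uab ue] := inAB _ (clamp_itv u AB); have [vab ve] := inAB _ (clamp_itv v AB).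
  have [h1 _ _] := zP _ uab ue; have [h1' _ _] := zP _ vab ve.
  rewrite opprB addrA subrK.
  have := mx_norm_entry (z (clamp A B u) - z (clamp A B v)) 0 j; rewrite !mxE.
  move=> /le_trans; apply; apply: le_trans (hlip _ _ uab vab h1 h1') _.
  by rewrite ler_wpM2l // clamp_lipschitz.
(* On the relevant times both clamps are identities and this is [theta (sg t)]. They make [psi]
   continuous, with values of modulus less than [r], on the whole line. *)
pose psi t := theta (clamp (- (r4 / 2)) (r4 / 2) (z (clamp A B t) 0 j - x0 0 j)).
have r420 : 0 <= r4 / 2 by rewrite divr_ge0 // ltW.
have cl4 s : `|clamp (- (r4 / 2)) (r4 / 2) s| < r4.
  apply: le_lt_trans r42; rewrite ler_norml; apply: clamp_itv.
  by rewrite (le_trans _ r420) // oppr_le0.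
exists (e / 2); first by rewrite divr_gt0.
exists psi; split.
- move=> t; pose w := fun t => z (clamp A B t) 0 j - x0 0 j.
  have k1 : {for t, continuous w} := czc t.
  have k2 : {for t, continuous (clamp (- (r4 / 2)) (r4 / 2) \o w)}.
    exact: (continuous_comp k1 (@clamp_continuous R _ _ (w t))).
  have k3 : {for (clamp (- (r4 / 2)) (r4 / 2) \o w) t, continuous theta}.
    by apply: ctheta; have [] := Hth _ (cl4 (w t)).
  exact: continuous_comp k2 k3.
- by move=> t; have [_ /Hd[]] := Hth _ (cl4 (z (clamp A B t) 0 j - x0 0 j)).
move=> t /andP[at_ tb] te.
have tAB : A <= t <= B.
  by rewrite ge_max le_min at_ tb /= -ler_distl ltW.
have [tab te'] := inAB t tAB; have [h1 h2 h3] := zP t tab te'.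
rewrite /psi (clamp_id tAB).
have -> : clamp (- (r4 / 2)) (r4 / 2) (z t 0 j - x0 0 j) = sg t.
  by apply: clamp_id; rewrite -ler_norml ltW.
have sr4 : `|sg t| < r4 by exact: lt_trans r42.
have [_ l2] := Hth _ sr4; have [_ l3 _] := Hd _ l2.
rewrite -(cmapK atl l3) (matchy _ sr4) -(matchz _ tAB).
exact: esym (cmapK atl (hdom t tab h1)).
Qed.

End Reparametrization.

(** * The lifted structure on M x R *)

Section TimesLine.
Context {R : realType} {n : nat} {M : topologicalType}.
Variable ch : charted R n M.
Hypothesis atl : atlas ch.
Implicit Types (z : M * R) (y : 'rV[R]_(n + 1)).
Notation chbar := (times_line ch).

(** The form pi^* a + c dw, with pi the projection to [M]. *)
Definition lift_cov (a : M -> 'cV[R]_n) (c : R) z : 'cV[R]_(n + 1) := col_mx (a z.1) c%:M.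

Lemma lsubmx_continuous m n1 n2 : continuous (@lsubmx R m n1 n2).
Proof.
move=> x; apply/continuous_mxP => i j.
rewrite (_ : (fun N => lsubmx N i j) = (fun N : 'M[R]_(m, n1 + n2) => N i (lshift n2 j))).
  exact: coord_continuous.
by apply/funext => N; rewrite mxE.
Qed.

Lemma rsubmx_continuous m n1 n2 : continuous (@rsubmx R m n1 n2).
Proof.
move=> x; apply/continuous_mxP => i j.
rewrite (_ : (fun N => rsubmx N i j) = (fun N : 'M[R]_(m, n1 + n2) => N i (rshift n1 j))).
  exact: coord_continuous.
by apply/funext => N; rewrite mxE.
Qed.

Lemma times_line_image z0 (U : set M) :
  image_in chbar z0 (U `*` setT) = lsubmx @^-1` image_in ch z0.1 U.
Proof.
apply/seteqP; split=> [y [z [pz [Uz _]] <-]|y [q [pq Uq] qy]].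
  by rewrite /= row_mxKl; exists z.1.
exists (q, rsubmx y 0 0); first by [].
rewrite /= qy -[RHS]hsubmxK; congr (row_mx _ _).
by apply/matrixP => i j; rewrite !mxE !ord1.
Qed.

Lemma times_line_image_cdom z0 z1 :
  image_in chbar z0 (cdom (chbar z1)) = lsubmx @^-1` image_in ch z0.1 (cdom (ch z1.1)).
Proof.
rewrite -times_line_image; congr (image_in _ _ _).
by apply/seteqP; split=> [z /= zz|z [/= zz _]].
Qed.

Lemma smooth_row_mx (V : normedModType R) m k1 k2 (U : set V) (A : V -> 'M[R]_(m, k1))
    (B : V -> 'M[R]_(m, k2)) : open U -> smooth U A -> smooth U B ->
  smooth U (fun x => row_mx (A x) (B x)).
Proof.
move=> oU /(smooth_mxP _ oU) sA /(smooth_mxP _ oU) sB; apply/smooth_mxP => // i j.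
under eq_fun do rewrite mxE.
by case: (fintype.split j) => k; [exact: sA|exact: sB].
Qed.

Lemma smooth_col_mx (V : normedModType R) m1 m2 k (U : set V) (A : V -> 'M[R]_(m1, k))
    (B : V -> 'M[R]_(m2, k)) : open U -> smooth U A -> smooth U B ->
  smooth U (fun x => col_mx (A x) (B x)).
Proof.
move=> oU /(smooth_mxP _ oU) sA /(smooth_mxP _ oU) sB; apply/smooth_mxP => // i j.
under eq_fun do rewrite mxE.
by case: (fintype.split i) => k'; [exact: sA|exact: sB].
Qed.

Lemma smooth_id (V : normedModType R) (U : set V) : smooth U (fun x : V => x).
Proof.
move=> [x _|k]; first exact: cvg_id.
split=> [x _|v]; first exact: ex_diff.
have -> : 'D_v (fun x : V => x) = (fun=> v) by apply/funext => x; exact: derive_id.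
exact: diff_upto_cst.
Qed.

Lemma smooth_lsubmx (W : normedModType R) m n1 n2 (U : set 'M[R]_(m, n1))
    (f : 'M[R]_(m, n1) -> W) : open U -> smooth U f ->
  smooth (@lsubmx R m n1 n2 @^-1` U) (fun N => f (lsubmx N)).
Proof. by move=> oU sf; exact: smooth_comp_lin (@lsubmx_continuous m n1 n2) oU sf. Qed.

Lemma smooth_rsubmx m n1 n2 (U : set 'M[R]_(m, n1 + n2)) :
  smooth U (fun N => rsubmx N).
Proof.
have := smooth_comp_lin (@rsubmx_continuous m n1 n2) openT (smooth_id (V := 'M[R]_(m, n2)) setT).
by apply: smooth_sub => y.
Qed.

Lemma times_line_transition z0 z1 y :
  (cmap (chbar z1) \o cinv (chbar z0)) y = row_mx (transition ch z0.1 z1.1 (lsubmx y)) (rsubmx y).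
Proof.
by rewrite /= /transition; congr (row_mx _ _); apply/matrixP => i j; rewrite !mxE !ord1.
Qed.

Lemma times_line_atlas : atlas chbar.
Proof.
split=> [z0|z0 z1].
  have oD : open (cdom (chbar z0)).
    apply: (@open_comp _ _ fst); last exact: cdom_open.
    by move=> z _; exact: cvg_fst.
  have imE : cmap (chbar z0) @` cdom (chbar z0) = lsubmx @^-1` (cmap (ch z0.1) @` cdom (ch z0.1)).
    have := times_line_image z0 (cdom (ch z0.1)).
    rewrite /image_in (_ : cdom (chbar z0) `&` _ = cdom (chbar z0)) ?setIid //.
    by apply/seteqP; split=> [z []|z h] //; split.
  have oI : open (cmap (chbar z0) @` cdom (chbar z0)).
    rewrite imE; apply: open_comp; first by move=> y _; exact: lsubmx_continuous.
    by have [_ _ + _ _] := atl.1 z0.1.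
  split=> //.
  - exact: (cdom_self atl z0.1).
  - move=> z; rewrite inE => pz; rewrite /= row_mxKl row_mxKr (cmapK atl pz) mxE /= mulr1n.
    by case: z pz.
  - split; rewrite continuous_open_subspace //.
      move=> z; rewrite inE => pz; apply/continuous_mxP => i j.
      have c1 : {for z, continuous (cmap (ch z0.1) \o fst)}.
        by apply: continuous_comp; [exact: cvg_fst|exact: cmap_continuous].
      rewrite (_ : (fun _ => _) = (fun z' : M * R => match fintype.split j with
          inl k => cmap (ch z0.1) z'.1 i k | inr _ => z'.2 end)).
        by case: (fintype.split j) => k; [move/continuous_mxP : c1; exact|exact: cvg_snd].
      apply/funext => z'; rewrite mxE; case: (fintype.split j) => k //.
      by rewrite mxE !ord1.
    move=> y; rewrite inE imE => Iy.
    have c1 : {for y, continuous (cinv (ch z0.1) \o lsubmx)}.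
      by apply: continuous_comp; [exact: lsubmx_continuous|exact: cinv_continuous].
    have c2 : {for y, continuous (fun y' : 'rV[R]_(n + 1) => rsubmx y' 0 0)}.
      by move/continuous_mxP: (@rsubmx_continuous 1 n 1 y); exact.
    exact: (cvg_pair c1 c2).
have oI := @image_in_open _ _ _ _ atl z0.1 _ (cdom_open atl z1.1).
rewrite (_ : cmap _ @` _ = lsubmx @^-1` image_in ch z0.1 (cdom (ch z1.1))); last exact: times_line_image_cdom.
have oI' : open (@lsubmx R 1 n 1 @^-1` image_in ch z0.1 (cdom (ch z1.1))).
  by apply: open_comp => // y _; exact: lsubmx_continuous.
have := smooth_row_mx oI' (smooth_lsubmx 1%N oI (transition_smooth atl z0.1 z1.1))
  (@smooth_rsubmx 1 n 1 _).
by apply: smooth_ext => // y _; rewrite times_line_transition.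
Qed.

Lemma times_line_trans_jac z0 z1 z : cdom (ch z0.1) z.1 -> cdom (ch z1.1) z.1 ->
  trans_jac chbar z0 z1 z = block_mx (trans_jac ch z0.1 z1.1 z.1) 0 0 1%:M.
Proof.
move=> h0 h1; apply/row_matrixP => i; rewrite !rowE; set u := delta_mx 0 i.
have z0z : cdom (chbar z0) z by []. have z1z : cdom (chbar z1) z by [].
rewrite (mulmx_trans_jac times_line_atlas u z0z z1z).
rewrite -[in RHS](hsubmxK u) mul_row_block !mulmx0 addr0 add0r mulmx1.
rewrite (mulmx_trans_jac atl (lsubmx u) h0 h1).
have lE : lsubmx (cmap (chbar z0) z) = cmap (ch z0.1) z.1 by exact: row_mxKl.
have dt : differentiable (transition ch z0.1 z1.1) (lsubmx (cmap (chbar z0) z)).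
  by rewrite lE; exact: transition_diff.
have D1 := is_derive_comp dt (is_derive_lsubmx (is_derive_id (cmap (chbar z0) z) u)).
have D2 := is_derive_rsubmx (is_derive_id (cmap (chbar z0) z) u).
have [_] := is_derive_row_mx D1 D2; rewrite lE => K; apply: etrans _ K.
apply: (congr1 (fun f => 'D_u f (cmap (chbar z0) z))).
by apply/funext => y; exact: times_line_transition.
Qed.

Lemma times_line_vec_in (A : M -> 'cV[R]_n) (X : M -> 'rV[R]_n) z0 y :
  cdom (ch z0.1) (cinv (ch z0.1) (lsubmx y)) ->
  vec_in chbar z0 (lift_vec A X) y =
  row_mx (vec_in ch z0.1 X (lsubmx y))
    (pairing (A (cinv (ch z0.1) (lsubmx y))) (X (cinv (ch z0.1) (lsubmx y))))%:M.
Proof.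
move=> h; rewrite /vec_in.
have E := @times_line_trans_jac (cinv (chbar z0) y) z0 (cinv (chbar z0) y) (cdom_self atl _) h.
rewrite /lift_vec; apply: etrans (congr1 (mulmx _) E) _.
by rewrite mul_row_block !mulmx0 addr0 add0r mulmx1.
Qed.

Lemma times_line_cov_in (a : M -> 'cV[R]_n) (c : R) z0 y :
  cdom (ch z0.1) (cinv (ch z0.1) (lsubmx y)) ->
  cov_in chbar z0 (lift_cov a c) y = col_mx (cov_in ch z0.1 a (lsubmx y)) c%:M.
Proof.
move=> h; rewrite /cov_in.
have E := @times_line_trans_jac z0 (cinv (chbar z0) y) (cinv (chbar z0) y) h (cdom_self atl _).
rewrite /lift_cov; apply: etrans (congr1 (mulmx^~ _) E) _.
by rewrite mul_block_col !mul0mx addr0 add0r mul1mx.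
Qed.

Lemma times_line_image_near z0 (U : set M) y : (lsubmx @^-1` image_in ch z0.1 U) y ->
  [/\ cdom (ch z0.1) (cinv (ch z0.1) (lsubmx y)), U (cinv (ch z0.1) (lsubmx y)) &
      lsubmx y = cmap (ch z0.1) (cinv (ch z0.1) (lsubmx y))].
Proof. by move=> [q [pq Uq] E]; rewrite -E (cmapK atl pq). Qed.

Lemma smooth_lift_vec (U : set M) (A : M -> 'cV[R]_n) (X : M -> 'rV[R]_n) : open U ->
  smooth_cov ch U A -> smooth_vec ch U X -> smooth_vec chbar (U `*` setT) (lift_vec A X).
Proof.
move=> oU sA sX z0; rewrite times_line_image.
have oI := @image_in_open _ _ _ _ atl z0.1 _ oU.
have oI' : open (@lsubmx R 1 n 1 @^-1` image_in ch z0.1 U).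
  by apply: open_comp => // y _; exact: lsubmx_continuous.
have := smooth_row_mx oI' (smooth_lsubmx 1%N oI (sX z0.1))
  (smooth_lsubmx 1%N oI (smooth_mulmx oI (sX z0.1) (sA z0.1))).
apply: smooth_ext => // y /times_line_image_near[h1 h2 h3].
rewrite times_line_vec_in //; congr (row_mx _ _); rewrite /pairing.
rewrite [X in vec_in _ _ _ X *m _]h3 [X in _ *m cov_in _ _ _ X]h3.
by rewrite (mulmx_in atl A X h1); apply/matrixP => i j; rewrite !ord1 [RHS]mxE mulr1n.
Qed.

Lemma smooth_lift_cov (U : set M) (a : M -> 'cV[R]_n) (c : R) : open U ->
  smooth_cov ch U a -> smooth_cov chbar (U `*` setT) (lift_cov a c).
Proof.
move=> oU sa z0; rewrite times_line_image.
have oI := @image_in_open _ _ _ _ atl z0.1 _ oU.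
have oI' : open (@lsubmx R 1 n 1 @^-1` image_in ch z0.1 U).
  by apply: open_comp => // y _; exact: lsubmx_continuous.
have := smooth_col_mx oI' (smooth_lsubmx 1%N oI (sa z0.1)) (smooth_cst _ (c%:M : 'M[R]_1)).
by apply: smooth_ext => // y /times_line_image_near[h1 h2 h3]; rewrite times_line_cov_in.
Qed.

(** With constant [c] the term c dw is closed, and the pulled back part does not depend on w. *)
Lemma dform1_lift_cov (a : M -> 'cV[R]_n) (c : R) z u v :
  differentiable (cov_in ch z.1 a) (cmap (ch z.1) z.1) ->
  differentiable (cov_in chbar z (lift_cov a c)) (cmap (chbar z) z) ->
  form2 (dform1 chbar (lift_cov a c) z) u v = form2 (dform1 ch a z.1) (lsubmx u) (lsubmx v).
Proof.
move=> da db; rewrite (dform1E _ _ da) (dform1E _ _ db).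
have lE : lsubmx (cmap (chbar z) z) = cmap (ch z.1) z.1 by exact: row_mxKl.
have D w : 'D_w (cov_in chbar z (lift_cov a c)) (cmap (chbar z) z) =
    col_mx ('D_(lsubmx w) (cov_in ch z.1 a) (cmap (ch z.1) z.1)) 0.
  have da' : differentiable (cov_in ch z.1 a) (lsubmx (cmap (chbar z) z)) by rewrite lE.
  have D1 := is_derive_comp da' (is_derive_lsubmx (is_derive_id (cmap (chbar z) z) w)).
  have [_] := is_derive_col_mx D1 (is_derive_cst (c%:M : 'M[R]_1) (cmap (chbar z) z) w).
  rewrite lE => <-.
  apply: near_eq_derive.
  have [zz zo] := (cdom_self times_line_atlas z, cdom_open times_line_atlas z).
  apply: filterS (cinv_near times_line_atlas zz zo zz) => y [h _ _].
  exact: times_line_cov_in.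
have mulE (w w' : 'rV[R]_(n + 1)) (r : 'cV[R]_n) : w *m col_mx r (0 : 'cV[R]_1) = lsubmx w *m r.
  by rewrite -{1}(hsubmxK w) mul_row_col mulmx0 addr0.
by rewrite (D u) (D v) !mulE.
Qed.

Lemma has_velocity_fst (c : R -> M * R) t v : has_velocity chbar c t v ->
  has_velocity ch (fun s => (c s).1) t (lsubmx v).
Proof.
move=> [h1 h2]; split; first exact: h1.
have E : cmap (ch (c t).1) \o (fun s => (c s).1) =
    (fun s => lsubmx ((cmap (chbar (c t)) \o c) s)).
  by apply/funext => s; exact: esym (row_mxKl _ _).
by rewrite E; exact: is_derive_lsubmx h2.
Qed.

Lemma lsubmx_norm_le m n1 n2 (A : 'M[R]_(m, n1 + n2)) : `|lsubmx A| <= `|A|.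
Proof. by apply: mx_norm_le => // i j; rewrite mxE; exact: mx_norm_entry. Qed.

Lemma abs_continuous_fst a b (c : R -> M * R) : abs_continuous_curve chbar a b c ->
  abs_continuous_curve ch a b (fun s => (c s).1).
Proof.
move=> H t tab; have [e e0 [H1 H2]] := H t tab; exists e => //; split=> // k k0.
have [d d0 Hd] := H2 k k0; exists d => // N s s' h1 h2 h3.
apply: le_lt_trans (Hd N s s' h1 h2 h3); apply: ler_sum => i _.
apply: le_trans (lsubmx_norm_le _); rewrite linearB /=.
by rewrite !row_mxKl.
Qed.

End TimesLine.

(** * Contact geometry and horizontal magnetic fields *)

Section BilinearForms.
Context {R : realType} {n : nat}.
Implicit Types (B : 'M[R]_n) (u v w : 'rV[R]_n) (a b : 'cV[R]_n).

Lemma pairingDr a u v : pairing a (u + v) = pairing a u + pairing a v.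
Proof. by rewrite /pairing mulmxDl mxE. Qed.

Lemma pairingZr a k u : pairing a (k *: u) = k * pairing a u.
Proof. by rewrite /pairing -scalemxAl mxE. Qed.

Lemma pairingBr a u v : pairing a (u - v) = pairing a u - pairing a v.
Proof. by rewrite -scaleN1r pairingDr pairingZr mulN1r. Qed.

Lemma pairingDl a b u : pairing (a + b) u = pairing a u + pairing b u.
Proof. by rewrite /pairing mulmxDr mxE. Qed.

Lemma pairingZl a k u : pairing (k *: a) u = k * pairing a u.
Proof. by rewrite /pairing -scalemxAr mxE. Qed.

Lemma pairingNl a u : pairing (- a) u = - pairing a u.
Proof. by rewrite -scaleN1r pairingZl mulN1r. Qed.

Lemma pairing_inj a b : (forall u, pairing a u = pairing b u) -> a = b.
Proof.
move=> H; apply/colP => i; have := H (delta_mx 0 i).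
by rewrite /pairing -!rowE !mxE.
Qed.

Lemma form2Dl B u v w : form2 B (u + v) w = form2 B u w + form2 B v w.
Proof. by rewrite /form2 !mulmxDl mxE. Qed.

Lemma form2Zl B k u w : form2 B (k *: u) w = k * form2 B u w.
Proof. by rewrite /form2 -!scalemxAl mxE. Qed.

Lemma form2Dr B u v w : form2 B w (u + v) = form2 B w u + form2 B w v.
Proof. by rewrite /form2 linearD /= mulmxDr mxE. Qed.

Lemma form2Zr B k u w : form2 B w (k *: u) = k * form2 B w u.
Proof. by rewrite /form2 linearZ /= -scalemxAr mxE. Qed.

Lemma form2_anti B u v : B^T = - B -> form2 B u v = - form2 B v u.
Proof.
move=> BT; rewrite /form2 -[u *m B *m v^T]mx11_tr !trmx_mul trmxK BT.
by rewrite mulNmx mulmxN mxE mulmxA.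
Qed.

Lemma form2_diag B u : B^T = - B -> form2 B u u = 0.
Proof. by move=> /(form2_anti u u) /eqP; rewrite -addr_eq0 -mulr2n mulrn_eq0 => /eqP. Qed.

Lemma form2_pairing B u v : form2 B u v = pairing (B *m v^T) u.
Proof. by rewrite /form2 /pairing mulmxA. Qed.

Lemma form2_wedge a b u v :
  form2 (wedge11 a b) u v = pairing a u * pairing b v - pairing b u * pairing a v.
Proof.
have E c d : (u *m (c *m d^T) *m v^T) 0 0 = pairing c u * pairing d v.
  rewrite mulmxA -mulmxA -trmx_mul mx11_tr [u *m c]mx11_scalar mul_scalar_mx mxE.
  by rewrite /pairing.
have subE (P Q : 'M[R]_1) : (P - Q) 0 0 = P 0 0 - Q 0 0 by rewrite !mxE.
by rewrite /form2 /wedge11 mulmxBr mulmxBl subE !E.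
Qed.

Lemma form2DB B B' u v : form2 (B + B') u v = form2 B u v + form2 B' u v.
Proof. by rewrite /form2 mulmxDr mulmxDl mxE. Qed.

Lemma form2ZB k B u v : form2 (k *: B) u v = k * form2 B u v.
Proof. by rewrite /form2 -scalemxAr -scalemxAl mxE. Qed.

Lemma form2_eq0 B : (forall u v, form2 B u v = 0) -> B = 0.
Proof.
move=> H; apply/matrixP => i j; have := H (delta_mx 0 i) (delta_mx 0 j).
by rewrite /form2 trmx_delta -rowE -colE !mxE.
Qed.

Lemma dform1_anti (T : Type) (ch : charted R n T) (a : T -> 'cV[R]_n) p :
  (dform1 ch a p)^T = - dform1 ch a p.
Proof. by apply/matrixP => i j; rewrite !mxE opprB. Qed.

(* An oriented orthonormal change of basis of the plane is a rotation. *)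
Lemma rotation_coefs (c s c' s' : R) : c * c + s * s = 1 -> c * c' + s * s' = 0 ->
  c * s' - s * c' = 1 -> c' = - s /\ s' = c.
Proof.
move=> h1 h2 h3; split.
  have -> : c' = c' * (c * c + s * s) by rewrite h1 mulr1.
  have -> : c' * (c * c + s * s) = c * (c * c' + s * s') - s * (c * s' - s * c') by ring.
  by rewrite h2 h3 mulr0 sub0r mulr1.
have -> : s' = s' * (c * c + s * s) by rewrite h1 mulr1.
have -> : s' * (c * c + s * s) = s * (c * c' + s * s') + c * (c * s' - s * c') by ring.
by rewrite h2 h3 mulr0 add0r mulr1.
Qed.

End BilinearForms.

Section Locality.
Context {R : realType} {n : nat} {T : topologicalType}.
Variable ch : charted R n T.
Hypothesis atl : atlas ch.

Lemma smooth_fun_ext U (f h : T -> R) : open U -> (forall p, U p -> f p = h p) ->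
  smooth_fun ch U f -> smooth_fun ch U h.
Proof.
move=> oU fh sf p; apply: smooth_ext (sf p); first exact: image_in_open.
by move=> _ [q [pq Uq] <-]; rewrite /fun_in (cmapK atl pq) fh.
Qed.

Lemma smooth_cov_ext U (a b : T -> 'cV[R]_n) : open U -> (forall p, U p -> a p = b p) ->
  smooth_cov ch U a -> smooth_cov ch U b.
Proof.
move=> oU ab sa p; apply: smooth_ext (sa p); first exact: image_in_open.
by move=> _ [q [pq Uq] <-]; rewrite /cov_in (cmapK atl pq) ab.
Qed.

Lemma smooth_covD U (a b : T -> 'cV[R]_n) : open U ->
  smooth_cov ch U a -> smooth_cov ch U b -> smooth_cov ch U (fun p => a p + b p).
Proof.
move=> oU sa sb p; apply: smooth_ext (smoothD _ (sa p) (sb p)); try exact: image_in_open.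
by move=> x _; rewrite /cov_in mulmxDr.
Qed.

Lemma smooth_covZ U (f : T -> R) (a : T -> 'cV[R]_n) : open U ->
  smooth_fun ch U f -> smooth_cov ch U a -> smooth_cov ch U (fun p => f p *: a p).
Proof.
move=> oU sf sa p; apply: smooth_ext (smooth_scalemx _ (sf p) (sa p)); try exact: image_in_open.
by move=> x _; rewrite /cov_in /fun_in -scalemxAr.
Qed.

Lemma smooth_vecD U (X Y : T -> 'rV[R]_n) : open U ->
  smooth_vec ch U X -> smooth_vec ch U Y -> smooth_vec ch U (fun p => X p + Y p).
Proof.
move=> oU sa sb p; apply: smooth_ext (smoothD _ (sa p) (sb p)); try exact: image_in_open.
by move=> x _; rewrite /vec_in mulmxDl.
Qed.

Lemma smooth_vecZ U (f : T -> R) (X : T -> 'rV[R]_n) : open U ->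
  smooth_fun ch U f -> smooth_vec ch U X -> smooth_vec ch U (fun p => f p *: X p).
Proof.
move=> oU sf sa p; apply: smooth_ext (smooth_scalemx _ (sf p) (sa p)); try exact: image_in_open.
by move=> x _; rewrite /vec_in /fun_in -scalemxAl.
Qed.

Lemma smooth_fun_cst U (c : R) : smooth_fun ch U (fun=> c).
Proof. by move=> p; exact: smooth_cst. Qed.

Lemma smooth_covN U (a : T -> 'cV[R]_n) : open U ->
  smooth_cov ch U a -> smooth_cov ch U (fun p => - a p).
Proof.
move=> oU sa; apply: smooth_cov_ext (smooth_covZ oU (smooth_fun_cst U (-1)) sa) => //.
by move=> p _; rewrite scaleN1r.
Qed.

Lemma dform1_near U (a b : T -> 'cV[R]_n) p : open U -> U p -> (forall q, U q -> a q = b q) ->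
  dform1 ch a p = dform1 ch b p.
Proof.
move=> oU Up ab; have pp := cdom_self atl p.
have E i : 'D_(delta_mx 0 i) (cov_in ch p a) (cmap (ch p) p) =
    'D_(delta_mx 0 i) (cov_in ch p b) (cmap (ch p) p).
  apply: near_eq_derive; apply: filterS (cinv_near atl pp oU Up) => y [_ h _].
  by rewrite /cov_in ab.
apply/matrixP => i j; rewrite [LHS]mxE [RHS]mxE.
exact: (congr2 (fun P Q : 'cV[R]_n => P j 0 - Q i 0) (E i) (E j)).
Qed.

Lemma dform1N (a : T -> 'cV[R]_n) p : differentiable (cov_in ch p a) (cmap (ch p) p) ->
  dform1 ch (fun q => - a q) p = - dform1 ch a p.
Proof.
move=> da.
have E i : 'D_(delta_mx 0 i) (cov_in ch p (fun q => - a q)) (cmap (ch p) p) =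
    - 'D_(delta_mx 0 i) (cov_in ch p a) (cmap (ch p) p).
  have [_ <-] := is_deriveN (is_derive_diff (delta_mx 0 i) da).
  apply: (congr1 (fun f => 'D_(delta_mx 0 i) f (cmap (ch p) p))).
  by apply/funext => x; exact: (mulmxN (trans_jac ch p (cinv (ch p) x) (cinv (ch p) x)) (a (cinv (ch p) x))).
apply/matrixP => i j; rewrite [LHS]mxE [RHS]mxE [X in _ = - X]mxE.
apply: etrans (congr2 (fun P Q : 'cV[R]_n => P j 0 - Q i 0) (E i) (E j)) _.
by rewrite [X in X - _]mxE [X in _ - X]mxE opprB opprK addrC.
Qed.

End Locality.

(** * Dual coframes, rotations of frames and frame-independent expressions *)

Section ContactAlgebra.
Context {R : realType} {M : topologicalType}.
Variable ch : charted R 3 M.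
Variables (omega : M -> 'cV[R]_3) (g : M -> 'M[R]_3) (X0 : M -> 'rV[R]_3).
Hypothesis atl : atlas ch.
Hypothesis Hc : contact_sub_riemannian ch omega g.
Hypothesis Hr : reeb ch omega X0.
Notation dom p := (dform1 ch omega p).
Notation F := (contact_frame ch omega g).

(** Contraction of d omega with frame vectors gives the dual coframe explicitly: d omega(X1, X2) =
    -1, and X0 lies in the kernel of d omega. *)
Definition coframe1 (X2 : M -> 'rV[R]_3) p : 'cV[R]_3 := - (dom p *m (X2 p)^T).
Definition coframe2 (X1 : M -> 'rV[R]_3) p : 'cV[R]_3 := dom p *m (X1 p)^T.

Lemma coframe_dual U X1 X2 : F U X1 X2 ->
  dual_coframe X0 U X1 X2 (coframe1 X2) (coframe2 X1).
Proof.
move=> [_ _ _ H] p Up; have [_ _ _ _ w] := H p Up; have [_ h] := Hr p.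
have a := dform1_anti ch omega p.
rewrite /coframe1 /coframe2 !pairingNl -!form2_pairing w !h !oppr0 !(form2_diag _ a).
by rewrite (form2_anti _ _ a) w oppr0.
Qed.

(** Duality says that the matrix of frame rows times the matrix of coframe columns is the identity.
    For square matrices the product in the other order is then the identity too, and that is the
    expansion. *)
Lemma frame_decomposition U X1 X2 p v : F U X1 X2 -> U p ->
  v = pairing (coframe1 X2 p) v *: X1 p + pairing (coframe2 X1 p) v *: X2 p
      + pairing (omega p) v *: X0 p.
Proof.
move=> FU Up; have [[a1 a2 a3] [b1 b2 b3]] := coframe_dual FU Up.
have [_ _ _ H] := FU; have [[k1 k2] _ _ _ _] := H p Up; have [k3 _] := Hr p.
set nu1 := coframe1 X2 p in a1 a2 a3 *; set nu2 := coframe2 X1 p in b1 b2 b3 *.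
pose f (i : 'I_3) : 'rV[R]_3 := nth 0 [:: X1 p; X2 p; X0 p] i.
pose h (i : 'I_3) : 'cV[R]_3 := nth 0 [:: nu1; nu2; omega p] i.
pose P : 'M[R]_3 := \matrix_i f i.
pose Q : 'M[R]_3 := \matrix_(j, k) h k j 0.
have hE u (k : 'I_3) : (u *m Q) 0 k = pairing (h k) u.
  by rewrite /pairing !mxE; apply: eq_bigr => j _; rewrite mxE.
have PQ : P *m Q = 1%:M.
  apply/matrixP => i k; rewrite [RHS]mxE.
  have -> : (P *m Q) i k = (f i *m Q) 0 k.
    by rewrite -(rowK f i) -row_mul [RHS]mxE.
  rewrite hE; case: i => [[|[|[|i]]] hi] //; case: k => [[|[|[|k]]] hk] //;
    rewrite /f /h /= ?k1 ?k2 ?k3 ?a1 ?a2 ?a3 ?b1 ?b2 ?b3 //.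
have QP := mulmx1C PQ.
rewrite -{1}[v]mulmx1 -QP mulmxA mulmx_sum_row.
rewrite !big_ord_recl big_ord0 addr0 !rowK !hE addrA.
by [].
Qed.

Lemma frame_pairing U X1 X2 p v : F U X1 X2 -> U p -> pairing (omega p) v = 0 ->
  v = pairing (coframe1 X2 p) v *: X1 p + pairing (coframe2 X1 p) v *: X2 p.
Proof.
by move=> FU Up o; rewrite {1}(frame_decomposition v FU Up) o scale0r addr0.
Qed.

(** Both frames are orthonormal and both are oriented by -d omega(X1, X2) = 1, so reflections are
    excluded. Independence of the frame for [dpot] and [characteristic] rests on this. *)
Lemma frame_rotation U X1 X2 V X1' X2' p : F U X1 X2 -> F V X1' X2' -> U p -> V p ->
  exists c s : R, [/\ c * c + s * s = 1, X1' p = c *: X1 p + s *: X2 p &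
    X2' p = - s *: X1 p + c *: X2 p].
Proof.
move=> FU FV Up Vp; have [_ _ _ HU] := FU; have [_ _ _ HV] := FV.
have [[k1 k2] G11 G22 G12 w12] := HU p Up.
have [[k1' k2'] G11' G22' G12' w12'] := HV p Vp.
have E1 := frame_pairing FU Up k1'; have E2 := frame_pairing FU Up k2'.
move: E1 E2; set c := pairing _ (X1' p); set s := pairing _ (X1' p).
set c' := pairing _ (X2' p); set s' := pairing _ (X2' p) => E1 E2.
have [_ _ Hsym _ _] := Hc; have symG := Hsym.1.
have g21 : form2 (g p) (X2 p) (X1 p) = 0 by rewrite -(symG p _ _ k1 k2).
have GE (a b a' b' : R) : form2 (g p) (a *: X1 p + b *: X2 p) (a' *: X1 p + b' *: X2 p) =
    a * a' + b * b'.
  rewrite !form2Dl !form2Dr !form2Zl !form2Zr G11 G22 G12 g21.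
  by rewrite !mulr1 !mulr0 addr0 add0r.
have an := dform1_anti ch omega p.
have w12E : form2 (dom p) (X1 p) (X2 p) = -1 by rewrite -w12 opprK.
have WE (a b a' b' : R) : - form2 (dom p) (a *: X1 p + b *: X2 p) (a' *: X1 p + b' *: X2 p) =
    a * b' - b * a'.
  rewrite !form2Dl !form2Dr !form2Zl !form2Zr !(form2_diag _ an).
  rewrite (form2_anti (X2 p) (X1 p) an) w12E; ring.
rewrite E1 E2 GE in G12'; rewrite E1 GE in G11'; rewrite E1 E2 WE in w12'.
have [ec es] := rotation_coefs G11' G12' w12'.
by exists c, s; split=> //; rewrite E2 ec es.
Qed.

Variables (beta : M -> 'M[R]_3) (A : M -> 'cV[R]_3).
Hypothesis Hb : magnetic_field ch omega g X0 beta.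

Definition field_coef (p : M) (v : 'rV[R]_3) : R := form2 (beta p) v (X0 p).

(** [horizontal_form2] provides smooth coefficients only existentially. Evaluating on (Xi, X0)
    identifies them with [field_coef], which thereby becomes smooth. *)
Lemma magnetic_field_frame U X1 X2 : F U X1 X2 ->
  [/\ smooth_fun ch U (fun p => field_coef p (X1 p)),
      smooth_fun ch U (fun p => field_coef p (X2 p)) &
      forall p u v, U p -> form2 (beta p) u v =
        pairing (omega p) v * (field_coef p (X1 p) * pairing (coframe1 X2 p) u
                              + field_coef p (X2 p) * pairing (coframe2 X1 p) u)
        - pairing (omega p) u * (field_coef p (X1 p) * pairing (coframe1 X2 p) v
                              + field_coef p (X2 p) * pairing (coframe2 X1 p) v)].
Proof.
move=> FU; have [[_ Hb2] _] := Hb; have dual := coframe_dual FU.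
have [b1 [b2 [s1 s2 bE]]] := Hb2 _ _ _ _ _ FU dual.
have K p u v : U p -> form2 (beta p) u v =
   pairing (omega p) v * (b1 p * pairing (coframe1 X2 p) u + b2 p * pairing (coframe2 X1 p) u)
   - pairing (omega p) u * (b1 p * pairing (coframe1 X2 p) v + b2 p * pairing (coframe2 X1 p) v).
  move=> Up; rewrite (bE p Up) form2DB !form2ZB !form2_wedge.
  by move: (pairing _ u) (pairing _ v) (pairing _ u) (pairing _ v) (pairing _ u) (pairing _ v) => *; ring.
have [oU _ _ HU] := FU.
have e1 p : U p -> field_coef p (X1 p) = b1 p.
  move=> Up; have [[a1 a2 a3] [c1 c2 c3]] := dual p Up.
  have [[k1 k2] _ _ _ _] := HU p Up; have [k3 _] := Hr p.
  by rewrite /field_coef (K _ _ _ Up) k1 k3 a1 c1; ring.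
have e2 p : U p -> field_coef p (X2 p) = b2 p.
  move=> Up; have [[a1 a2 a3] [c1 c2 c3]] := dual p Up.
  have [[k1 k2] _ _ _ _] := HU p Up; have [k3 _] := Hr p.
  by rewrite /field_coef (K _ _ _ Up) k2 k3 a2 c2; ring.
have [oU' _ _ _] := FU.
split.
- by apply: (smooth_fun_ext atl oU' _ s1) => p Up; rewrite e1.
- by apply: (smooth_fun_ext atl oU' _ s2) => p Up; rewrite e2.
- by move=> p u v Up; rewrite (e1 p Up) (e2 p Up); exact: K.
Qed.

Lemma magnetic_field_neq0 U X1 X2 p : F U X1 X2 -> U p -> beta p != 0 ->
  0 < field_coef p (X1 p) ^+ 2 + field_coef p (X2 p) ^+ 2.
Proof.
move=> FU Up bp; rewrite lt0r addr_ge0 ?sqr_ge0 // andbT.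
apply: contraNneq bp => /eqP; rewrite paddr_eq0 ?sqr_ge0 // !sqrf_eq0 => /andP[/eqP b1 /eqP b2].
apply/eqP/form2_eq0 => u v; have [_ _ ->] := magnetic_field_frame FU; last exact: Up.
by rewrite b1 b2 !mul0r addr0 !mulr0 subrr.
Qed.

(** In a local frame beta is nonzero exactly where the sum of the squares of its two smooth
    coefficients is positive. *)
Lemma magnetic_field_neq0_open : (forall p, exists U X1 X2, F U X1 X2 /\ U p) ->
  open [set p | beta p != 0].
Proof.
move=> Hf; rewrite openE => p bp; have [U [X1 [X2 [FU Up]]]] := Hf p.
have [oU _ _ _] := FU; have pp := cdom_self atl p.
have [s1 s2 bE] := magnetic_field_frame FU.
have q0 := magnetic_field_neq0 FU Up bp.
have cont f : smooth_fun ch U f -> {for p, continuous f}.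
  move=> sf.
  have c1 : {for cmap (ch p) p, continuous (fun_in ch p f)}.
    by apply: differentiable_continuous; apply: smooth_differentiable (sf p) _; exact: image_in_mem.
  have c2 : {for p, continuous (fun_in ch p f \o cmap (ch p))}.
    by apply: continuous_comp => //; exact: cmap_continuous.
  have : (fun_in ch p f \o cmap (ch p)) @ p --> (fun_in ch p f \o cmap (ch p)) p := c2.
  rewrite /= (fun_inE atl f pp) => c3; suff : f @ p --> f p by [].
  apply: cvg_trans c3; apply: near_eq_cvg.
  have : \forall q \near p, cdom (ch p) q by apply: open_nbhs_nbhs; split; [exact: cdom_open|].
  by apply: filterS => q pq; rewrite /= (fun_inE atl f pq).
have c : {for p, continuous (fun q => field_coef q (X1 q) * field_coef q (X1 q)
    + field_coef q (X2 q) * field_coef q (X2 q))}.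
  by apply: continuousD; apply: continuousM; exact: cont.
have N1 : \forall q \near p, 0 < field_coef q (X1 q) * field_coef q (X1 q)
    + field_coef q (X2 q) * field_coef q (X2 q).
  have o : open [set x : R | 0 < x] by exact: open_gt.
  have pos : [set x : R | 0 < x] (field_coef p (X1 p) * field_coef p (X1 p)
    + field_coef p (X2 p) * field_coef p (X2 p)) by rewrite /= -!expr2.
  exact: (c _ (open_nbhs_nbhs (conj o pos))).
have NU : \forall q \near p, U q by exact: open_nbhs_nbhs.
apply: filterS N1 => q q1 /=; apply: contraTneq q1 => b0.
by rewrite /field_coef b0 /form2 !mulmx0 !mul0mx mxE mul0r addr0 ltxx.
Qed.

Variables (e1 e2 : M -> 'rV[R]_3).
Hypothesis He : forall p, exists U X1 X2, [/\ F U X1 X2, U p, e1 p = X1 p & e2 p = X2 p].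
Hypothesis Ha : magnetic_potential ch omega g X0 beta A.

(** [e1] and [e2] are frame values chosen point by point, with no continuity. A rotation has
    determinant 1 and dA is alternating, so the value agrees with the smooth expression in any local
    frame. *)
Definition dpot p : R := form2 (dform1 ch A p) (e1 p) (e2 p).

Definition rumin_potential p : 'cV[R]_3 := A p + dpot p *: omega p.

Lemma dpot_frame U X1 X2 p : F U X1 X2 -> U p -> dpot p = form2 (dform1 ch A p) (X1 p) (X2 p).
Proof.
move=> FU Up; have [V [Y1 [Y2 [FV Vp E1 E2]]]] := He p.
have [c [s [cs EX EY]]] := frame_rotation FU FV Up Vp.
have an := dform1_anti ch A p.
rewrite /dpot E1 E2 EX EY !form2Dl !form2Dr !form2Zl !form2Zr !(form2_diag _ an).
rewrite (form2_anti (X2 p) (X1 p) an).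
by move: (form2 _ _ _) => w; rewrite -[RHS]mul1r -cs; ring.
Qed.

Lemma rumin_potential_smooth U X1 X2 : F U X1 X2 -> smooth_cov ch U rumin_potential.
Proof.
move=> FU; have [oU sX1 sX2 _] := FU; have [[sA _] _] := Ha; have [so _ _ _ _] := Hc.
have sub a : smooth_cov ch setT a -> smooth_cov ch U a.
  by move=> sa p; apply: smooth_sub (sa p) => y [q [pq _] qy]; exists q.
apply: (smooth_covD atl oU (sub _ sA)); apply: (smooth_covZ atl oU _ (sub _ so)).
have := smooth_fun_dform1 atl oU (sub _ sA) sX1 sX2.
by apply: (smooth_fun_ext atl oU) => p Up; rewrite (dpot_frame FU Up).
Qed.

Lemma dform1_rumin_potential p : dform1 ch rumin_potential p = beta p.
Proof.
have [U [X1 [X2 [FU Up _ _]]]] := He p; have [oU _ _ _] := FU.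
have [_ H] := Ha; rewrite (H U X1 X2 FU p Up).
by apply: (dform1_near atl oU Up) => q Uq; rewrite /rumin_potential (dpot_frame FU Uq).
Qed.

(** The unit vector annihilated by beta, obtained by turning the coefficient vector through a right
    angle. Rotating the frame rotates both, so the result does not depend on the frame. Where beta
    vanishes the value is 0. *)
Definition characteristic p : 'rV[R]_3 :=
  (Num.sqrt (field_coef p (e1 p) ^+ 2 + field_coef p (e2 p) ^+ 2))^-1 *:
    (field_coef p (e2 p) *: e1 p - field_coef p (e1 p) *: e2 p).

Lemma characteristic_frame U X1 X2 p : F U X1 X2 -> U p -> characteristic p =
  (Num.sqrt (field_coef p (X1 p) ^+ 2 + field_coef p (X2 p) ^+ 2))^-1 *:
    (field_coef p (X2 p) *: X1 p - field_coef p (X1 p) *: X2 p).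
Proof.
move=> FU Up; have [V [Y1 [Y2 [FV Vp E1 E2]]]] := He p.
have [c [s [cs EX EY]]] := frame_rotation FU FV Up Vp.
rewrite /characteristic E1 E2 EX EY /field_coef !form2Dl !form2Zl.
move: (form2 _ (X1 p) _) (form2 _ (X2 p) _) => b1 b2.
have -> : (c * b1 + s * b2) ^+ 2 + (- s * b1 + c * b2) ^+ 2 = b1 ^+ 2 + b2 ^+ 2.
  by rewrite -[RHS]mul1r -cs; ring.
congr (_ *: _); apply/rowP => i; rewrite !mxE; move: (X1 p 0 i) (X2 p 0 i) => x1 x2.
by rewrite -[RHS]mul1r -cs; ring.
Qed.

End ContactAlgebra.

Record magnetic_setting (R : realType) (M : topologicalType) (ch : charted R 3 M)
    (omega : M -> 'cV[R]_3) (g : M -> 'M[R]_3) (X0 : M -> 'rV[R]_3)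
    (beta : M -> 'M[R]_3) (A : M -> 'cV[R]_3) (e1 e2 : M -> 'rV[R]_3) : Prop :=
  MagneticSetting {
    ms_atlas : atlas ch;
    ms_contact : contact_sub_riemannian ch omega g;
    ms_reeb : reeb ch omega X0;
    ms_field : magnetic_field ch omega g X0 beta;
    ms_potential : magnetic_potential ch omega g X0 beta A;
    ms_frame : forall p, exists U X1 X2,
      [/\ contact_frame ch omega g U X1 X2, U p, e1 p = X1 p & e2 p = X2 p] }.

Section VanishingForms.
Context {R : realType} {n : nat} {T : topologicalType}.
Variable ch : charted R n T.
Hypothesis atl : atlas ch.

Lemma derive_fun_in_0 (V : set T) (f : T -> R) p u : open V -> V p ->
  (forall q, V q -> f q = 0) -> 'D_u (fun_in ch p f) (cmap (ch p) p) = 0.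
Proof.
move=> oV Vp f0; have pp := cdom_self atl p.
rewrite -[RHS](derive_cst (0 : R) (cmap (ch p) p) u).
apply: near_eq_derive; apply: filterS (cinv_near atl pp oV Vp) => y [_ h _].
by rewrite /fun_in f0.
Qed.

(** In Cartan's formula the two derivative terms differentiate functions that vanish identically on
    [V]. *)
Lemma bracket_annihilated (V : set T) (a : T -> 'cV[R]_n) (X Y : T -> 'rV[R]_n) p :
  open V -> V p -> differentiable (cov_in ch p a) (cmap (ch p) p) ->
  smooth_vec ch V X -> smooth_vec ch V Y ->
  (forall q, V q -> pairing (a q) (X q) = 0) -> (forall q, V q -> pairing (a q) (Y q) = 0) ->
  pairing (a p) (lie_bracket ch X Y p) = - form2 (dform1 ch a p) (X p) (Y p).
Proof.
move=> oV Vp da sX sY aX aY; have pp := cdom_self atl p.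
have dX := smooth_vec_diff sX Vp pp; have dY := smooth_vec_diff sY Vp pp.
have := dform1_cartan atl da dX dY.
rewrite (derive_fun_in_0 (X p) oV Vp aY) (derive_fun_in_0 (Y p) oV Vp aX) subr0 sub0r => ->.
by rewrite opprK.
Qed.

Lemma flag_pos (E : T -> set 'rV[R]_n) U k X : flag ch E U k X -> (0 < k)%N.
Proof. by elim. Qed.

(** Inclusions and brackets cannot end at level 1, since levels are positive; sums and multiples
    remain. A linear condition [P] implied by [E] is carried along because [E] is just a set of
    vectors at each point. *)
Lemma flag1_section (E : T -> set 'rV[R]_n) U X (P : T -> 'rV[R]_n -> Prop) : open U ->
  (forall p u, E p u -> P p u) -> (forall p u v, P p u -> P p v -> P p (u + v)) ->
  (forall p c u, P p u -> P p (c *: u)) ->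
  flag ch E U 1 X -> smooth_vec ch U X /\ forall p, U p -> P p (X p).
Proof.
move=> oU EP PD PZ; move eq1: 1%N => k fl; elim: fl eq1 => {k X}.
- by move=> X sX EX _; split=> // p Up; exact/EP/EX.
- by move=> k X fl _ [] k0; move: (flag_pos fl); rewrite -k0.
- by move=> k X Y _ _ fl _ [] k0; move: (flag_pos fl); rewrite -k0.
- move=> k X Y _ IHX _ IHY k1; have [sX PX] := IHX k1; have [sY PY] := IHY k1.
  by split=> [|p Up]; [exact: smooth_vecD|exact: PD (PX p Up) (PY p Up)].
- move=> k f X sf _ IHX k1; have [sX PX] := IHX k1.
  by split=> [|p Up]; [exact: smooth_vecZ|exact: PZ (PX p Up)].
Qed.

End VanishingForms.

(** * The two forms that cut out the lifted distribution, and its step *)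

Section LiftedGeometry.
Context {R : realType} {M : topologicalType} {ch : charted R 3 M}.
Context {omega : M -> 'cV[R]_3} {g : M -> 'M[R]_3} {X0 : M -> 'rV[R]_3}.
Context {beta : M -> 'M[R]_3} {A : M -> 'cV[R]_3} {e1 e2 : M -> 'rV[R]_3}.
Hypothesis S : magnetic_setting ch omega g X0 beta A e1 e2.
Notation F := (contact_frame ch omega g).
Notation chbar := (times_line ch).
Notation Fbar := (lift_frames A F).
Notation Dbar := (frame_span Fbar).
Notation alpha := (rumin_potential ch omega A e1 e2).
Implicit Types z : M * R.

(* The form dw - alpha, where d alpha = beta; its differential is -beta. *)
Definition eta_form : M * R -> 'cV[R]_(3 + 1) := lift_cov (fun p => - alpha p) 1.
Definition omega_bar : M * R -> 'cV[R]_(3 + 1) := lift_cov omega 0.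

Lemma pairing_col_row n (a : 'cV[R]_n) (c : R) (u : 'rV[R]_n) (d : R) :
  pairing (col_mx a c%:M) (row_mx u d%:M) = pairing a u + d * c.
Proof.
rewrite /pairing mul_row_col mxE; congr (_ + _).
by rewrite mul_scalar_mx mxE mxE eqxx mulr1n.
Qed.

Lemma row_mx_split n (v : 'rV[R]_(n + 1)) : exists d, v = row_mx (lsubmx v) d%:M.
Proof.
exists (rsubmx v 0 0); rewrite -{1}(hsubmxK v); congr (row_mx _ _).
exact: mx11_scalar.
Qed.

Lemma omega_bar_pairing z v : pairing (omega_bar z) v = pairing (omega z.1) (lsubmx v).
Proof.
have [d ->] := row_mx_split v.
by rewrite /omega_bar /lift_cov pairing_col_row row_mxKl mulr0 addr0.
Qed.

Lemma eta_lift_vec X z : pairing (omega z.1) (X z.1) = 0 ->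
  pairing (eta_form z) (lift_vec A X z) = 0.
Proof.
move=> h; rewrite /eta_form /lift_cov /lift_vec pairing_col_row mulr1.
by rewrite pairingNl /rumin_potential pairingDl pairingZl h mulr0 addr0 addNr.
Qed.

Lemma lsubmx_lift_vec X z : lsubmx (lift_vec A X z) = X z.1.
Proof. exact: row_mxKl. Qed.

Lemma lift_frame_kernel V Y1 Y2 z : Fbar V Y1 Y2 -> V z ->
  [/\ pairing (eta_form z) (Y1 z) = 0, pairing (eta_form z) (Y2 z) = 0,
      pairing (omega_bar z) (Y1 z) = 0 & pairing (omega_bar z) (Y2 z) = 0].
Proof.
move=> [U [X1 [X2 [FU -> -> ->]]]] [Uz _]; have [_ _ _ H] := FU.
have [[k1 k2] _ _ _ _] := H z.1 Uz.
rewrite !omega_bar_pairing !lsubmx_lift_vec; split=> //; exact: eta_lift_vec.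
Qed.

Lemma frame_at p : exists U X1 X2, F U X1 X2 /\ U p.
Proof. by have [U [X1 [X2 [FU Up _ _]]]] := ms_frame S p; exists U, X1, X2. Qed.

Lemma open_times_line (U : set M) : open U -> open (U `*` [set: R]).
Proof.
move=> oU; have -> : U `*` [set: R] = fst @^-1` U by apply/seteqP; split=> z //= [].
by apply: open_comp => // z _; exact: cvg_fst.
Qed.

Lemma lift_frame_smooth V Y1 Y2 : Fbar V Y1 Y2 ->
  [/\ open V, smooth_vec chbar V Y1 & smooth_vec chbar V Y2].
Proof.
move=> [U [X1 [X2 [[oU s1 s2 _] -> -> ->]]]]; have [[sA _] _] := ms_potential S.
have sAU : smooth_cov ch U A by move=> p; apply: smooth_sub (sA p) => y [q [pq _] qy]; exists q.
split; first exact: open_times_line.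
- exact (smooth_lift_vec (ms_atlas S) oU sAU s1).
- exact (smooth_lift_vec (ms_atlas S) oU sAU s2).
Qed.

Lemma alpha_smooth U X1 X2 : F U X1 X2 -> smooth_cov ch U alpha.
Proof.
exact: (rumin_potential_smooth (ms_atlas S) (ms_contact S) (ms_reeb S) (ms_frame S) (ms_potential S)).
Qed.

Lemma eta_smooth U X1 X2 : F U X1 X2 -> smooth_cov chbar (U `*` setT) eta_form.
Proof.
move=> FU; have [oU _ _ _] := FU.
exact (smooth_lift_cov (ms_atlas S) 1 oU (smooth_covN (ms_atlas S) oU (alpha_smooth FU))).
Qed.

Lemma omega_bar_smooth U : open U -> smooth_cov chbar (U `*` setT) omega_bar.
Proof.
move=> oU; have [so _ _ _ _] := ms_contact S.
apply (smooth_lift_cov (ms_atlas S) 0 oU) => p.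
by apply: smooth_sub (so p) => y [q [pq _] qy]; exists q.
Qed.

Lemma eta_diff z0 z : cdom (chbar z0) z ->
  differentiable (cov_in chbar z0 eta_form) (cmap (chbar z0) z).
Proof.
move=> zz; have [U [X1 [X2 [FU Uz]]]] := frame_at z.1.
by apply: (smooth_cov_diff (eta_smooth FU) _ zz).
Qed.

Lemma omega_bar_diff z0 z : cdom (chbar z0) z ->
  differentiable (cov_in chbar z0 omega_bar) (cmap (chbar z0) z).
Proof. by move=> zz; apply: (smooth_cov_diff (omega_bar_smooth openT) _ zz). Qed.

Lemma dform1_eta z u v :
  form2 (dform1 chbar eta_form z) u v = - form2 (beta z.1) (lsubmx u) (lsubmx v).
Proof.
have atl := ms_atlas S; have [U [X1 [X2 [FU Uz]]]] := frame_at z.1; have [oU _ _ _] := FU.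
have sa := alpha_smooth FU.
have da := smooth_cov_diff sa Uz (cdom_self atl z.1).
have dn := smooth_cov_diff (smooth_covN atl oU sa) Uz (cdom_self atl z.1).
have zz : cdom (chbar z) z by exact: cdom_self (times_line_atlas atl) z.
rewrite /eta_form (dform1_lift_cov atl _ _ dn (eta_diff zz)) (dform1N da).
rewrite (dform1_rumin_potential (ms_atlas S) (ms_contact S) (ms_reeb S) (ms_frame S) (ms_potential S)).
by rewrite -scaleN1r form2ZB mulN1r.
Qed.

Lemma dform1_omega_bar z u v :
  form2 (dform1 chbar omega_bar z) u v = form2 (dform1 ch omega z.1) (lsubmx u) (lsubmx v).
Proof.
have atl := ms_atlas S; have [so _ _ _ _] := ms_contact S.
have zz : cdom (chbar z) z by exact: cdom_self (times_line_atlas atl) z.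
have d0 := smooth_cov_diff so (I : [set: M] z.1) (cdom_self atl z.1).
exact (dform1_lift_cov atl u v d0 (omega_bar_diff zz)).
Qed.

Lemma eta_bracket V Y Y' z : open V -> V z -> smooth_vec chbar V Y -> smooth_vec chbar V Y' ->
  (forall z', V z' -> pairing (eta_form z') (Y z') = 0) ->
  (forall z', V z' -> pairing (eta_form z') (Y' z') = 0) ->
  pairing (eta_form z) (lie_bracket chbar Y Y' z) =
  form2 (beta z.1) (lsubmx (Y z)) (lsubmx (Y' z)).
Proof.
move=> oV Vz sY sY' h h'; have zz := cdom_self (times_line_atlas (ms_atlas S)) z.
rewrite (bracket_annihilated (times_line_atlas (ms_atlas S)) oV Vz (eta_diff zz) sY sY' h h').
by rewrite dform1_eta opprK.
Qed.

Lemma omega_bar_bracket V Y Y' z : open V -> V z -> smooth_vec chbar V Y -> smooth_vec chbar V Y' ->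
  (forall z', V z' -> pairing (omega_bar z') (Y z') = 0) ->
  (forall z', V z' -> pairing (omega_bar z') (Y' z') = 0) ->
  pairing (omega_bar z) (lie_bracket chbar Y Y' z) =
  - form2 (dform1 ch omega z.1) (lsubmx (Y z)) (lsubmx (Y' z)).
Proof.
move=> oV Vz sY sY' h h'; have zz := cdom_self (times_line_atlas (ms_atlas S)) z.
rewrite (bracket_annihilated (times_line_atlas (ms_atlas S)) oV Vz (omega_bar_diff zz) sY sY' h h').
by rewrite dform1_omega_bar.
Qed.

Lemma beta_horizontal p u v : pairing (omega p) u = 0 -> pairing (omega p) v = 0 ->
  form2 (beta p) u v = 0.
Proof.
move=> ou ov; have [U [X1 [X2 [FU Up]]]] := frame_at p.
have [_ _ ->] := magnetic_field_frame (ms_atlas S) (ms_reeb S) (ms_field S) FU; last exact: Up.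
by rewrite ou ov !mul0r subrr.
Qed.

Lemma flag1_kernel V X z : open V -> flag chbar Dbar V 1 X -> V z ->
  [/\ smooth_vec chbar V X, pairing (eta_form z) (X z) = 0 & pairing (omega_bar z) (X z) = 0].
Proof.
move=> oV fl Vz.
have [|||sX H] := @flag1_section _ _ _ chbar (times_line_atlas (ms_atlas S)) Dbar V X
  (fun z u => pairing (eta_form z) u = 0 /\ pairing (omega_bar z) u = 0) oV _ _ _ fl.
- move=> p u [U [Y1 [Y2 [FU Up [u1 [u2 ->]]]]]].
  have [h1 h2 h3 h4] := lift_frame_kernel FU Up.
  by rewrite !pairingDr !pairingZr h1 h2 h3 h4 !mulr0 addr0.
- by move=> p u v [h1 h2] [h3 h4]; rewrite !pairingDr h1 h2 h3 h4 addr0.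
- by move=> p c u [h1 h2]; rewrite !pairingZr h1 h2 !mulr0.
by have [h1 h2] := H z Vz.
Qed.

(** On a bracket of two horizontal fields eta takes the value of beta on their projections, and beta
    vanishes on pairs of horizontal vectors. *)
Lemma flag2_kernel V X z : open V -> flag chbar Dbar V 2 X -> V z -> pairing (eta_form z) (X z) = 0.
Proof.
move=> oV fl; have [k k2] : exists k, 2%N = k by exists 2%N.
have {fl} : flag chbar Dbar V k X by rewrite -k2.
move=> fl; elim: fl k2 z => {k X} //.
- by move=> k X fl _ [] k1 z Vz; subst k; have [_ ->] := flag1_kernel oV fl Vz.
- move=> k X Y flX _ flY _ [] k1 z Vz; subst k.
  have [sX _ oX] := flag1_kernel oV flX Vz; have [sY _ oY] := flag1_kernel oV flY Vz.
  rewrite (eta_bracket oV Vz sX sY); last 2 first.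
  + by move=> z' Vz'; have [] := flag1_kernel oV flX Vz'.
  + by move=> z' Vz'; have [] := flag1_kernel oV flY Vz'.
  by apply: beta_horizontal; rewrite -omega_bar_pairing.
- by move=> k X Y _ IHX _ IHY k2 z Vz; rewrite pairingDr IHX ?IHY ?addr0.
- by move=> k f X _ _ IHX k2 z Vz; rewrite pairingZr IHX ?mulr0.
Qed.

Lemma eta_vertical z : pairing (eta_form z) (row_mx 0 1%:M) = 1.
Proof. by rewrite /eta_form /lift_cov pairing_col_row /pairing mul0mx mxE add0r mulr1. Qed.

(** The vertical vector d/dw has eta-value 1, so it never belongs to the second layer; this holds at
    every point of the product. *)
Lemma step_gt2 z j : (0 < j < 3)%N -> flag_at chbar Dbar j z <> setT.
Proof.
move=> j3 /seteqP[_ /(_ (row_mx 0 1%:M) I) [U [X [oU Uz fl XE]]]].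
have fl2 : flag chbar Dbar U 2 X.
  by case: j j3 fl => [|[|[|j]]] // _ fl; exact: flag_incl.
have := flag2_kernel oU fl2 Uz; rewrite XE eta_vertical => /eqP.
by rewrite oner_eq0.
Qed.

(** The projection of [v] is horizontal and expands in the frame. Subtracting the same combination
    of lifts leaves a vertical vector killed by eta, that is, zero. *)
Lemma lift_span U X1 X2 z v : F U X1 X2 -> U z.1 ->
  pairing (eta_form z) v = 0 -> pairing (omega_bar z) v = 0 ->
  exists a1 a2, v = a1 *: lift_vec A X1 z + a2 *: lift_vec A X2 z.
Proof.
move=> FU Uz ev ov; rewrite omega_bar_pairing in ov.
have E := frame_pairing (ms_reeb S) FU Uz ov.
set a1 := pairing _ _ in E; set a2 := pairing _ _ in E.
exists a1, a2; have [d vE] := row_mx_split v.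
have [_ _ _ H] := FU; have [[h1 h2] _ _ _ _] := H z.1 Uz.
pose w := v - (a1 *: lift_vec A X1 z + a2 *: lift_vec A X2 z).
have ew : pairing (eta_form z) w = 0.
  by rewrite pairingBr pairingDr !pairingZr ev !eta_lift_vec // !mulr0 addr0 subrr.
have lw : lsubmx w = 0.
  rewrite /w linearB linearD !linearZ /= !lsubmx_lift_vec -E subrr //.
have [d' wE] := row_mx_split w; rewrite lw in wE.
have d'0 : d' = 0.
  move: ew; rewrite wE /eta_form /lift_cov pairing_col_row.
  by rewrite /pairing mul0mx mxE add0r mulr1.
have : w = 0.
  rewrite wE d'0; apply/rowP => i; rewrite !mxE; case: (fintype.split i) => k; rewrite !mxE //.
  by rewrite mul0rn.
by move/eqP; rewrite subr_eq0 => /eqP.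
Qed.

Lemma flag3_full z : beta z.1 != 0 -> flag_at chbar Dbar 3 z = setT.
Proof.
move=> bz; apply/seteqP; split=> // v _.
have [U [X1 [X2 [FU Uz]]]] := frame_at z.1; have [oU _ _ H] := FU.
pose Y1 := lift_vec A X1; pose Y2 := lift_vec A X2; pose V := U `*` [set: R].
have FV : Fbar V Y1 Y2 by exists U, X1, X2.
have [oV s1 s2] := lift_frame_smooth FV.
have Vz : V z by [].
have atlb := times_line_atlas (ms_atlas S).
pose Y12 := lie_bracket chbar Y1 Y2.
have s12 : smooth_vec chbar V Y12 by exact: smooth_vec_bracket.
have k1 z' : V z' -> pairing (eta_form z') (Y1 z') = 0 by move=> Vz'; have [] := lift_frame_kernel FV Vz'.
have k2 z' : V z' -> pairing (eta_form z') (Y2 z') = 0 by move=> Vz'; have [] := lift_frame_kernel FV Vz'.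
have k3 z' : V z' -> pairing (omega_bar z') (Y1 z') = 0 by move=> Vz'; have [] := lift_frame_kernel FV Vz'.
have k4 z' : V z' -> pairing (omega_bar z') (Y2 z') = 0 by move=> Vz'; have [] := lift_frame_kernel FV Vz'.
have e12 z' : V z' -> pairing (eta_form z') (Y12 z') = 0.
  move=> Vz'; rewrite (eta_bracket oV Vz' s1 s2 k1 k2).
  by apply: beta_horizontal; rewrite -omega_bar_pairing; [exact: k3|exact: k4].
have o12 z' : V z' -> pairing (omega_bar z') (Y12 z') = 1.
  move=> Vz'; rewrite (omega_bar_bracket oV Vz' s1 s2 k3 k4) /Y1 /Y2 !lsubmx_lift_vec.
  by case: Vz' => Uz' _; have [_ _ _ _ ->] := H z'.1 Uz'.
have fl1 : flag chbar Dbar V 1 Y1.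
  apply: flag_base => // z' Vz'; exists V, Y1, Y2; split=> //; exists 1, 0.
  by rewrite scale1r scale0r addr0.
have fl2 : flag chbar Dbar V 1 Y2.
  apply: flag_base => // z' Vz'; exists V, Y1, Y2; split=> //; exists 0, 1.
  by rewrite scale1r scale0r add0r.
have fl12 : flag chbar Dbar V 2 Y12 by exact: flag_bracket.
have [Y3 [fl3 e3]] : exists Y3, flag chbar Dbar V 3 Y3 /\ pairing (eta_form z) (Y3 z) != 0.
  have q0 := magnetic_field_neq0 (ms_atlas S) (ms_reeb S) (ms_field S) FU Uz bz.
  (* The projection of [Y12] has omega-value 1, hence differs from X0 by a horizontal vector, on
     which beta against another horizontal vector gives nothing. *)
  have bracketE X Y : smooth_vec chbar V Y -> (forall z', V z' -> pairing (eta_form z') (Y z') = 0) ->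
     Y = lift_vec A X -> pairing (omega z.1) (X z.1) = 0 ->
     pairing (eta_form z) (lie_bracket chbar Y Y12 z) = field_coef X0 beta z.1 (X z.1).
    move=> sY kY YE oX; rewrite (eta_bracket oV Vz sY s12 kY e12) YE lsubmx_lift_vec.
    have := o12 z Vz; rewrite omega_bar_pairing => oY12.
    have [oX0 _] := ms_reeb S z.1.
    rewrite -[lsubmx _](subrK (X0 z.1)) form2Dr beta_horizontal ?add0r //.
    by rewrite pairingBr oY12 oX0 subrr.
  have [[h1 h2] _ _ _ _] := H z.1 Uz.
  have [b1|b1] := eqVneq (field_coef X0 beta z.1 (X1 z.1)) 0.
    exists (lie_bracket chbar Y2 Y12); split; first exact: flag_bracket.
    rewrite (bracketE X2 Y2) //; apply: contraTneq q0 => b2.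
    by rewrite b1 b2 expr0n addr0 ltxx.
  exists (lie_bracket chbar Y1 Y12); split; first exact: flag_bracket.
  by rewrite (bracketE X1 Y1).
(* Triangular elimination: [Y3] removes the eta-component, [Y12] then removes the omega-component
   without disturbing eta, and the remainder lies in the lifted distribution. *)
pose c4 := pairing (eta_form z) v / pairing (eta_form z) (Y3 z).
pose v1 := v - c4 *: Y3 z.
have ev1 : pairing (eta_form z) v1 = 0 by rewrite pairingBr pairingZr divfK // subrr.
pose c3 := pairing (omega_bar z) v1; pose v2 := v1 - c3 *: Y12 z.
have ev2 : pairing (eta_form z) v2 = 0 by rewrite pairingBr pairingZr ev1 e12 // mulr0 subrr.
have ov2 : pairing (omega_bar z) v2 = 0 by rewrite pairingBr pairingZr o12 // mulr1 subrr.
have [a1 [a2 v2E]] := lift_span FU Uz ev2 ov2.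
exists V, (fun q => (a1 *: Y1 q + a2 *: Y2 q) + (c3 *: Y12 q + c4 *: Y3 q)); split=> //.
  have cst_smooth c := smooth_fun_cst chbar V c.
  have up X : flag chbar Dbar V 1 X -> flag chbar Dbar V 3 X.
    by move=> fl; do 2 apply: flag_incl.
  apply: flag_add; apply: flag_add.
  - exact: flag_scale (cst_smooth a1) (up _ fl1).
  - exact: flag_scale (cst_smooth a2) (up _ fl2).
  - exact: flag_scale (cst_smooth c3) (flag_incl fl12).
  - exact: flag_scale (cst_smooth c4) fl3.
by rewrite -v2E addrA /v2 subrK /v1 subrK.
Qed.

Lemma lifted_step3 z : beta z.1 != 0 -> has_step chbar Dbar z 3.
Proof. by move=> bz; split; [by []|exact: flag3_full|move=> j; exact: step_gt2]. Qed.

End LiftedGeometry.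

(** * Abnormal extremals *)

Section CovectorsAlongCurves.
Context {R : realType} {n : nat} {T : topologicalType}.
Variable ch : charted R n T.
Hypothesis atl : atlas ch.

Lemma derive_annihilated (V : set T) (a : T -> 'cV[R]_n) (X : T -> 'rV[R]_n) p w :
  open V -> V p -> differentiable (cov_in ch p a) (cmap (ch p) p) -> smooth_vec ch V X ->
  (forall q, V q -> pairing (a q) (X q) = 0) ->
  ('D_w (vec_in ch p X) (cmap (ch p) p) *m a p
   + X p *m 'D_w (cov_in ch p a) (cmap (ch p) p)) 0 0 = 0.
Proof.
move=> oV Vp da sX aX; have pp := cdom_self atl p.
apply: etrans (derive_fun_in_0 atl w oV Vp aX); apply: esym.
exact: (derive_fun_pairing atl w da (smooth_vec_diff sX Vp pp)).
Qed.

Lemma is_derive_cov_curve (a : T -> 'cV[R]_n) (c : R -> T) t v :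
  differentiable (cov_in ch (c t) a) (cmap (ch (c t)) (c t)) -> has_velocity ch c t v ->
  is_derive t 1 (fun s => trans_jac ch (c t) (c s) (c s) *m a (c s))
    ('D_v (cov_in ch (c t) a) (cmap (ch (c t)) (c t))).
Proof.
move=> da [cd dc].
apply: near_eq_is_derive (is_derive_comp da dc).
by apply: filterS cd => s cs; exact: (cov_inE atl a cs).
Qed.

Lemma momentum_velocity (c : R -> T) (zeta : R -> 'cV[R]_n) t (Y1 Y2 : T -> 'rV[R]_n) u1 u2 h1 h2 :
  differentiable (vec_in ch (c t) Y1) (cmap (ch (c t)) (c t)) ->
  differentiable (vec_in ch (c t) Y2) (cmap (ch (c t)) (c t)) ->
  hamiltonian_vector ch (momentum Y1) (c t, zeta t) h1 ->
  hamiltonian_vector ch (momentum Y2) (c t, zeta t) h2 ->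
  has_velocity (cotangent ch) (fun s => (c s, zeta s)) t (u1 *: h1 + u2 *: h2) ->
  has_velocity ch c t (u1 *: Y1 (c t) + u2 *: Y2 (c t)) /\
  exists2 xi, is_derive t 1 (fun s => trans_jac ch (c t) (c s) (c s) *m zeta s) xi &
    forall w, w *m xi =
      - (u1 *: ('D_w (vec_in ch (c t) Y1) (cmap (ch (c t)) (c t)) *m zeta t)
         + u2 *: ('D_w (vec_in ch (c t) Y2) (cmap (ch (c t)) (c t)) *m zeta t)).
Proof.
move=> d1 d2 H1 H2 /has_velocity_cotangent [hv hx].
have [l1 r1] := (hamiltonian_momentumP atl (z := (c t, zeta t)) h1 d1).1 H1.
have [l2 r2] := (hamiltonian_momentumP atl (z := (c t, zeta t)) h2 d2).1 H2.
split.
  have E : lsubmx (u1 *: h1 + u2 *: h2) = u1 *: Y1 (c t) + u2 *: Y2 (c t).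
    by apply: etrans (congr2 (fun a b => u1 *: a + u2 *: b) l1 l2); rewrite linearD !linearZ.
  by rewrite -E.
exists (rsubmx (u1 *: h1 + u2 *: h2))^T => // w.
have -> : (rsubmx (u1 *: h1 + u2 *: h2))^T = u1 *: (rsubmx h1)^T + u2 *: (rsubmx h2)^T.
  by rewrite linearD !linearZ linearD !linearZ.
rewrite mulmxDr -!scalemxAr.
apply: etrans (congr2 (fun a b => u1 *: a + u2 *: b) (r1 w) (r2 w)) _.
by rewrite opprD !scalerN.
Qed.

End CovectorsAlongCurves.

(** * The adjoint equation in terms of the two forms *)

Section AbnormalIdentity.
Context {R : realType} {M : topologicalType} {ch : charted R 3 M}.
Context {omega : M -> 'cV[R]_3} {g : M -> 'M[R]_3} {X0 : M -> 'rV[R]_3}.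
Context {beta : M -> 'M[R]_3} {A : M -> 'cV[R]_3} {e1 e2 : M -> 'rV[R]_3}.
Hypothesis S : magnetic_setting ch omega g X0 beta A e1 e2.
Notation F := (contact_frame ch omega g).
Notation chbar := (times_line ch).
Notation Fbar := (lift_frames A F).
Notation Dbar := (frame_span Fbar).
Notation eta := (@eta_form R M ch omega A e1 e2).
Notation omb := (@omega_bar R M omega).
Implicit Types z : M * R.

Definition vertical : 'rV[R]_(3 + 1) := row_mx 0 1%:M.
Definition reeb_lift z : 'rV[R]_(3 + 1) := row_mx (X0 z.1) 0.
Definition charge (zeta : 'cV[R]_(3 + 1)) : R := pairing zeta vertical.
(** With [charge] this recovers k and f from k eta + f omega: d/dw is killed by omega, and the
    lifted Reeb vector has omega-value 1. Its eta-value need not vanish, whence the subtraction. *)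
Definition multiplier z (zeta : 'cV[R]_(3 + 1)) : R :=
  pairing (zeta - charge zeta *: eta z) (reeb_lift z).

Lemma omega_bar_vertical z : pairing (omb z) vertical = 0.
Proof. by rewrite omega_bar_pairing row_mxKl /pairing mul0mx mxE. Qed.

Lemma omega_bar_reeb z : pairing (omb z) (reeb_lift z) = 1.
Proof. by rewrite omega_bar_pairing row_mxKl; have [] := ms_reeb S z.1. Qed.

(** Any test vector becomes a combination of Y1 and Y2 once suitable multiples of the lifted Reeb
    vector and of d/dw are removed, so only these two directions matter. *)
Lemma annihilator_decomposition V Y1 Y2 z zeta : Fbar V Y1 Y2 -> V z ->
  pairing zeta (Y1 z) = 0 -> pairing zeta (Y2 z) = 0 ->
  zeta = charge zeta *: eta z + multiplier z zeta *: omb z.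
Proof.
move=> [U [X1 [X2 [FU -> -> ->]]]] [Uz _] z1 z2; apply: pairing_inj => v.
set b := pairing (eta z) (reeb_lift z).
pose w := v - (pairing (omb z) v *: reeb_lift z
               + (pairing (eta z) v - pairing (omb z) v * b) *: vertical).
have ew : pairing (eta z) w = 0.
  rewrite pairingBr pairingDr !pairingZr eta_vertical mulr1 -/b.
  by rewrite [X in _ - X]addrC subrK subrr.
have ow : pairing (omb z) w = 0.
  by rewrite pairingBr pairingDr !pairingZr omega_bar_reeb omega_bar_vertical mulr0 mulr1 addr0 subrr.
have [a1 [a2 wE]] := lift_span S FU Uz ew ow.
have zw : pairing zeta w = 0 by rewrite wE pairingDr !pairingZr z1 z2 !mulr0 addr0.
move: zw; rewrite pairingBr pairingDr !pairingZr => /eqP; rewrite subr_eq0 => /eqP ->.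
rewrite pairingDl !pairingZl /multiplier pairingDl pairingNl pairingZl -/(charge zeta) -/b.
move: (pairing (omb z) v) (pairing (eta z) v) (pairing zeta _) (charge zeta) (b) => *; clear; ring.
Qed.

Lemma vertical_trans_jac z0 z : cdom (chbar z0) z ->
  vertical *m trans_jac chbar z0 z z = vertical.
Proof.
move=> zz; have atl := ms_atlas S.
rewrite (times_line_trans_jac atl zz (cdom_self atl z.1)) /vertical.
by rewrite mul_row_block !mul0mx !mulmx0 mulmx1 !add0r.
Qed.

(** Scalar bookkeeping for [abnormal_identity]. [DE] and [DO] stand for derivatives of the forms
    along the velocity, [E1] to [O2] for their derivatives in the test direction paired with Y1 or
    Y2, [dE] and [dO] for the exterior derivatives. *)
Lemma hamilton_sum (k f u1 u2 dk df xi E O DE DO E1 O1 E2 O2 Y1E Y1O Y2E Y2O Y1z Y2z dE dO : R) :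
  xi = dk * E + k * DE + (df * O + f * DO) -> xi = - (u1 * Y1z + u2 * Y2z) ->
  Y1z = k * Y1E + f * Y1O -> Y2z = k * Y2E + f * Y2O ->
  Y1E = - E1 -> Y1O = - O1 -> Y2E = - E2 -> Y2O = - O2 ->
  dE = DE - (u1 * E1 + u2 * E2) -> dO = DO - (u1 * O1 + u2 * O2) ->
  dk * E + df * O + k * dE + f * dO = 0.
Proof.
move=> -> /eqP; rewrite -subr_eq0 => /eqP + Z1 Z2 h1 h2 h3 h4 -> ->.
by rewrite Z1 Z2 h1 h2 h3 h4 => <-; ring.
Qed.

(** Derivability of the coefficients is extracted from that of the covector: k is a fixed linear
    functional of [Xi], and f is the quotient of [w0] applied to [Xi - k E] by [w0] applied to [O],
    whose denominator is 1 at [t]. *)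
Lemma is_derive_coefficients n (Xi E O : R -> 'cV[R]_n) (k f : R -> R) (t : R) (xi dE dO : 'cV[R]_n)
    (w1 w0 : 'rV[R]_n) :
  is_derive t 1 Xi xi -> is_derive t 1 E dE -> is_derive t 1 O dO ->
  (\forall s \near t, k s = (w1 *m Xi s) 0 0 /\ Xi s = k s *: E s + f s *: O s) ->
  (w0 *m O t) 0 0 = 1 ->
  exists k' f' : R, [/\ is_derive t 1 f f' &
    xi = k' *: E t + k t *: dE + (f' *: O t + f t *: dO)].
Proof.
move=> dXi dE' dO' nr O1.
have dlin (w : 'rV[R]_n) (G : R -> 'cV[R]_n) dG : is_derive t 1 G dG ->
    is_derive t 1 (fun s => (w *m G s) 0 0) ((w *m dG) 0 0).
  have dw : is_derive (t : R) (1 : R) (fun _ : R => w) 0 by exact: is_derive_cst.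
  move=> h; have /is_derive_mxP := is_derive_mulmx dw h.
  by move=> /(_ 0 0); rewrite mul0mx add0r.
have dk : is_derive t 1 k ((w1 *m xi) 0 0).
  by apply: near_eq_is_derive (dlin w1 _ _ dXi); apply: filterS nr => s [->].
pose gO s := (w0 *m O s) 0 0; have dgO : is_derive t 1 gO ((w0 *m dO) 0 0) by exact: dlin.
have gO1 : gO t = 1 by exact: O1.
have gOn0 : gO t != 0 by rewrite gO1 oner_neq0.
have dgN : is_derive t 1 (fun s => Xi s - k s *: E s)
    (xi - (((w1 *m xi) 0 0) *: E t + k t *: dE)).
  by apply: is_deriveB; exact: is_derive_scalemx.
have df : exists f', is_derive t 1 f f'.
  eexists; apply: near_eq_is_derive (is_deriveM (dlin w0 _ _ dgN) (is_deriveV gOn0 dgO)).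
  have cg : {for t, continuous gO} by apply: differentiable_continuous; apply/derivable1_diffP; case: dgO.
  have ng : \forall s \near t, gO s != 0 by exact: cvgr_neq0 cg _.
  apply: filterS (filterI ng nr) => s [gs [ks XiE]] /=.
  rewrite -[LHS]/(_ * _) XiE addrC addKr -scalemxAr mxE mulfK //.
have [f' df'] := df; exists ((w1 *m xi) 0 0), f'; split=> //.
have [_ XiE] := dXi; have H := is_deriveD (is_derive_scalemx dk dE') (is_derive_scalemx df' dO').
have [_ HE] := H; apply: etrans (esym XiE) (etrans _ HE); apply: near_eq_derive; apply: filterS nr => s [_ h]; exact: h.
Qed.

(** Hamilton's equation for k eta + f omega becomes free of coordinates once derivatives of Yi are
    traded for derivatives of the forms, by differentiating eta(Yi) = omega(Yi) = 0. The number k'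
    is left open; later test vectors are chosen in the kernel of eta. *)
Lemma abnormal_identity (c : R -> M * R) (zeta : R -> 'cV[R]_(3 + 1)) t V Y1 Y2 u1 u2 h1 h2 :
  Fbar V Y1 Y2 -> V (c t) ->
  (\forall s \near t, V (c s) -> pairing (zeta s) (Y1 (c s)) = 0 /\ pairing (zeta s) (Y2 (c s)) = 0) ->
  hamiltonian_vector chbar (momentum Y1) (c t, zeta t) h1 ->
  hamiltonian_vector chbar (momentum Y2) (c t, zeta t) h2 ->
  has_velocity (cotangent chbar) (fun s => (c s, zeta s)) t (u1 *: h1 + u2 *: h2) ->
  let v := u1 *: Y1 (c t) + u2 *: Y2 (c t) in
  has_velocity chbar c t v /\ exists k' f' : R,
  is_derive t 1 (fun s => multiplier (c s) (zeta s)) f' /\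
  forall w, k' * pairing (eta (c t)) w + f' * pairing (omb (c t)) w
    + charge (zeta t) * form2 (dform1 chbar eta (c t)) v w
    + multiplier (c t) (zeta t) * form2 (dform1 chbar omb (c t)) v w = 0.
Proof.
move=> FV Vt ann H1 H2 Hv v.
have [oV s1 s2] := lift_frame_smooth S FV.
have atlb := times_line_atlas (ms_atlas S).
have tt := cdom_self atlb (c t).
have d1 := smooth_vec_diff s1 Vt tt; have d2 := smooth_vec_diff s2 Vt tt.
have [hv [xi dxi xiE]] := momentum_velocity atlb d1 d2 H1 H2 Hv.
rewrite -/v in hv; split=> //.
have dE := is_derive_cov_curve atlb (eta_diff S tt) hv.
have dO := is_derive_cov_curve atlb (omega_bar_diff S tt) hv.
set Xi := (fun s => _ *m zeta s) in dxi.
set E := (fun s => _) in dE; set O := (fun s => _) in dO.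
set DE := 'D_v _ _ in dE; set DO := 'D_v _ _ in dO.
have cc := has_velocity_continuous atlb hv.
have nV := curve_near cc oV Vt; have [nd _] := hv.
have near_dec : \forall s \near t, [/\ charge (zeta s) = (vertical *m Xi s) 0 0 &
    Xi s = charge (zeta s) *: E s + multiplier (c s) (zeta s) *: O s].
  apply: filterS (filterI nV (filterI nd ann)) => s [Vs [ds /(_ Vs) [z1 z2]]].
  split; first by rewrite /Xi mulmxA vertical_trans_jac.
  apply: etrans (congr1 (mulmx (trans_jac chbar (c t) (c s) (c s)))
    (annihilator_decomposition FV Vs z1 z2)) _.
  by rewrite mulmxDr -!scalemxAr.
have Xit : zeta t = charge (zeta t) *: eta (c t) + multiplier (c t) (zeta t) *: omb (c t).
  by have [z1 z2] := nbhs_singleton ann Vt; exact: annihilator_decomposition FV Vt z1 z2.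
have tj1 : trans_jac chbar (c t) (c t) (c t) = 1%:M by exact: trans_jac_id.
have Et : E t = eta (c t) by rewrite /E tj1 mul1mx.
have Ot : O t = omb (c t) by rewrite /O tj1 mul1mx.
have Ot1 : (reeb_lift (c t) *m O t) 0 0 = 1 by rewrite Ot; exact: omega_bar_reeb.
have nd2 : \forall s \near t, charge (zeta s) = (vertical *m Xi s) 0 0 /\
    Xi s = charge (zeta s) *: E s + multiplier (c s) (zeta s) *: O s.
  by apply: filterS near_dec => s [].
have [k' [f' [df' xiD]]] := is_derive_coefficients dxi dE dO nd2 Ot1.
exists k', f'; split=> // w.
rewrite Et Ot in xiD.
have kEO z : V z -> [/\ pairing (eta z) (Y1 z) = 0, pairing (eta z) (Y2 z) = 0,
    pairing (omb z) (Y1 z) = 0 & pairing (omb z) (Y2 z) = 0] by move=> Vz; exact (lift_frame_kernel FV Vz).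
have derE Y : smooth_vec chbar V Y -> (forall z, V z -> pairing (eta z) (Y z) = 0) ->
    ('D_w (vec_in chbar (c t) Y) (cmap (chbar (c t)) (c t)) *m eta (c t)) 0 0 =
    - (Y (c t) *m 'D_w (cov_in chbar (c t) eta) (cmap (chbar (c t)) (c t))) 0 0.
  move=> sY kY; have := derive_annihilated atlb w oV Vt (eta_diff S tt) sY kY.
  by rewrite mxE => /eqP; rewrite addr_eq0 => /eqP.
have derO Y : smooth_vec chbar V Y -> (forall z, V z -> pairing (omb z) (Y z) = 0) ->
    ('D_w (vec_in chbar (c t) Y) (cmap (chbar (c t)) (c t)) *m omb (c t)) 0 0 =
    - (Y (c t) *m 'D_w (cov_in chbar (c t) omb) (cmap (chbar (c t)) (c t))) 0 0.
  move=> sY kY; have := derive_annihilated atlb w oV Vt (omega_bar_diff S tt) sY kY.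
  by rewrite mxE => /eqP; rewrite addr_eq0 => /eqP.
have E1 := derE Y1 s1 (fun z Vz => let: And4 h _ _ _ := kEO z Vz in h).
have E2 := derE Y2 s2 (fun z Vz => let: And4 _ h _ _ := kEO z Vz in h).
have O1 := derO Y1 s1 (fun z Vz => let: And4 _ _ h _ := kEO z Vz in h).
have O2 := derO Y2 s2 (fun z Vz => let: And4 _ _ _ h := kEO z Vz in h).
have expand (B B' : 'rV[R]_(3+1)) (C : 'cV[R]_(3+1)) :
  ((u1 *: B + u2 *: B') *m C) 0 0 = u1 * (B *m C) 0 0 + u2 * (B' *m C) 0 0.
  by rewrite mulmxDl -!scalemxAl !mxE.
have expandr (B : 'rV[R]_(3+1)) (C C' : 'cV[R]_(3+1)) (k f : R) :
  (B *m (k *: C + f *: C')) 0 0 = k * (B *m C) 0 0 + f * (B *m C') 0 0.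
  by rewrite mulmxDr -!scalemxAr !mxE.
have expand4 (B : 'rV[R]_(3 + 1)) (C1 C2 C3 C4 : 'cV[R]_(3+1)) (r1 r2 r3 r4 : R) :
  (B *m (r1 *: C1 + r2 *: C2 + (r3 *: C3 + r4 *: C4))) 0 0 =
  r1 * (B *m C1) 0 0 + r2 * (B *m C2) 0 0 + (r3 * (B *m C3) 0 0 + r4 * (B *m C4) 0 0).
  by rewrite mulmxDr mxE !expandr.
have entryB (P Q : 'M[R]_1) : (P - Q) 0 0 = P 0 0 - Q 0 0 by rewrite !mxE.
have F1 := etrans (dform1E v w (eta_diff S tt)) (etrans (entryB _ _)
  (congr1 (fun r => (w *m DE) 0 0 - r) (expand (Y1 (c t)) (Y2 (c t)) _))).
have F2 := etrans (dform1E v w (omega_bar_diff S tt)) (etrans (entryB _ _)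
  (congr1 (fun r => (w *m DO) 0 0 - r) (expand (Y1 (c t)) (Y2 (c t)) _))).
have L : (w *m xi) 0 0 = k' * pairing (eta (c t)) w + charge (zeta t) * (w *m DE) 0 0
    + (f' * pairing (omb (c t)) w + multiplier (c t) (zeta t) * (w *m DO) 0 0).
  exact: etrans (congr1 (fun C => (w *m C) 0 0) xiD) (expand4 _ _ _ _ _ _ _ _ _).
have scalar (P : 'rV[R]_(3 + 1)) : (P *m zeta t) 0 0 =
    charge (zeta t) * (P *m eta (c t)) 0 0 + multiplier (c t) (zeta t) * (P *m omb (c t)) 0 0.
  exact: etrans (congr1 (fun C => (P *m C) 0 0) Xit) (expandr P _ _ _ _).
have entryH (r s : R) (P Q : 'M[R]_1) : (- (r *: P + s *: Q)) 0 0 = - (r * P 0 0 + s * Q 0 0).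
  by rewrite !mxE.
have H := etrans (congr1 (fun N : 'M[R]_1 => N 0 0) (xiE w)) (entryH _ _ _ _).
exact (hamilton_sum L H (scalar _) (scalar _) E1 O1 E2 O2 F1 F2).
Qed.

End AbnormalIdentity.

(** * Isolated zeros and countable unions of null sets *)

Section Isolated.
Context {R : realType}.
Notation mu := (@lebesgue_measure R).

(** Near [t] the function is d (s - t) up to an error of at most |d| / 2 times |s - t|, too small to
    cancel the linear term. *)
Lemma derive_isolated_zero (f : R -> R) (t d : R) : is_derive t 1 f d -> d != 0 -> f t = 0 ->
  isolated [set s | f s = 0] t.
Proof.
move=> df d0 ft; pose D (s : R) := f s - d * s.
have dD : is_derive t 1 D 0.
  have := is_deriveB df (is_deriveM (is_derive_cst d t 1) (is_derive_id t 1)).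
  by rewrite scaler0 addr0 /GRing.scale /= mulr1 subrr.
have e0 : 0 < `|d| / 2 by rewrite divr_gt0 // normr_gt0.
have [r r0 H] := is_derive_growth dD e0.
split; first by rewrite inE.
exists [set s | `|s - t| < r]; first by apply: (near_normP _ (fun s => `|s - t| < r)).2; exists r.
apply/seteqP; split=> [s [/H] /= + fs|s /= ->]; last by rewrite subrr normr0.
rewrite /D fs ft !sub0r normr0 add0r opprK addrC -mulrBr normrM distrC => h.
apply/eqP; rewrite -subr_eq0 -normr_eq0; apply/negPn/negP => st0.
move: h; rewrite -subr_ge0 -mulrBl pmulr_lge0; last by rewrite lt_neqAle eq_sym st0 normr_ge0.
by rewrite subr_ge0; apply/negP; rewrite -ltNge ltr_pdivrMr // ltr_pMr ?ltr1n // normr_gt0.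
Qed.

Lemma negligible_countable_bigcup (I : Type) (D : set I) (G : I -> set R) : countable D ->
  (forall i, D i -> mu.-negligible (G i)) -> mu.-negligible (\bigcup_(i in D) G i).
Proof.
move=> /countable_injP [f finj] nG.
have sub : \bigcup_(i in D) G i `<=` \bigcup_k \bigcup_(i in [set i | D i /\ f i = k]) G i.
  by move=> t [i Di Gt]; exists (f i) => //; exists i.
apply: (@negligibleS _ _ _ mu _ _ sub); apply: negligible_bigcup => k.
have [[i [Di fi]]|nD] := pselect (exists i, D i /\ f i = k).
  apply: (@negligibleS _ _ _ mu (G i)) (nG i Di) => t [j [Dj fj]].
  by have -> : j = i by apply: finj; rewrite ?inE // fj fi.
by apply: (@negligibleS _ _ _ mu set0) (negligible_set0 mu) => t [j Dj _]; case: nD; exists j.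
Qed.

Lemma negligible_countable (S : set R) : countable S -> mu.-negligible S.
Proof.
move=> cS; have := negligible_countable_bigcup (G := fun x => [set x]) cS.
rewrite bigcup_imset1 image_id; apply=> i _.
by exists [set i]; split=> //; exact: lebesgue_measure_set1.
Qed.

End Isolated.

(** * Projections of abnormal trajectories *)

Section AbnormalProjection.
Context {R : realType} {M : topologicalType} {ch : charted R 3 M}.
Context {omega : M -> 'cV[R]_3} {g : M -> 'M[R]_3} {X0 : M -> 'rV[R]_3}.
Context {beta : M -> 'M[R]_3} {A : M -> 'cV[R]_3} {e1 e2 : M -> 'rV[R]_3}.
Hypothesis S : magnetic_setting ch omega g X0 beta A e1 e2.
Notation F := (contact_frame ch omega g).
Notation chbar := (times_line ch).
Notation Fbar := (lift_frames A F).
Notation eta := (@eta_form R M ch omega A e1 e2).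
Notation omb := (@omega_bar R M omega).
Notation charge := (@charge R).
Notation multiplier := (@multiplier R M ch omega X0 A e1 e2).
Notation mu := (@lebesgue_measure R).

Lemma eta_lift z (u : 'rV[R]_3) :
  pairing (eta z) (row_mx u (pairing (rumin_potential ch omega A e1 e2 z.1) u)%:M) = 0.
Proof. by rewrite /eta_form /lift_cov pairing_col_row pairingNl mulr1 addNr. Qed.

Lemma lsubmx_frame_comb (X1 X2 : M -> 'rV[R]_3) z (u1 u2 : R) :
  lsubmx (u1 *: lift_vec A X1 z + u2 *: lift_vec A X2 z) = u1 *: X1 z.1 + u2 *: X2 z.1.
Proof. by rewrite linearD !linearZ /= !lsubmx_lift_vec. Qed.

(* Where the multiplier is nonzero the controls vanish; at a non-isolated zero its derivative
   charge * beta(v, X0) vanishes too. *)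
Lemma abnormal_velocity (c : R -> M * R) (zeta : R -> 'cV[R]_(3 + 1)) t V Y1 Y2 u1 u2 h1 h2 :
  Fbar V Y1 Y2 -> V (c t) ->
  (\forall s \near t, V (c s) -> pairing (zeta s) (Y1 (c s)) = 0 /\ pairing (zeta s) (Y2 (c s)) = 0) ->
  hamiltonian_vector chbar (momentum Y1) (c t, zeta t) h1 ->
  hamiltonian_vector chbar (momentum Y2) (c t, zeta t) h2 ->
  has_velocity (cotangent chbar) (fun s => (c s, zeta s)) t (u1 *: h1 + u2 *: h2) ->
  zeta t != 0 -> ~ isolated [set s | multiplier (c s) (zeta s) = 0] t ->
  forall w, form2 (beta (c t).1) (lsubmx (u1 *: Y1 (c t) + u2 *: Y2 (c t))) w = 0.
Proof.
move=> FV Vt ann H1 H2 Hv z0 niso w.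
have [_ [k' [f' [df' Id]]]] := abnormal_identity S FV Vt ann H1 H2 Hv.
have [z1 z2] := nbhs_singleton ann Vt.
have zE := annihilator_decomposition S FV Vt z1 z2.
have [ky1 ky2 kO1 kO2] := lift_frame_kernel (e1 := e1) (e2 := e2) FV Vt.
set v := u1 *: _ + _ in Id *.
have ov : pairing (omega (c t).1) (lsubmx v) = 0.
  by rewrite -omega_bar_pairing /v pairingDr !pairingZr kO1 kO2 !mulr0 addr0.
have [m0|m0] := eqVneq (multiplier (c t) (zeta t)) 0.
  have f'0 : f' = 0.
    by apply/eqP/negPn/negP => f'0; apply: niso; exact: derive_isolated_zero df' f'0 m0.
  have k0 : charge (zeta t) != 0.
    by apply: contra_neq z0 => k0; rewrite zE k0 m0 !scale0r addr0.
  (* An arbitrary vector [w] of [M] is lifted into the kernel of eta, which removes the term with k'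
     and leaves charge times beta. *)
  have := Id (row_mx w (pairing (rumin_potential ch omega A e1 e2 (c t).1) w)%:M).
  rewrite eta_lift f'0 m0 !mul0r mulr0 !add0r addr0 (dform1_eta S) row_mxKl => /eqP.
  by rewrite mulf_eq0 (negPf k0) oppr_eq0 => /eqP.
have [U [X1 [X2 [FU VE Y1E Y2E]]]] := FV.
have Ut : U (c t).1 by move: Vt; rewrite VE => -[].
have [_ _ _ frame] := FU; have [[kX1 kX2] _ _ _ d12] := frame _ Ut.
have d21 : form2 (dform1 ch omega (c t).1) (X2 (c t).1) (X1 (c t).1) = 1.
  by rewrite (form2_anti _ _ (dform1_anti _ _ _)).
have d12' : form2 (dform1 ch omega (c t).1) (X1 (c t).1) (X2 (c t).1) = -1.
  by rewrite -d12 opprK.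
have dd u : form2 (dform1 ch omega (c t).1) u u = 0 by exact: form2_diag (dform1_anti _ _ _).
have vE : lsubmx v = u1 *: X1 (c t).1 + u2 *: X2 (c t).1.
  by rewrite /v Y1E Y2E lsubmx_frame_comb.
have last_term (k1 k2 k m r1 r2 r3 r4 r5 : R) : r1 = 0 -> r2 = 0 -> r3 = 0 -> r4 = r5 ->
    k1 * r1 + k2 * r2 + k * r3 + m * r4 = 0 -> m * r5 = 0.
  by move=> -> -> -> ->; rewrite !mulr0 !add0r.
have bv X : pairing (omega (c t).1) (X (c t).1) = 0 ->
    form2 (dform1 chbar eta (c t)) v (lift_vec A X (c t)) = 0.
  move=> oX; apply: etrans (dform1_eta S _ _ _) _; rewrite lsubmx_lift_vec.
  by rewrite (beta_horizontal S ov oX) oppr0.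
have dv X : form2 (dform1 chbar omb (c t)) v (lift_vec A X (c t)) =
    u1 * form2 (dform1 ch omega (c t).1) (X1 (c t).1) (X (c t).1)
    + u2 * form2 (dform1 ch omega (c t).1) (X2 (c t).1) (X (c t).1).
  apply: etrans (dform1_omega_bar S _ _ _) _.
  by rewrite lsubmx_lift_vec vE form2Dl !form2Zl.
subst Y1 Y2.
have I1 := last_term _ _ _ _ _ _ _ _ _ ky1 kO1 (bv X1 kX1) (dv X1) (Id _).
have I2 := last_term _ _ _ _ _ _ _ _ _ ky2 kO2 (bv X2 kX2) (dv X2) (Id _).
rewrite dd d21 mulr0 add0r mulr1 in I1.
rewrite dd d12' mulr0 addr0 in I2.
move/eqP: I1; rewrite mulf_eq0 (negPf m0) => /eqP u20.
move/eqP: I2; rewrite mulf_eq0 (negPf m0) mulrN1 oppr_eq0 => /eqP u10.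
by rewrite vE u10 u20 !scale0r addr0 /form2 mul0mx mul0mx mxE.
Qed.

(** The exceptional set of the hypothesis depends on the frame, and frames are uncountably many. A
    countable basis reduces them to one frame per basic open set. The end points are discarded so
    that zeta annihilates the frame at all nearby times. *)
Lemma abnormal_velocity_ae (a b : R) (c : R -> M * R) (zeta : R -> 'cV[R]_(3 + 1)) :
  @second_countable M ->
  (forall t, a <= t <= b -> zeta t != 0) ->
  (forall V Y1 Y2, Fbar V Y1 Y2 ->
    (forall t, a <= t <= b -> V (c t) ->
       pairing (zeta t) (Y1 (c t)) = 0 /\ pairing (zeta t) (Y2 (c t)) = 0) /\
    {ae mu, forall t, a <= t <= b -> V (c t) ->
       exists u1 u2 h1 h2,
       [/\ has_velocity chbar c t (u1 *: Y1 (c t) + u2 *: Y2 (c t)),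
           hamiltonian_vector chbar (momentum Y1) (c t, zeta t) h1,
           hamiltonian_vector chbar (momentum Y2) (c t, zeta t) h2 &
           has_velocity (cotangent chbar) (fun s => (c s, zeta s)) t
             (u1 *: h1 + u2 *: h2)]}) ->
  exists2 N : set R, mu.-negligible N & forall t, a <= t <= b -> ~ N t ->
    a < t < b /\
    exists U X1 X2 u1 u2, [/\ F U X1 X2, U (c t).1,
      has_velocity chbar c t (u1 *: lift_vec A X1 (c t) + u2 *: lift_vec A X2 (c t)) &
      forall w, form2 (beta (c t).1) (u1 *: X1 (c t).1 + u2 *: X2 (c t).1) w = 0].
Proof.
move=> [B cB [Bo Bb]] z0 H.
pose good X1 X2 t := exists u1 u2 h1 h2,
  [/\ has_velocity chbar c t (u1 *: lift_vec A X1 (c t) + u2 *: lift_vec A X2 (c t)),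
      hamiltonian_vector chbar (momentum (lift_vec A X1)) (c t, zeta t) h1,
      hamiltonian_vector chbar (momentum (lift_vec A X2)) (c t, zeta t) h2 &
      has_velocity (cotangent chbar) (fun s => (c s, zeta s)) t (u1 *: h1 + u2 *: h2)].
(* A time is bad for [W] only if every frame whose domain contains [W] fails there, so the null set
   of a single such frame covers all bad times spent over [W]. *)
pose bad W := [set t | a <= t <= b /\ forall U X1 X2, F U X1 X2 -> W `<=` U ->
  U (c t).1 -> ~ good X1 X2 t].
pose D := [set W | B W /\ exists U X1 X2, F U X1 X2 /\ W `<=` U].
pose bad0 W := bad W `&` [set t | W (c t).1].
pose iso := isolated [set s | multiplier (c s) (zeta s) = 0].
exists ([set a] `|` [set b] `|` iso `|` \bigcup_(W in D) bad0 W).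
  apply: negligibleU; first apply: negligibleU; first apply: negligibleU.
  - by apply: negligible_countable; exact: countable1.
  - by apply: negligible_countable; exact: countable1.
  - by apply: negligible_countable; exact: countable_isolated.
  apply: negligible_countable_bigcup.
    by apply: sub_countable cB; apply: subset_card_le => W [].
  move=> W [BW [U [X1 [X2 [FU WU]]]]].
  have FV : Fbar (U `*` setT) (lift_vec A X1) (lift_vec A X2) by exists U, X1, X2.
  have [_ ae] := H _ _ _ FV; apply: negligibleS ae => t [[tab nt] Wt] /= Ht.
  apply: (nt U X1 X2 FU WU (WU _ Wt)); apply: Ht => //; split=> //; exact: WU.
move=> t tab nN.
have ta : t <> a by move=> ta; apply: nN; do 3 left.
have tb : t <> b by move=> tb; apply: nN; do 2 left; right.
have ab : a < t < b.
  case/andP: tab => h1 h2; rewrite !lt_neqAle h1 h2 !andbT eq_sym.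
  by apply/andP; split; apply/eqP.
split=> //.
have niso : ~ iso t by move=> h; apply: nN; left; right.
have [U0 [X1 [X2 [FU0 U0t]]]] := frame_at S (c t).1; have [oU0 _ _ _] := FU0.
have [W [BW Wt] WU0] := Bb (c t).1 U0 (open_nbhs_nbhs (conj oU0 U0t)).
have [U [X1' [X2' [FU WU [u1 [u2 [h1 [h2 [hv H1 H2 Hv]]]]]]]]] : exists U X1 X2,
    [/\ F U X1 X2, W `<=` U & good X1 X2 t].
  apply: contrapT => nex; apply: nN; right; exists W.
    by split=> //; exists U0, X1, X2.
  split=> //; split=> // U X1' X2' FU WU Ut gt; apply: nex; exists U, X1', X2'; split=> //.
have FV : Fbar (U `*` setT) (lift_vec A X1') (lift_vec A X2') by exists U, X1', X2'.
have Vt : (U `*` [set: R]) (c t) by split=> //; exact: WU.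
have [ann _] := H _ _ _ FV.
have nann : \forall s \near t, (U `*` [set: R]) (c s) ->
    pairing (zeta s) (lift_vec A X1' (c s)) = 0 /\ pairing (zeta s) (lift_vec A X2' (c s)) = 0.
  case/andP: ab => at' tb'.
  have n1 : \forall s \near t, a < s by exact: lt_nbhsr.
  have n2 : \forall s \near t, s < b by exact: lt_nbhsl.
  apply: filterS (filterI n1 n2) => s [h3 h4] Vs; apply: ann => //.
  by rewrite !ltW.
exists U, X1', X2', u1, u2; split=> //; first exact: WU.
move=> w; rewrite -lsubmx_frame_comb.
exact: abnormal_velocity FV Vt nann H1 H2 Hv (z0 t tab) niso w.
Qed.

Lemma horizontal_fst a b (c : R -> M * R) :
  horizontal_curve chbar Fbar a b c -> horizontal_curve ch F a b (fun t => (c t).1).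
Proof.
move=> [ac [C HC]]; split; first exact (abs_continuous_fst ac).
exists C => U X1 X2 FU.
have FV : Fbar (U `*` setT) (lift_vec A X1) (lift_vec A X2) by exists U, X1, X2.
apply: negligibleS (HC _ _ _ FV) => t /= nt Ht; apply: nt => tab Ut.
have [u1 [u2 [uC hv]]] := Ht tab (conj Ut I); exists u1, u2; split=> //.
by rewrite -lsubmx_frame_comb; exact: (has_velocity_fst hv).
Qed.

Lemma abnormal_projection a b (c : R -> M * R) : @second_countable M ->
  abnormal_trajectory chbar Fbar a b c ->
  horizontal_curve ch F a b (fun t => (c t).1) /\
  {ae mu, forall t, a <= t <= b -> exists v, has_velocity ch (fun t => (c t).1) t v /\
     forall w, form2 (beta (c t).1) v w = 0}.
Proof.
move=> M2 [hc [zeta [_ z0 H]]]; split; first exact: horizontal_fst.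
have [N nN HN] := abnormal_velocity_ae M2 z0 H.
apply: negligibleS nN => t /= nt; apply: contrapT => Nt; apply: nt => tab.
have [_ [U [X1 [X2 [u1 [u2 [FU Ut hv bv]]]]]]] := HN t tab Nt.
exists (u1 *: X1 (c t).1 + u2 *: X2 (c t).1); split=> //.
by rewrite -lsubmx_frame_comb; exact: (has_velocity_fst hv).
Qed.

End AbnormalProjection.

(** * The abnormal trajectory through a point *)

Section LipschitzCurves.
Context {R : realType} {n : nat} {T : topologicalType}.
Variable ch : charted R n T.

Lemma locally_lipschitz_derive (V : normedModType R) (f : R -> V) (t C : R) :
  (\forall s \near t, exists2 d : V, is_derive (s : R) 1 f d & `|d| <= C) -> locally_lipschitz f t.
Proof.
move=> /near_normP [e e0 He]; exists (e / 2); first by rewrite divr_gt0.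
exists `|C|; first exact: normr_ge0.
have H (s : R) : t - e / 2 <= s <= t + e / 2 -> exists2 d, is_derive s 1 f d & `|d| <= `|C|.
  move=> st; have [|d ds dC] := He s.
    by rewrite ltr_distlC; apply/andP; split; lra.
  by exists d => //; exact: le_trans dC (ler_norm C).
move=> y z; rewrite !ltr_distlC => yt zt.
by apply: (derive_lipschitz_sym (normr_ge0 C) H); apply/andP; split; lra.
Qed.

Lemma lipschitz_curve_local (a b : R) (c : R -> T) :
  (forall t, a <= t <= b -> (\forall s \near t, cdom (ch (c t)) (c s)) /\
     locally_lipschitz (cmap (ch (c t)) \o c) t) -> lipschitz_curve ch a b c.
Proof.
move=> H t tab; have [/near_normP [e1 e10 H1] [e2 e20 [L L0 H2]]] := H t tab.
exists (Num.min e1 e2); first by rewrite lt_min e10.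
exists L; split=> [s _|s s' _ _]; rewrite !lt_min => /andP[h1 h2]; first exact: H1.
by move=> /andP[h3 h4]; exact: H2.
Qed.

Lemma lipschitz_abs_continuous (a b : R) (c : R -> T) :
  lipschitz_curve ch a b c -> abs_continuous_curve ch a b c.
Proof.
move=> H t tab; have [e e0 [L [H1 H2]]] := H t tab.
exists (e / 2); first by rewrite divr_gt0.
have near_t s : Num.max a (t - e / 2) <= s <= Num.min b (t + e / 2) ->
    a <= s <= b /\ `|s - t| < e.
  rewrite ge_max le_min => /andP[/andP[h1 h2] /andP[h3 h4]].
  by rewrite h1 h3; split=> //; rewrite ltr_distlC; apply/andP; split; lra.
split=> [s /near_t[sab st]|eps eps0]; first exact: H1.
have L1 : 0 < `|L| + 1 by rewrite ltr_wpDl.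
exists (eps / (`|L| + 1)); first by rewrite divr_gt0.
move=> N s u su _; rewrite ltr_pdivlMr // => sum_lt.
apply: le_lt_trans sum_lt; rewrite mulr_suml; apply: ler_sum => i _.
have [h1 [h2 h3]] := su i.
have [sa st] : a <= s i <= b /\ `|s i - t| < e by apply: near_t; rewrite h1 (le_trans h2 h3).
have [ua ut] : a <= u i <= b /\ `|u i - t| < e by apply: near_t; rewrite h3 (le_trans h1 h2).
apply: le_trans (H2 _ _ ua sa ut st) _.
rewrite (ger0_norm (_ : 0 <= u i - s i)) ?subr_ge0 // mulrC ler_wpM2l ?subr_ge0 //.
by apply: le_trans (ler_norm L) _; rewrite lerDl ler01.
Qed.

Lemma lipschitz_curve_base (a b : R) (c : R -> T) (zeta : R -> 'cV[R]_n) :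
  lipschitz_curve (cotangent ch) a b (fun t => (c t, zeta t)) -> lipschitz_curve ch a b c.
Proof.
move=> H t tab; have [e e0 [L [H1 H2]]] := H t tab.
exists e => //; exists L; split=> // s s' sa sa' st st'.
apply: le_trans (H2 s s' sa sa' st st').
have E r : cmap (ch (c t)) (c r) = lsubmx (cmap (cotangent ch (c t, zeta t)) (c r, zeta r)).
  exact: esym (row_mxKl _ _).
rewrite (E s) (E s').
have -> (P Q : 'rV[R]_(n + n)) : lsubmx P - lsubmx Q = lsubmx (P - Q) by rewrite linearB.
exact: lsubmx_norm_le.
Qed.

End LipschitzCurves.

Lemma hausdorff_prod (T1 T2 : topologicalType) : hausdorff_space T1 -> hausdorff_space T2 ->
  hausdorff_space (T1 * T2)%type.
Proof.
move=> h1 h2 [x1 x2] [y1 y2] cl; congr (_, _).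
- apply: h1 => U V Ux Vy.
  have nU : nbhs (x1, x2) (U `*` [set: T2]) by exists (U, setT) => //; split=> //; exact: filterT.
  have nV : nbhs (y1, y2) (V `*` [set: T2]) by exists (V, setT) => //; split=> //; exact: filterT.
  by have [[z1 z2] /= [[Uz _] [Vz _]]] := cl _ _ nU nV; exists z1.
- apply: h2 => U V Ux Vy.
  have nU : nbhs (x1, x2) ([set: T1] `*` U) by exists (setT, U) => //; split=> //; exact: filterT.
  have nV : nbhs (y1, y2) ([set: T1] `*` V) by exists (setT, V) => //; split=> //; exact: filterT.
  by have [[z1 z2] /= [[_ Uz] [_ Vz]]] := cl _ _ nU nV; exists z2.
Qed.

(** * The unit field spanning the kernel of beta, lifted *)

Section CharacteristicField.
Context {R : realType} {M : topologicalType} {ch : charted R 3 M}.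
Context {omega : M -> 'cV[R]_3} {g : M -> 'M[R]_3} {X0 : M -> 'rV[R]_3}.
Context {beta : M -> 'M[R]_3} {A : M -> 'cV[R]_3} {e1 e2 : M -> 'rV[R]_3}.
Hypothesis S : magnetic_setting ch omega g X0 beta A e1 e2.
Notation F := (contact_frame ch omega g).
Notation chbar := (times_line ch).
Notation Fbar := (lift_frames A F).
Notation coef X p := (field_coef X0 beta p (X p)).
Notation mu := (@lebesgue_measure R).

Definition field_norm (X1 X2 : M -> 'rV[R]_3) p : R := Num.sqrt (coef X1 p ^+ 2 + coef X2 p ^+ 2).
Definition characteristic_lift : M * R -> 'rV[R]_(3 + 1) :=
  lift_vec A (characteristic X0 beta e1 e2).
Notation Z := characteristic_lift.
Definition field_region : set (M * R) := [set z | beta z.1 != 0].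

Lemma field_region_open : open field_region.
Proof.
have oD := magnetic_field_neq0_open (ms_atlas S) (ms_reeb S) (ms_field S) (frame_at S).
by apply: (open_comp _ oD) => z _; exact: cvg_fst.
Qed.

Lemma characteristic_lift_frame U X1 X2 z : F U X1 X2 -> U z.1 ->
  Z z = (field_norm X1 X2 z.1)^-1 *:
    (coef X2 z.1 *: lift_vec A X1 z + (- coef X1 z.1) *: lift_vec A X2 z).
Proof.
move=> FU Uz; rewrite /Z /lift_vec.
rewrite (characteristic_frame (ms_contact S) (ms_reeb S) beta (ms_frame S) FU Uz).
rewrite -/(field_norm X1 X2 z.1) pairingZr pairingBr !pairingZr.
rewrite !scale_row_mx add_row_mx scale_row_mx scaleNr; congr (row_mx _ _).
by apply/matrixP => i j; rewrite !mxE !ord1 eqxx !mulr1n mulNr.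
Qed.

Lemma field_norm_gt0 U X1 X2 p : F U X1 X2 -> U p -> beta p != 0 -> 0 < field_norm X1 X2 p.
Proof.
move=> FU Up bp; rewrite sqrtr_gt0.
exact: (magnetic_field_neq0 (ms_atlas S) (ms_reeb S) (ms_field S) FU Up bp).
Qed.

Lemma field_norm_sqr X1 X2 p : field_norm X1 X2 p ^+ 2 = coef X1 p ^+ 2 + coef X2 p ^+ 2.
Proof. by rewrite sqr_sqrtr // addr_ge0 // sqr_ge0. Qed.

Lemma characteristic_controls U X1 X2 z : F U X1 X2 -> U z.1 -> beta z.1 != 0 ->
  exists u1 u2 : R, [/\ u1 ^+ 2 + u2 ^+ 2 = 1, u1 * coef X1 z.1 + u2 * coef X2 z.1 = 0 &
    Z z = u1 *: lift_vec A X1 z + u2 *: lift_vec A X2 z].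
Proof.
move=> FU Uz bz; have n0 := field_norm_gt0 FU Uz bz.
exists ((field_norm X1 X2 z.1)^-1 * coef X2 z.1), ((field_norm X1 X2 z.1)^-1 * - coef X1 z.1).
split; last by rewrite (characteristic_lift_frame FU Uz) scalerDr !scalerA.
  rewrite !exprMn sqrrN -mulrDr addrC -field_norm_sqr -exprMn mulVf ?expr1n //.
  by rewrite gt_eqF.
by rewrite -!mulrA -mulrDr mulNr [coef X2 _ * _]mulrC subrr mulr0.
Qed.

(** A plane vector orthogonal to (b1, b2) is a multiple of the unit vector (b2, -b1)/n, and the
    factor is its inner product with that vector. *)
Lemma control_proportional (b1 b2 n u1 u2 : R) : 0 < n -> n ^+ 2 = b1 ^+ 2 + b2 ^+ 2 ->
  u1 * b1 + u2 * b2 = 0 ->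
  u1 = (b2 * u1 - b1 * u2) / n * (n^-1 * b2) /\ u2 = (b2 * u1 - b1 * u2) / n * (n^-1 * - b1).
Proof.
move=> n0 nE h; have nn : n != 0 by rewrite gt_eqF.
have E1 : (b2 * u1 - b1 * u2) * b2 = u1 * n ^+ 2.
  by rewrite nE -[LHS]addr0 -[X in _ + X](mulr0 b1) -h; ring.
have E2 : (b2 * u1 - b1 * u2) * - b1 = u2 * n ^+ 2.
  by rewrite nE -[LHS]addr0 -[X in _ + X](mulr0 b2) -h; ring.
split; apply: (mulIf (expf_neq0 2 nn)).
- by rewrite -E1; field.
- by rewrite -E2; field.
Qed.

Lemma annihilated_velocity U X1 X2 z u1 u2 : F U X1 X2 -> U z.1 -> beta z.1 != 0 ->
  (forall w, form2 (beta z.1) (u1 *: X1 z.1 + u2 *: X2 z.1) w = 0) ->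
  exists f : R, u1 *: lift_vec A X1 z + u2 *: lift_vec A X2 z = f *: Z z.
Proof.
move=> FU Uz bz H; have n0 := field_norm_gt0 FU Uz bz.
have h : u1 * coef X1 z.1 + u2 * coef X2 z.1 = 0.
  by have := H (X0 z.1); rewrite form2Dl !form2Zl.
have [h1 h2] := control_proportional n0 (field_norm_sqr X1 X2 z.1) h.
exists ((coef X2 z.1 * u1 - coef X1 z.1 * u2) / field_norm X1 X2 z.1).
rewrite (characteristic_lift_frame FU Uz) scalerA scalerDr !scalerA.
rewrite mulrA in h1; rewrite mulrA in h2.
by rewrite -h1 -h2.
Qed.

Lemma beta_controls U X1 X2 (z : M * R) u1 u2 w : F U X1 X2 -> U z.1 ->
  u1 * coef X1 z.1 + u2 * coef X2 z.1 = 0 ->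
  form2 (beta z.1) (u1 *: X1 z.1 + u2 *: X2 z.1) w = 0.
Proof.
move=> FU Uz h; have [_ _ ->] := magnetic_field_frame (ms_atlas S) (ms_reeb S) (ms_field S) FU; last exact: Uz.
have [[d1 d2 _] [d3 d4 _]] := coframe_dual (ms_reeb S) FU Uz.
have [_ _ _ frame] := FU; have [[kX1 kX2] _ _ _ _] := frame _ Uz.
rewrite !pairingDr !pairingZr d1 d2 d3 d4 kX1 kX2 !mulr0 !mulr1 !addr0 add0r mul0r subr0.
by rewrite [coef X1 _ * _]mulrC [coef X2 _ * _]mulrC h mulr0.
Qed.

Lemma characteristic_lift_neq0 z : beta z.1 != 0 -> Z z != 0.
Proof.
move=> bz; have [U [X1 [X2 [FU Uz]]]] := frame_at S z.1.
have [u1 [u2 [u12 _ ZE]]] := characteristic_controls FU Uz bz.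
apply/eqP => Z0; have [_ _ _ frame] := FU; have [[kX1 kX2] _ _ _ _] := frame _ Uz.
have [[d1 d2 _] [d3 d4 _]] := coframe_dual (ms_reeb S) FU Uz.
have l0 : u1 *: X1 z.1 + u2 *: X2 z.1 = 0.
  by rewrite -(lsubmx_frame_comb (A := A)) -ZE Z0 linear0.
have p0 (a : 'cV[R]_3) : pairing a 0 = 0 by rewrite /pairing mul0mx mxE.
have := congr1 (pairing (coframe1 ch omega X2 z.1)) l0.
rewrite pairingDr !pairingZr d1 d2 p0 mulr0 mulr1 addr0 => u10.
have := congr1 (pairing (coframe2 ch omega X1 z.1)) l0.
rewrite pairingDr !pairingZr d3 d4 p0 mulr0 mulr1 add0r => u20.
by move: u12; rewrite u10 u20 expr0n addr0 => /eqP; rewrite eq_sym oner_eq0.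
Qed.

Lemma fun_in_locally_lipschitz U (f : M -> R) (z : M * R) : open U -> U z.1 -> smooth_fun ch U f ->
  locally_lipschitz (fun_in chbar z (fun z' => f z'.1)) (cmap (chbar z) z).
Proof.
move=> oU Uz sf; have atl := ms_atlas S.
have oI : open (image_in ch z.1 U) := image_in_open atl oU.
have s1 : smooth (image_in ch z.1 U) (fun x => (fun_in ch z.1 f x)%:M : 'M[R]_1).
  apply/smooth_mxP => // i j; apply: smooth_ext (sf z.1) => // x _.
  by rewrite mxE !ord1 eqxx mulr1n.
have s2 := smooth_lsubmx 1 oI s1.
have oI2 : open (@lsubmx R 1 3 1 @^-1` image_in ch z.1 U).
  by apply: open_comp => // y _; exact: lsubmx_continuous.
have zz : (@lsubmx R 1 3 1 @^-1` image_in ch z.1 U) (cmap (chbar z) z).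
  rewrite /= row_mxKl; exact: image_in_mem (cdom_self atl _) Uz.
apply: locally_lipschitz_near (locally_lipschitz_entry 0 0 (smooth_locally_lipschitz oI2 zz s2)).
by apply: filterE => y; rewrite mxE eqxx mulr1n.
Qed.

Lemma vec_in_locally_lipschitz V (Y : M * R -> 'rV[R]_(3 + 1)) z : open V -> V z ->
  smooth_vec chbar V Y -> locally_lipschitz (vec_in chbar z Y) (cmap (chbar z) z).
Proof.
move=> oV Vz sY; have atlb := times_line_atlas (ms_atlas S).
have oI : open (image_in chbar z V) := image_in_open atlb oV.
apply: smooth_locally_lipschitz oI _ (sY z).
exact: image_in_mem (cdom_self atlb _) Vz.
Qed.

(** In a local frame the field is built from smooth data by products, one square root and one
    inverse; beta being nonzero keeps the argument of the root positive. *)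
Lemma characteristic_lift_lipschitz z : field_region z ->
  locally_lipschitz (vec_in chbar z Z) (cmap (chbar z) z).
Proof.
move=> bz; have atlb := times_line_atlas (ms_atlas S).
have [U [X1 [X2 [FU Uz]]]] := frame_at S z.1; have [oU _ _ _] := FU.
have FV : Fbar (U `*` setT) (lift_vec A X1) (lift_vec A X2) by exists U, X1, X2.
have [oV s1 s2] := lift_frame_smooth S FV; have Vz : (U `*` [set: R]) z by [].
have [sf1 sf2 _] := magnetic_field_frame (ms_atlas S) (ms_reeb S) (ms_field S) FU.
pose f1 := fun_in chbar z (fun z' => coef X1 z'.1).
pose f2 := fun_in chbar z (fun z' => coef X2 z'.1).
have L1 : locally_lipschitz f1 (cmap (chbar z) z) by exact: fun_in_locally_lipschitz oU Uz sf1.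
have L2 : locally_lipschitz f2 (cmap (chbar z) z) by exact: fun_in_locally_lipschitz oU Uz sf2.
have LY1 := vec_in_locally_lipschitz oV Vz s1.
have LY2 := vec_in_locally_lipschitz oV Vz s2.
have zz := cdom_self atlb z.
have f1z : f1 (cmap (chbar z) z) = coef X1 z.1 by exact: (fun_inE atlb (fun z' => coef X1 z'.1) zz).
have f2z : f2 (cmap (chbar z) z) = coef X2 z.1 by exact: (fun_inE atlb (fun z' => coef X2 z'.1) zz).
have Ln : locally_lipschitz (fun y => (Num.sqrt (f1 y * f1 y + f2 y * f2 y))^-1) (cmap (chbar z) z).
  have Lq : locally_lipschitz (fun y => f1 y *: f1 y + f2 y *: f2 y) (cmap (chbar z) z).
    by apply: locally_lipschitzD; exact: locally_lipschitzZ.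
  have q0 : 0 < f1 (cmap (chbar z) z) *: f1 (cmap (chbar z) z)
      + f2 (cmap (chbar z) z) *: f2 (cmap (chbar z) z).
    by rewrite f1z f2z; have := field_norm_gt0 FU Uz bz; rewrite sqrtr_gt0 !expr2.
  apply: locally_lipschitz_comp (locally_lipschitz_comp Lq (locally_lipschitz_sqrt q0)) _.
  by apply: locally_lipschitz_inv; rewrite gt_eqF //= sqrtr_gt0.
have Lm : locally_lipschitz (fun y => - f1 y) (cmap (chbar z) z).
  have Lc : locally_lipschitz (fun=> -1 : R) (cmap (chbar z) z) by exact: locally_lipschitz_cst.
  apply: locally_lipschitz_near (locally_lipschitzZ Lc L1).
  by apply: filterE => y; rewrite /GRing.scale /= mulN1r.
apply: locally_lipschitz_near (locally_lipschitzZ Ln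
  (locally_lipschitzD (locally_lipschitzZ L2 LY1) (locally_lipschitzZ Lm LY2))).
apply: filterS (cinv_near atlb zz oV Vz) => y [_ Vy _].
rewrite /vec_in /f1 /f2 /fun_in; move: (cinv (chbar z) y) Vy => q [Uq _].
by rewrite (characteristic_lift_frame FU Uq) -scalemxAl mulmxDl -!scalemxAl /field_norm !expr2.
Qed.

End CharacteristicField.

Lemma hamiltonian_momentum_exists (R : realType) n (T : topologicalType) (ch : charted R n T)
    (X : T -> 'rV[R]_n) z : atlas ch ->
  differentiable (vec_in ch z.1 X) (cmap (ch z.1) z.1) ->
  exists h, [/\ hamiltonian_vector ch (momentum X) z h, lsubmx h = X z.1 &
    forall u, u *m (rsubmx h)^T = - ('D_u (vec_in ch z.1 X) (cmap (ch z.1) z.1) *m z.2)].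
Proof.
move=> atl dX; pose J := 'J (vec_in ch z.1 X) (cmap (ch z.1) z.1).
exists (row_mx (X z.1) (- (J *m z.2))^T).
have El : lsubmx (row_mx (X z.1) (- (J *m z.2))^T) = X z.1 by exact: row_mxKl.
have Er u : u *m (rsubmx (row_mx (X z.1) (- (J *m z.2))^T))^T =
    - ('D_u (vec_in ch z.1 X) (cmap (ch z.1) z.1) *m z.2).
  rewrite row_mxKr trmxK mulmxN mulmxA; apply: congr1.
  exact: (congr1 (fun v => v *m z.2) (esym (deriveEjacobian u dX))).
by split=> //; apply: (hamiltonian_momentumP atl _ dX).2.
Qed.

(** * Integral curves of the characteristic field are abnormal *)

Section AbnormalCurves.
Context {R : realType} {M : topologicalType} {ch : charted R 3 M}.
Context {omega : M -> 'cV[R]_3} {g : M -> 'M[R]_3} {X0 : M -> 'rV[R]_3}.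
Context {beta : M -> 'M[R]_3} {A : M -> 'cV[R]_3} {e1 e2 : M -> 'rV[R]_3}.
Hypothesis S : magnetic_setting ch omega g X0 beta A e1 e2.
Notation F := (contact_frame ch omega g).
Notation chbar := (times_line ch).
Notation Fbar := (lift_frames A F).
Notation eta := (@eta_form R M ch omega A e1 e2).
Notation Z := (@characteristic_lift R M X0 beta A e1 e2).
Notation region := (@field_region R M beta).
Notation coef X p := (field_coef X0 beta p (X p)).
Notation mu := (@lebesgue_measure R).

Lemma eta_annihilates V Y1 Y2 z : Fbar V Y1 Y2 -> V z ->
  pairing (eta z) (Y1 z) = 0 /\ pairing (eta z) (Y2 z) = 0.
Proof. by move=> FV Vz; have [] := lift_frame_kernel (e1 := e1) (e2 := e2) FV Vz. Qed.

Lemma eta_neq0 z : eta z != 0.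
Proof.
apply/eqP => e0; have := eta_vertical (e1 := e1) (e2 := e2) (ch := ch) (omega := omega) (A := A) z.
by rewrite e0 /pairing mulmx0 mxE => /eqP; rewrite eq_sym oner_eq0.
Qed.

Lemma sum_annihilated (u1 u2 a1 a2 b1 b2 : R) : a1 = - b1 -> a2 = - b2 ->
  - (u1 * a1 + u2 * a2) = u1 * b1 + u2 * b2.
Proof. by move=> -> ->; ring. Qed.

Lemma eta_hamiltonian (c : R -> M * R) t U X1 X2 u1 u2 : F U X1 X2 -> U (c t).1 ->
  u1 * coef X1 (c t).1 + u2 * coef X2 (c t).1 = 0 ->
  has_velocity chbar c t (u1 *: lift_vec A X1 (c t) + u2 *: lift_vec A X2 (c t)) ->
  exists h1 h2,
    [/\ hamiltonian_vector chbar (momentum (lift_vec A X1)) (c t, eta (c t)) h1,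
        hamiltonian_vector chbar (momentum (lift_vec A X2)) (c t, eta (c t)) h2 &
        has_velocity (cotangent chbar) (fun s => (c s, eta (c s))) t (u1 *: h1 + u2 *: h2)].
Proof.
move=> FU Ut u0 hv; have atlb := times_line_atlas (ms_atlas S).
have FV : Fbar (U `*` setT) (lift_vec A X1) (lift_vec A X2) by exists U, X1, X2.
have [oV s1 s2] := lift_frame_smooth S FV; have Vt : (U `*` [set: R]) (c t) by [].
have tt := cdom_self atlb (c t).
have d1 := smooth_vec_diff s1 Vt tt; have d2 := smooth_vec_diff s2 Vt tt.
have [h1 [H1 l1 r1]] := hamiltonian_momentum_exists (z := (c t, eta (c t))) atlb d1.
have [h2 [H2 l2 r2]] := hamiltonian_momentum_exists (z := (c t, eta (c t))) atlb d2.
exists h1, h2; split; [exact: H1|exact: H2|].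
have lE : lsubmx (u1 *: h1 + u2 *: h2) = u1 *: lift_vec A X1 (c t) + u2 *: lift_vec A X2 (c t).
  by apply: etrans (congr2 (fun a b => u1 *: a + u2 *: b) l1 l2); rewrite linearD !linearZ.
apply/has_velocity_cotangent; split; first by rewrite lE.
set v := u1 *: lift_vec A X1 (c t) + _ in hv.
have dE := is_derive_cov_curve atlb (eta_diff S tt) hv.
suff -> : (rsubmx (u1 *: h1 + u2 *: h2))^T = 'D_v (cov_in chbar (c t) eta) (cmap (chbar (c t)) (c t)).
  exact: dE.
apply: pairing_inj => w.
have rE : (rsubmx (u1 *: h1 + u2 *: h2))^T = u1 *: (rsubmx h1)^T + u2 *: (rsubmx h2)^T.
  by rewrite linearD !linearZ linearD !linearZ.
have dform0 : form2 (dform1 chbar eta (c t)) v w = 0.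
  apply: etrans (dform1_eta S (c t) v w) _; rewrite /v lsubmx_frame_comb.
  by rewrite (beta_controls S _ FU Ut u0) oppr0.
have entryB (P Q : 'M[R]_1) : (P - Q) 0 0 = P 0 0 - Q 0 0 by rewrite !mxE.
have expand (B B' : 'rV[R]_(3 + 1)) (C : 'cV[R]_(3+1)) :
  ((u1 *: B + u2 *: B') *m C) 0 0 = u1 * (B *m C) 0 0 + u2 * (B' *m C) 0 0.
  by rewrite mulmxDl -!scalemxAl !mxE.
have e0 : pairing ('D_v (cov_in chbar (c t) eta) (cmap (chbar (c t)) (c t))) w =
    (v *m 'D_w (cov_in chbar (c t) eta) (cmap (chbar (c t)) (c t))) 0 0.
  have := etrans (esym (dform1E v w (eta_diff S tt))) dform0.
  by move=> /(etrans (esym (entryB _ _)))/eqP; rewrite subr_eq0 => /eqP.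
apply: etrans _ (etrans _ (esym e0)); last exact: esym (expand _ _ _).
apply: etrans (congr1 (fun C => pairing C w) rE) _.
have derE X : smooth_vec chbar (U `*` setT) (lift_vec A X) ->
    (forall z, (U `*` setT) z -> pairing (eta z) (lift_vec A X z) = 0) ->
    ('D_w (vec_in chbar (c t) (lift_vec A X)) (cmap (chbar (c t)) (c t)) *m eta (c t)) 0 0 =
    - (lift_vec A X (c t) *m 'D_w (cov_in chbar (c t) eta) (cmap (chbar (c t)) (c t))) 0 0.
  move=> sY kY; have := derive_annihilated atlb w oV Vt (eta_diff S tt) sY kY.
  by rewrite mxE => /eqP; rewrite addr_eq0 => /eqP.
have k1 := derE X1 s1 (fun z Vz => (eta_annihilates FV Vz).1).
have k2 := derE X2 s2 (fun z Vz => (eta_annihilates FV Vz).2).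
apply: etrans (sum_annihilated u1 u2 k1 k2).
have pE (C C' : 'cV[R]_(3 + 1)) : pairing (u1 *: C + u2 *: C') w =
    u1 * (w *m C) 0 0 + u2 * (w *m C') 0 0 by rewrite pairingDl !pairingZl.
have entryN (P Q : 'M[R]_1) : u1 * (- P) 0 0 + u2 * (- Q) 0 0 = - (u1 * P 0 0 + u2 * Q 0 0).
  by rewrite !mxE opprD !mulrN.
apply: etrans (pE _ _) _.
apply: etrans (congr2 (fun x y : 'M[R]_1 => u1 * x 0 0 + u2 * y 0 0) (r1 w) (r2 w)) _.
exact: entryN.
Qed.

Lemma integral_unit_speed (J : set R) (c : R -> M * R) :
  integral_curve chbar region Z J c -> unit_speed chbar Fbar J c.
Proof.
move=> ic V Y1 Y2 [U [X1 [X2 [FU -> -> ->]]]] t Jt [Ut _].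
have [bt hv] := ic t Jt; have [u1 [u2 [u12 _ ZE]]] := characteristic_controls S FU Ut bt.
by exists u1, u2; rewrite -ZE.
Qed.

Lemma integral_derive_bounded (J : set R) (c : R -> M * R) t : open J -> J t ->
  integral_curve chbar region Z J c ->
  (\forall s \near t, cdom (chbar (c t)) (c s)) /\
  locally_lipschitz (cmap (chbar (c t)) \o c) t.
Proof.
move=> oJ Jt ic; have atlb := times_line_atlas (ms_atlas S).
have [bt hv] := ic t Jt; have [cd dc] := hv; split=> //.
have [e e0 [B B0 HB]] := locally_lipschitz_bounded (characteristic_lift_lipschitz S bt).
have cc : {for t, continuous (cmap (chbar (c t)) \o c)}.
  by apply: differentiable_continuous; apply/derivable1_diffP; case: dc.
have nB : \forall s \near t, `|(cmap (chbar (c t)) \o c) s - cmap (chbar (c t)) (c t)| < e.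
  have nb : nbhs (cmap (chbar (c t)) (c t)) [set y | `|y - cmap (chbar (c t)) (c t)| < e].
    by apply: (near_normP _ (fun y => `|y - cmap (chbar (c t)) (c t)| < e)).2; exists e.
  exact: (cc _ nb).
have nJ : \forall s \near t, J s by exact: open_nbhs_nbhs.
apply: (@locally_lipschitz_derive _ _ _ _ B).
apply: filterS (filterI cd (filterI nJ nB)) => s [cs [Js Bs]].
have [bs hs] := ic s Js; eexists; first exact: (integral_chart atlb cs hs).
exact: HB.
Qed.

Lemma locally_lipschitz_cov_curve (c : R -> M * R) (t : R) :
  (\forall s \near t, cdom (chbar (c t)) (c s)) ->
  locally_lipschitz (cmap (chbar (c t)) \o c) t ->
  locally_lipschitz (cmap (cotangent chbar (c t, eta (c t))) \o (fun s => (c s, eta (c s)))) t.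
Proof.
move=> cd Lc; have atlb := times_line_atlas (ms_atlas S).
have [U [X1 [X2 [FU Ut]]]] := frame_at S (c t).1; have [oU _ _ _] := FU.
have oV := open_times_line (R := R) oU; have Vt : (U `*` [set: R]) (c t) by [].
have oI : open (image_in chbar (c t) (U `*` [set: R])) := image_in_open atlb oV.
have tI := image_in_mem (cdom_self atlb (c t)) Vt.
have LE := smooth_locally_lipschitz oI tI (eta_smooth S FU (c t)).
have LEc := locally_lipschitz_comp Lc LE.
have nE : \forall s \near t, cov_in chbar (c t) eta (cmap (chbar (c t)) (c s)) =
    trans_jac chbar (c t) (c s) (c s) *m eta (c s).
  by apply: filterS cd => s cs; exact: (cov_inE atlb eta cs).
apply: locally_lipschitz_mx => i j; rewrite -[j]splitK; case: (fintype.split j) => k.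
  apply: locally_lipschitz_near (locally_lipschitz_entry i k Lc).
  by apply: filterE => s /=; rewrite row_mxEl.
apply: locally_lipschitz_near (locally_lipschitz_entry k i LEc).
apply: filterS nE => s /= Es; rewrite row_mxEr.
have trE (C : 'cV[R]_(3 + 1)) : C^T i k = C k i by rewrite mxE.
by rewrite trE; exact (congr1 (fun C : 'cV[R]_(3 + 1) => C k i) Es).
Qed.

Lemma integral_abnormal (a b : R) (J : set R) (c : R -> M * R) : open J ->
  (forall t, a <= t <= b -> J t) -> integral_curve chbar region Z J c ->
  abnormal_trajectory chbar Fbar a b c.
Proof.
move=> oJ abJ ic.
have vel U X1 X2 t : F U X1 X2 -> a <= t <= b -> U (c t).1 ->
    exists u1 u2 : R, [/\ u1 ^+ 2 + u2 ^+ 2 = 1, u1 * coef X1 (c t).1 + u2 * coef X2 (c t).1 = 0 &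
      has_velocity chbar c t (u1 *: lift_vec A X1 (c t) + u2 *: lift_vec A X2 (c t))].
  move=> FU tab Ut; have [bt hv] := ic t (abJ t tab).
  have [u1 [u2 [u12 u0 ZE]]] := characteristic_controls S FU Ut bt.
  by exists u1, u2; rewrite -ZE.
split; [split|].
- apply: lipschitz_abs_continuous; apply: lipschitz_curve_local => t tab.
  exact: integral_derive_bounded oJ (abJ t tab) ic.
- exists 1 => V Y1 Y2 [U [X1 [X2 [FU -> -> ->]]]].
  apply: aeW => t tab [Ut _]; have [u1 [u2 [u12 _ hv]]] := vel _ _ _ t FU tab Ut.
  by exists u1, u2; rewrite u12.
exists (fun t => eta (c t)); split.
- apply: lipschitz_curve_local => t tab.
  have [cd Lc] := integral_derive_bounded oJ (abJ t tab) ic; split; first exact: cd.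
  exact: locally_lipschitz_cov_curve.
- by move=> t _; exact: eta_neq0.
- move=> V Y1 Y2 FV; split=> [t _ Vt|]; first exact: eta_annihilates FV Vt.
  case: FV => [U [X1 [X2 [FU -> -> ->]]]].
  apply: aeW => t tab [Ut _]; have [u1 [u2 [_ u0 hv]]] := vel _ _ _ t FU tab Ut.
  have [h1 [h2 [H1 H2 Hv]]] := eta_hamiltonian FU Ut u0 hv.
  by exists u1, u2, h1, h2.
Qed.

End AbnormalCurves.

(** * Uniqueness up to reparametrization *)

Section AbnormalUniqueness.
Context {R : realType} {M : topologicalType} {ch : charted R 3 M}.
Context {omega : M -> 'cV[R]_3} {g : M -> 'M[R]_3} {X0 : M -> 'rV[R]_3}.
Context {beta : M -> 'M[R]_3} {A : M -> 'cV[R]_3} {e1 e2 : M -> 'rV[R]_3}.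
Hypothesis S : magnetic_setting ch omega g X0 beta A e1 e2.
Notation F := (contact_frame ch omega g).
Notation chbar := (times_line ch).
Notation Fbar := (lift_frames A F).
Notation Z := (@characteristic_lift R M X0 beta A e1 e2).
Notation region := (@field_region R M beta).
Notation mu := (@lebesgue_measure R).

(** Near each time [eta] runs along the integral curve [delta] through its own position; when
    [delta] meets [c], maximality makes it a shifted piece of [c]. These local lifts are what
    [path_lifting] consumes. *)
Lemma abnormal_reparametrization (a b t0 s0 : R) (J : set R) (c eta : R -> M * R) :
  @second_countable M -> maximal_curve chbar region Z J c ->
  abnormal_trajectory chbar Fbar a b eta ->
  (forall t, a <= t <= b -> beta (eta t).1 != 0) ->
  a <= t0 <= b -> J s0 -> eta t0 = c s0 ->
  exists phi : R -> R, [/\ continuous phi, phi t0 = s0 &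
    forall t, a <= t <= b -> J (phi t) /\ eta t = c (phi t)].
Proof.
move=> M2 maxc [_ [zeta [lip z0 H]]] bz t0ab Js0 et0.
have atlb := times_line_atlas (ms_atlas S).
have [N nN HN] := abnormal_velocity_ae S M2 z0 H.
have tangent t : a < t < b -> ~ N t -> exists f : R, has_velocity chbar eta t (f *: Z (eta t)).
  move=> /andP[h1 h2] Nt; have tab : a <= t <= b by rewrite !ltW.
  have [_ [U [X1 [X2 [u1 [u2 [FU Ut hv bv]]]]]]] := HN t tab Nt.
  have [f fE] := annihilated_velocity S FU Ut (bz t tab) bv.
  by exists f; rewrite -fE.
have lipb := lipschitz_curve_base lip.
apply: (path_lifting t0ab Js0 et0) => t tab.
have rt : region (eta t) by exact: bz.
have [r r0 [delta d0 icd]] := integral_curve_exists atlb (field_region_open S)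
  (characteristic_lift_lipschitz S) rt.
have [e0 e00 [L [H1 H2]]] := lipb t tab.
have H2' (s s' : R) : a <= s <= b -> a <= s' <= b -> `|s - t| < e0 -> `|s' - t| < e0 ->
    `|cmap (chbar (eta t)) (eta s) - cmap (chbar (eta t)) (eta s')| <= `|L| * `|s - s'|.
  move=> sa sa' st st'; apply: le_trans (H2 s s' sa sa' st st') _.
  by apply: ler_wpM2r => //; exact: ler_norm.
have [e ep [psi [cpsi psir psiE]]] := tangent_curve_reparametrization atlb
  (characteristic_lift_lipschitz S) rt (characteristic_lift_neq0 S (bz t tab)) r0 d0 icd
  tab erefl e00 (normr_ge0 L) H1 H2' nN tangent.
exists e => // t1 s1 t1ab t1t Js1 et1.
pose I := [set s : R | `|s| < r].
have oI : open I.
  have -> : I = ball (0 : R) r.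
    by apply/seteqP; split=> s; rewrite /I /ball /= sub0r normrN.
  exact: ball_open.
have iI : is_interval I.
  move=> x y; rewrite /I /= !ltr_norml => /andP[x1 x2] /andP[y1 y2] w /andP[w1 w2].
  by rewrite ltr_norml; apply/andP; split; lra.
have Ipsi u : I (psi u) by exact: psir.
have dE : delta (psi t1) = c s1 by rewrite -(psiE t1 t1ab t1t).
have mx := maxc I delta s1 (psi t1) oI iI (Ipsi t1) Js1 icd dE.
exists (fun u => psi u - psi t1 + s1); split.
- move=> u; apply: cvgD; last exact: cvg_cst.
  by apply: cvgB; [exact: cpsi|exact: cvg_cst].
- by rewrite subrr add0r.
- move=> u uab ut; have [Ju cu] := mx (psi u) (Ipsi u).
  by split=> //; rewrite cu (psiE u uab ut).
Qed.

Lemma abnormal_exists_unique (pbar : M * R) : hausdorff_space M -> @second_countable M ->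
  beta pbar.1 != 0 ->
  exists (J : set R) (gammabar : R -> (M * R)%type),
  [/\ open J, is_interval J, J 0 & gammabar 0 = pbar] /\
  [/\ (forall t, J t -> beta (gammabar t).1 != 0),
      unit_speed chbar Fbar J gammabar,
      (forall a b : R, a < b -> (forall t, a <= t <= b -> J t) ->
         abnormal_trajectory chbar Fbar a b gammabar) &
      (forall (a b t0 : R) (eta : R -> (M * R)%type), a < b ->
         abnormal_trajectory chbar Fbar a b eta ->
         (forall t, a <= t <= b -> beta (eta t).1 != 0) ->
         a <= t0 <= b -> eta t0 = pbar ->
         exists phi : R -> R,
         [/\ {within `[a, b], continuous phi}, phi t0 = 0 &
             forall t, a <= t <= b ->
               J (phi t) /\ eta t = gammabar (phi t)])].
Proof.
move=> hM M2 bp; have atlb := times_line_atlas (ms_atlas S).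
have [J [c [[oJ iJ J0 c0] [ic mx]]]] := maximal_curve_exists atlb (field_region_open S)
  (characteristic_lift_lipschitz S) (hausdorff_prod hM (@Rhausdorff R)) (bp : region pbar).
exists J, c; split=> //; split.
- by move=> t Jt; have [] := ic t Jt.
- exact: (integral_unit_speed S ic).
- by move=> a b _ abJ; exact: (integral_abnormal S oJ abJ ic).
- move=> a b t0 eta _ ab be t0ab et0.
  have et0' : eta t0 = c 0 by rewrite c0.
  have [phi [cphi phi0 Hphi]] := abnormal_reparametrization M2 mx ab be t0ab J0 et0'.
  by exists phi; split=> //; exact: continuous_subspaceT.
Qed.

End AbnormalUniqueness.

(** * Normal extremals *)

Lemma derive_line (R : realType) (V W : normedModType R) (f : V -> W) (x v : V) :
  'D_v f x = 'D_(1 : R) (fun h : R => f (h *: v + x)) 0.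
Proof.
apply: (congr1 (fun G : R -> W => lim (G @ (0 : R)^'))); apply/funext => h /=.
by rewrite scale0r add0r addr0 /GRing.scale /= mulr1.
Qed.

(** Directional derivatives see only one line, so functions on spaces of different dimensions can be
    compared; here the cotangent charts of M x R and of M. *)
Lemma derive_line_congr (R : realType) (V V' W : normedModType R) (f : V -> W) (f' : V' -> W)
    (x v : V) (x' v' : V') :
  (\forall h \near (0 : R), f (h *: v + x) = f' (h *: v' + x')) -> 'D_v f x = 'D_v' f' x'.
Proof.
move=> fE; apply: etrans (derive_line f x v) (etrans _ (esym (derive_line f' x' v'))).
by apply: near_eq_derive; apply: filterS fE.
Qed.

Section NormalProjection.
Context {R : realType} {M : topologicalType} {ch : charted R 3 M}.
Context {omega : M -> 'cV[R]_3} {g : M -> 'M[R]_3} {X0 : M -> 'rV[R]_3}.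
Context {beta : M -> 'M[R]_3} {A : M -> 'cV[R]_3} {e1 e2 : M -> 'rV[R]_3}.
Hypothesis S : magnetic_setting ch omega g X0 beta A e1 e2.
Notation F := (contact_frame ch omega g).
Notation chbar := (times_line ch).
Notation Fbar := (lift_frames A F).

(* Forgets the coordinate w and its conjugate momentum, which is the charge. *)
Definition reduce_covector (y : 'rV[R]_((3 + 1) + (3 + 1))) : 'rV[R]_(3 + 3) :=
  row_mx (lsubmx (lsubmx y)) (lsubmx (rsubmx y)).

Lemma reduce_covector_line (h : R) v y :
  reduce_covector (h *: v + y) = h *: reduce_covector v + reduce_covector y.
Proof. by rewrite /reduce_covector !linearP scale_row_mx add_row_mx. Qed.

Notation normal_hamiltonian Y1 Y2 := (fun z => 2^-1 * (momentum Y1 z ^+ 2 + momentum Y2 z ^+ 2)).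
Notation magnetic_hamiltonian X1 X2 q := (fun z => 2^-1 *
         ((momentum X1 z + q * pairing (A z.1) (X1 z.1)) ^+ 2
          + (momentum X2 z + q * pairing (A z.1) (X2 z.1)) ^+ 2)).

Lemma momentum_lift_in X (z : M * R) (zeta : 'cV[R]_(3 + 1)) (lambda : 'cV[R]_3) y q :
  cdom (ch z.1) (cinv (ch z.1) (lsubmx (lsubmx y))) -> rsubmx (rsubmx y) = q%:M ->
  fun_in (cotangent chbar) (z, zeta) (momentum (lift_vec A X)) y =
  fun_in (cotangent ch) (z.1, lambda)
    (fun z' => momentum X z' + q * pairing (A z'.1) (X z'.1)) (reduce_covector y).
Proof.
move=> yd yq; have atl := ms_atlas S; have atlb := times_line_atlas atl.
apply: etrans (congr1 (fun f => f y) (momentum_in chbar (lift_vec A X) (z, zeta))) _.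
pose x := lsubmx (lsubmx y).
have E1 : vec_in chbar z (lift_vec A X) (lsubmx y) = row_mx (vec_in ch z.1 X x)
    (pairing (A (cinv (ch z.1) x)) (X (cinv (ch z.1) x)))%:M by exact: times_line_vec_in atl _ _ _ _ yd.
apply: etrans (congr1 (fun r : 'rV[R]_(3 + 1) => (r *m (rsubmx y)^T) 0 0) E1) _.
have E2 := congr1 (fun f => f (reduce_covector y)) (momentum_in ch X (z.1, lambda)).
have E3 : fun_in (cotangent ch) (z.1, lambda)
    (fun z' => momentum X z' + q * pairing (A z'.1) (X z'.1)) (reduce_covector y) =
  fun_in (cotangent ch) (z.1, lambda) (momentum X) (reduce_covector y)
  + q * pairing (A (cinv (ch z.1) (lsubmx (reduce_covector y))))
          (X (cinv (ch z.1) (lsubmx (reduce_covector y)))) by [].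
apply: etrans _ (esym E3).
apply: etrans _ (congr1 (fun r => r + _) (esym E2)).
rewrite /reduce_covector row_mxKl row_mxKr -/x -[rsubmx y]hsubmxK yq.
rewrite tr_row_mx tr_scalar_mx mul_row_col row_mxKl mxE; congr (_ + _).
by rewrite -scalar_mxM mxE eqxx mulr1n mulrC.
Qed.

(** The two Hamiltonians agree on the slice where the momentum of w equals [q], so their
    differentials are compared on vectors [v] tangent to that slice. *)
Lemma dfun_reduce U X1 X2 (z : M * R) (zeta : 'cV[R]_(3 + 1)) q v : open U -> U z.1 ->
  dsubmx zeta = q%:M -> rsubmx (rsubmx v) = 0 ->
  dfun (cotangent chbar) (normal_hamiltonian (lift_vec A X1) (lift_vec A X2)) (z, zeta) v =
  dfun (cotangent ch) (magnetic_hamiltonian X1 X2 q) (z.1, usubmx zeta) (reduce_covector v).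
Proof.
move=> oU Uz zq vq; have atl := ms_atlas S; have atlb := times_line_atlas atl.
rewrite /dfun; apply: derive_line_congr.
set y0 := cmap (cotangent chbar (z, zeta)) (z, zeta).
have y0E : y0 = row_mx (row_mx (cmap (ch z.1) z.1) z.2%:M) zeta^T by exact: cotangent_cmap_self.
have ry0 : cmap (cotangent ch (z.1, usubmx zeta)) (z.1, usubmx zeta) = reduce_covector y0.
  apply: etrans (cotangent_cmap_self atl _) _.
  by rewrite y0E /reduce_covector row_mxKl row_mxKr row_mxKl trmx_usub.
have y0q : rsubmx (rsubmx y0) = q%:M by rewrite y0E row_mxKr -trmx_dsub zq tr_scalar_mx.
have oI : open (image_in ch z.1 U) := image_in_open atl oU.
have cl : {for (0 : R), continuous (fun h : R => lsubmx (lsubmx (h *: v + y0)) : 'rV[R]_3)}.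
  apply: (@continuous_comp _ _ _ (fun h : R => h *: v + y0) (fun y => lsubmx (lsubmx y))).
    by apply: cvgD; [apply: cvgZr_tmp; exact: cvg_id|exact: cvg_cst].
  apply: (@continuous_comp _ _ _ (fun y : 'rV[R]_((3 + 1) + (3 + 1)) => lsubmx y) (fun y => lsubmx y)).
    exact: lsubmx_continuous.
  exact: lsubmx_continuous.
have nI : nbhs (lsubmx (lsubmx ((0 : R) *: v + y0)) : 'rV[R]_3) (image_in ch z.1 U).
  rewrite scale0r add0r y0E !row_mxKl; apply: open_nbhs_nbhs; split=> //.
  exact: image_in_mem (cdom_self atl _) Uz.
have nh : \forall h \near (0 : R), image_in ch z.1 U (lsubmx (lsubmx (h *: v + y0))) by exact: (cl _ nI).
apply: filterS nh => h [p [pd _] pE].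
have hd : cdom (ch z.1) (cinv (ch z.1) (lsubmx (lsubmx (h *: v + y0)))).
  by rewrite -pE (cmapK atl pd).
have hq : rsubmx (rsubmx (h *: v + y0)) = q%:M by rewrite !linearP /= vq y0q scaler0 add0r.
have P1 := momentum_lift_in X1 zeta (usubmx zeta) hd hq.
have P2 := momentum_lift_in X2 zeta (usubmx zeta) hd hq.
rewrite ry0 -reduce_covector_line.
exact: (congr2 (fun r s => 2^-1 * (r ^+ 2 + s ^+ 2)) P1 P2).
Qed.

Lemma dsubmx_charge (zeta : 'cV[R]_(3 + 1)) : dsubmx zeta = (charge zeta)%:M.
Proof.
rewrite /charge /pairing /vertical -[in RHS](vsubmxK zeta) mul_row_col mul0mx add0r mul1mx.
exact: mx11_scalar.
Qed.

Lemma trans_jac_usubmx z0 z (zeta : 'cV[R]_(3 + 1)) : cdom (chbar z0) z ->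
  usubmx (trans_jac chbar z0 z z *m zeta) = trans_jac ch z0.1 z.1 z.1 *m usubmx zeta.
Proof.
move=> zz; have atl := ms_atlas S.
apply: etrans (congr1 (fun C => usubmx (C *m zeta))
  (times_line_trans_jac atl zz (cdom_self atl z.1))) _.
by rewrite -[zeta in LHS]vsubmxK mul_block_col col_mxKu mul0mx addr0.
Qed.

(** Testing Hamilton's equation with d/dw shows that the charge has derivative 0; testing it with
    vectors that have no w-component and no charge component gives the equation on the cotangent
    bundle of M. *)
Lemma normal_velocity (c : R -> M * R) (zeta : R -> 'cV[R]_(3 + 1)) t U X1 X2 h :
  F U X1 X2 -> U (c t).1 ->
  hamiltonian_vector chbar (normal_hamiltonian (lift_vec A X1) (lift_vec A X2)) (c t, zeta t) h ->
  has_velocity (cotangent chbar) (fun s => (c s, zeta s)) t h ->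
  [/\ is_derive t 1 (fun s => charge (zeta s)) 0,
      hamiltonian_vector ch (magnetic_hamiltonian X1 X2 (charge (zeta t)))
        ((c t).1, usubmx (zeta t)) (reduce_covector h) &
      has_velocity (cotangent ch) (fun s => ((c s).1, usubmx (zeta s))) t (reduce_covector h)].
Proof.
move=> FU Ut Hh /has_velocity_cotangent [hv hx]; have [oU _ _ _] := FU.
have atl := ms_atlas S; have atlb := times_line_atlas atl.
have Hv := (hamiltonian_vectorP atlb _ (c t, zeta t) h).1 Hh.
have red v : rsubmx (rsubmx v) = 0 ->
    (rsubmx v *m (lsubmx h)^T - lsubmx v *m (rsubmx h)^T) 0 0 =
    dfun (cotangent ch) (magnetic_hamiltonian X1 X2 (charge (zeta t)))
      ((c t).1, usubmx (zeta t)) (reduce_covector v).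
  move=> v0; apply: etrans (Hv v) _.
  exact (dfun_reduce X1 X2 (z := c t) oU Ut (dsubmx_charge (zeta t)) v0).
have [cd _] := hv.
split.
- have k0 : (@vertical R *m (rsubmx h)^T) 0 0 = 0.
    have := red (row_mx (@vertical R) 0); rewrite row_mxKr row_mxKl linear0 => /(_ erefl).
    have -> : reduce_covector (row_mx (@vertical R) 0) = 0.
      by rewrite /reduce_covector row_mxKr !row_mxKl linear0 row_mx0.
    rewrite mul0mx sub0r mxE => /eqP; rewrite eqr_oppLR => /eqP ->.
    rewrite /dfun derive_line; under eq_fun do rewrite scaler0.
    by rewrite derive_cst oppr0.
  have dw : is_derive (t : R) (1 : R) (fun _ : R => @vertical R) 0 by exact: is_derive_cst.
  have /is_derive_mxP /(_ 0 0) := is_derive_mulmx dw hx; rewrite mul0mx add0r k0.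
  apply: near_eq_is_derive; apply: filterS cd => s cs.
  by rewrite mulmxA (vertical_trans_jac S).
- apply/hamiltonian_vectorP => // v.
  pose v' : 'rV[R]_((3 + 1) + (3 + 1)) := row_mx (row_mx (lsubmx v) 0) (row_mx (rsubmx v) 0).
  have rv : reduce_covector v' = v.
    by rewrite /reduce_covector /v' row_mxKl row_mxKr !row_mxKl hsubmxK.
  have v'0 : rsubmx (rsubmx v') = 0 by rewrite /v' !row_mxKr.
  have := red v' v'0; rewrite rv => <-.
  have E (a : 'rV[R]_3) (b : 'rV[R]_(3 + 1)) :
      row_mx a (0 : 'rV[R]_1) *m b^T = a *m (lsubmx b)^T.
    by rewrite -[b in LHS]hsubmxK tr_row_mx mul_row_col mul0mx addr0.
  by rewrite /v' /reduce_covector !row_mxKr !row_mxKl !E.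
- apply/has_velocity_cotangent; split.
    by rewrite /reduce_covector row_mxKl; exact: has_velocity_fst hv.
  have du : is_derive t 1 (fun s => usubmx (trans_jac chbar (c t) (c s) (c s) *m zeta s))
      (usubmx (rsubmx h)^T).
    have := is_derive_trmx (is_derive_lsubmx (is_derive_trmx hx)).
    rewrite trmxK trmx_lsub; apply: near_eq_is_derive; apply: filterE => s.
    by rewrite trmx_lsub trmxK.
  have -> : (rsubmx (reduce_covector h))^T = usubmx (rsubmx h)^T.
    by rewrite /reduce_covector row_mxKr trmx_lsub.
  apply: near_eq_is_derive du; apply: filterS cd => s cs.
  exact: trans_jac_usubmx.
Qed.

Lemma normal_projection (I : set R) (c : R -> M * R) : open I -> is_interval I ->
  normal_trajectory chbar Fbar I c ->
  exists q : R, magnetic_geodesic ch F A q I (fun t => (c t).1).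
Proof.
move=> oI iI [zeta H].
have step U X1 X2 t : F U X1 X2 -> I t -> U (c t).1 -> exists h,
  [/\ is_derive t 1 (fun s => charge (zeta s)) 0,
      hamiltonian_vector ch (magnetic_hamiltonian X1 X2 (charge (zeta t)))
        ((c t).1, usubmx (zeta t)) h &
      has_velocity (cotangent ch) (fun s => ((c s).1, usubmx (zeta s))) t h].
  move=> FU It Ut.
  have FV : Fbar (U `*` setT) (lift_vec A X1) (lift_vec A X2) by exists U, X1, X2.
  have [h Hh hv] := H _ _ _ FV t It (conj Ut Logic.I).
  by exists (reduce_covector h); exact: (normal_velocity FU Ut Hh hv).
have dq t : I t -> is_derive t 1 (fun s => charge (zeta s)) 0.
  move=> It; have [U [X1 [X2 [FU Ut]]]] := frame_at S (c t).1.
  by have [h []] := step _ _ _ t FU It Ut.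
have le_const s t : I s -> I t -> s <= t -> charge (zeta s) = charge (zeta t).
  move=> Is It st.
  have H0 w : s <= w <= t -> exists2 d : R, is_derive (w : R) 1 (fun r => charge (zeta r)) d & `|d| <= 0.
    by move=> wst; exists 0; [apply: dq; exact: iI wst|rewrite normr0].
  have := derive_lipschitz_sym (lexx 0) H0 (s := s) (t := t).
  rewrite !lexx st mul0r normr_le0 subr_eq0 => H1; exact/eqP/H1.
(* On an empty interval there is no time at which to read off the charge, and any value will do. *)
have [I0|nI0] := pselect (exists t0, I t0); last first.
  exists 0, (fun t => usubmx (zeta t)) => U X1 X2 FU t It.
  by case: nI0; exists t.
have [t0 It0] := I0; exists (charge (zeta t0)), (fun t => usubmx (zeta t)).
move=> U X1 X2 FU t It Ut; have [h [_ Hh hv]] := step _ _ _ t FU It Ut.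
have -> : charge (zeta t0) = charge (zeta t).
  by have [tt|/ltW tt] := leP t0 t; [exact: le_const|exact/esym/le_const].
by exists h.
Qed.

End NormalProjection.

(** Every flag element is generated from sections of the span of the frames, and such a section can
    have a value at [p] only if some frame is defined there. *)
Lemma flag_frame_exists (R : realType) n (T : topologicalType) (ch : charted R n T)
    (F : @frames R n T) U k X p : flag ch (frame_span F) U k X -> U p ->
  exists V Y1 Y2, F V Y1 Y2 /\ V p.
Proof.
move=> fl Up; elim: fl => {k X} //.
by move=> X _ EX; have [V [Y1 [Y2 [FV Vp _]]]] := EX p Up; exists V, Y1, Y2.
Qed.

Theorem theorem2 (R : realType) (M : topologicalType) (ch : charted R 3 M)
    (omega : M -> 'cV[R]_3) (g : M -> 'M[R]_3) (X0 : M -> 'rV[R]_3)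
    (beta : M -> 'M[R]_3) (A : M -> 'cV[R]_3) :
  let F := contact_frame ch omega g in
  let Fbar := lift_frames A F in
  let chbar := times_line ch in
  let Dbar := frame_span Fbar in
  smooth_manifold ch ->
  connected [set: M] ->
  contact_sub_riemannian ch omega g ->
  reeb ch omega X0 ->
  magnetic_field ch omega g X0 beta ->
  magnetic_potential ch omega g X0 beta A ->
  bracket_generating chbar Dbar ->
  [/\ (* (a) *)
      (forall (I : set R) (gammabar : R -> (M * R)%type),
         open I -> is_interval I ->
         normal_trajectory chbar Fbar I gammabar ->
         exists q : R,
           magnetic_geodesic ch F A q I (fun t => (gammabar t).1)),
      (* (b) *)
      (forall (a b : R) (gammabar : R -> (M * R)%type), a < b ->
         abnormal_trajectory chbar Fbar a b gammabar ->
         let gamma := fun t => (gammabar t).1 in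
         horizontal_curve ch F a b gamma /\
         {ae @lebesgue_measure R, forall t, a <= t <= b ->
            exists v, has_velocity ch gamma t v /\
              forall w, form2 (beta (gamma t)) v w = 0}),
      (forall pbar : M * R, beta pbar.1 != 0 -> has_step chbar Dbar pbar 3) &
      (* existence and uniqueness, up to reparametrization, of the abnormal
         trajectory through a point of the region where beta does not vanish *)
      (forall pbar : M * R, beta pbar.1 != 0 ->
         exists (J : set R) (gammabar : R -> (M * R)%type),
         [/\ open J, is_interval J, J 0 & gammabar 0 = pbar] /\
         [/\ (forall t, J t -> beta (gammabar t).1 != 0),
             unit_speed chbar Fbar J gammabar,
             (forall a b : R, a < b -> (forall t, a <= t <= b -> J t) ->
                abnormal_trajectory chbar Fbar a b gammabar) &
             (forall (a b t0 : R) (eta : R -> (M * R)%type), a < b ->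
                abnormal_trajectory chbar Fbar a b eta ->
                (forall t, a <= t <= b -> beta (eta t).1 != 0) ->
                a <= t0 <= b -> eta t0 = pbar ->
                exists phi : R -> R,
                [/\ {within `[a, b], continuous phi}, phi t0 = 0 &
                    forall t, a <= t <= b ->
                      J (phi t) /\ eta t = gammabar (phi t)])])].
Proof.
move=> F Fbar chbar Dbar [hM M2 charts trans] _ Hc Hr Hb Ha bg.
(* Local orthonormal frames come from bracket generation: the full tangent space at [(p, 0)]
   contains at least the zero vector, whose flag element exhibits a lifted frame over the point. *)
have frames_at p : exists ep : 'rV[R]_3 * 'rV[R]_3, exists U X1 X2,
    [/\ F U X1 X2, U p, ep.1 = X1 p & ep.2 = X2 p].
  have [k [_ full _]] := bg (p, 0).
  have : flag_at chbar Dbar k (p, 0) 0 by rewrite full.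
  move=> [V [X [_ Vp fl _]]].
  have [W [Y1 [Y2 [[U [X1 [X2 [FU WE _ _]]]] Wp]]]] := flag_frame_exists fl Vp.
  by exists (X1 p, X2 p), U, X1, X2; split=> //; move: Wp; rewrite WE => -[].
have [e He] := boolp.choice frames_at.
have S : magnetic_setting ch omega g X0 beta A (fun p => (e p).1) (fun p => (e p).2).
  by split.
split.
- exact: (normal_projection S).
- by move=> a b gammabar _ ab gamma; exact: (abnormal_projection S M2 ab).
- by move=> pbar bp; exact: (lifted_step3 S bp).
- by move=> pbar bp; exact: (abnormal_exists_unique S hM M2 bp).
Qed.
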